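(* There exist an absolute constant $c>0$ and a universal polynomial $p$ in five variables (independent of all the data below, and nonnegative on $[0,\infty)^4\times\mathbb{R}$) such that the following holds. Let $\|\cdot\|_*$ be a norm on $\mathbb{R}^m$ and let $X$ be a random variable on a nondegenerate lattice $\mathcal{L}\subset\mathbb{R}^m$ with $\mathcal{L} = \operatorname{span}_{\mathbb{Z}}\operatorname{supp}X$. Suppose $\Sigma := \mathbb{E}[XX^\dagger]$ has least eigenvalue $\sigma$, and $(\mathbb{E}\|Z\|_2^\eta)^{1/\eta} = L < \infty$ for some $\eta > 2$, where $Z := \Sigma^{-1/2}X$. Put $$N_3 := c\max\left\{\frac{R_*^2\,\rho_*(\mathcal{L})^2}{\sigma},\; p\left(m,\; s(Z)^{-1},\; L,\; \tfrac{1}{\eta-2},\; \log\frac{\det\mathcal{L}}{\sqrt{\det\Sigma}}\right)^{1+\frac{1}{\eta-2}}\right\}.$$ If $n \ge N_3$ and $M$ is an $m\times n$ random matrix whose columns are independent copies of $X$, then $$\operatorname{disc}_*(M) \le 2\rho_*(\mathcal{L})$$ with probability at least $1 - 3n^{-\frac{\eta-2}{2+\eta}}$.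
   Context: A lattice is a discrete subgroup of $\mathbb{R}^m$; it is nondegenerate if its real span is $\mathbb{R}^m$. $\det\mathcal{L}$ is the (absolute value of the) determinant of any matrix whose columns form a basis of $\mathcal{L}$. The dual of a lattice $\mathcal{L}'$ is $\mathcal{L}'^* = \{z : \langle z,\lambda\rangle\in\mathbb{Z}\ \text{for all } \lambda\in\mathcal{L}'\}$. For the norm $\|\cdot\|_*$: $\operatorname{disc}_*(M) = \min_{y \in \{\pm1\}^n} \|My\|_*$; $d_*(x,S) = \inf_{y\in S}\|x-y\|_*$; $\rho_*(S) = \sup_{x \in \operatorname{span}_{\mathbb{R}} S} d_*(x,S)$ is the covering radius; $R_*$ is the maximum Euclidean length of a vector $x$ with $\|x\|_* = 1$. Spanningness: with $\mathcal{L}' = \Sigma^{-1/2}\mathcal{L}$, define $\tilde Z(\theta) := \sqrt{\mathbb{E}[|\langle\theta,Z\rangle \bmod 1|^2]}$, where $y \bmod 1$ is the representative of $y$ modulo $\mathbb{Z}$ in $(-1/2,1/2]$. A vector $\theta$ is pseudodual if $\tilde Z(\theta)\le d(\theta,\mathcal{L}'^* )/2$, with $d$ Euclidean distance. Then $s(Z) := \inf\{\tilde Z(\theta) : \theta \text{ pseudodual},\ \theta\notin\mathcal{L}'^*\}$, equal to $\infty$ if there is no such $\theta$. Conventions: $s(Z)^{-1}=0$ if $s(Z)=\infty$, and $N_3=\infty$ (nothing is claimed) if $s(Z)=0$. *)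

(* Defs.v *)
From mathcomp Require Import all_boot all_order all_algebra.
From mathcomp Require Import all_classical all_reals all_analysis.
From mathcomp Require mpoly.
Set Implicit Arguments.
Unset Strict Implicit.
Unset Printing Implicit Defensive.
Import Order.TTheory GRing.Theory Num.Theory.
Import numFieldNormedType.Exports.

Local Open Scope classical_set_scope.
Local Open Scope ring_scope.

(* Vectors of R^m are columns 'cV[R]_m.  The norm `|x| that the library puts
   on 'cV[R]_m is the sup norm; it is not used here, only its topology is. *)

Section Vectors.
Context {R : realType} {m : nat}.
Implicit Types (N : 'cV[R]_m -> R) (S L : set 'cV[R]_m).

Definition dotv (x y : 'cV[R]_m) : R := \sum_(i < m) x i 0 * y i 0.

Definition enorm (x : 'cV[R]_m) : R := Num.sqrt (dotv x x).

Definition is_norm N : Prop :=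
  [/\ forall x, N x = 0 -> x = 0,
      forall (a : R) x, N (a *: x) = `|a| * N x &
      forall x y, N (x + y) <= N x + N y].

Definition rspan S : set 'cV[R]_m :=
  [set x | exists (k : nat) (a : 'I_k -> R) (v : 'I_k -> 'cV[R]_m),
     (forall i, S (v i)) /\ x = \sum_(i < k) a i *: v i].

Definition zspan S : set 'cV[R]_m :=
  [set x | exists (k : nat) (a : 'I_k -> int) (v : 'I_k -> 'cV[R]_m),
     (forall i, S (v i)) /\ x = \sum_(i < k) v i *~ a i].

Definition is_lattice L : Prop :=
  [/\ L 0, forall x y, L x -> L y -> L (x - y) & L `<=` isolated L].

Definition nondegenerate_lattice L : Prop := rspan L = [set: 'cV[R]_m].

(* A basis of a nondegenerate lattice: m linearly independent columns whose
   integer combinations are exactly the points of L. *)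
Definition lattice_basis L (B : 'M[R]_m) : Prop :=
  B \in unitmx /\
  L = [set B *m map_mx (fun a : int => a%:~R) z | z in [set: 'cV[int]_m]].

(* The common value of `|\det B| over the bases B of L (0 if there is none). *)
Definition lattice_det L : R :=
  xget 0 [set `|\det B| | B in [set B | lattice_basis L B]].

Definition dual_lattice L : set 'cV[R]_m :=
  [set z | forall l, L l -> dotv z l \is a Num.int].

Definition norm_dist N (x : 'cV[R]_m) S : R := inf [set N (x - y) | y in S].

(* The real-valued sup is the supremum for every lattice: the set is nonempty
   and bounded. *)
Definition covering_radius N S : R := sup [set norm_dist N x S | x in rspan S].

(* The maximum is attained as soon as 0 < m, by compactness of the unit sphere
   of a norm. *)
Definition max_enorm N : R := sup [set enorm x | x in [set x | N x = 1]].

(* The minimum is over a finite nonempty set. *)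
Definition disc N (n : nat) (M : 'M[R]_(m, n)) : R :=
  inf [set N (M *m y) |
       y in [set y : 'cV[R]_n | forall j, y j 0 = 1 \/ y j 0 = -1]].

Definition least_eigenvalue (A : 'M[R]_m) (s : R) : Prop :=
  eigenvalue A s /\ forall t, eigenvalue A t -> s <= t.

Definition pos_def (A : 'M[R]_m) : Prop :=
  A^T = A /\ forall x : 'cV[R]_m, x != 0 -> 0 < dotv x (A *m x).

(* A^(-1/2), i.e. the unique positive definite square root of A^-1, when A is
   positive definite. *)
Definition inv_sqrtmx (A : 'M[R]_m) : 'M[R]_m :=
  xget 0 [set S | pos_def S /\ S *m S = invmx A].

End Vectors.

(* The representative of y modulo Z in (-1/2, 1/2]. *)
Definition mod1 (R : realType) (y : R) : R := y - (Num.ceil (y - 2^-1))%:~R.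

(* R^m with its Borel sigma-algebra. *)
Notation borelV R m := (g_sigma_algebraType (@open 'cV[R]_m)).

Section RandomVectors.
Context {R : realType} {m : nat} {d : measure_display} {T : measurableType d}.
Variable P : probability T R.

Definition rv_support (X : T -> 'cV[R]_m) : set 'cV[R]_m :=
  [set x | (0 < P (X @^-1` [set x]))%E].

Definition has_second_moments (X : T -> 'cV[R]_m) : Prop :=
  forall i j, P.-integrable [set: T] (EFin \o (fun w => X w i 0 * X w j 0)).

Definition second_moment_mx (X : T -> 'cV[R]_m) : 'M[R]_m :=
  \matrix_(i, j) fine 'E_P[fun w => X w i 0 * X w j 0].

Definition Ztilde (Z : T -> 'cV[R]_m) (theta : 'cV[R]_m) : R :=
  Num.sqrt (fine 'E_P[fun w => `|mod1 (dotv theta (Z w))| ^+ 2]).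

(* For Z = E[X X^T]^(-1/2) X with X on the lattice L, take L' = E[X X^T]^(-1/2) L. *)
Definition pseudodual (Z : T -> 'cV[R]_m) (L' : set 'cV[R]_m)
    (theta : 'cV[R]_m) : Prop :=
  Ztilde Z theta <= norm_dist enorm theta (dual_lattice L') / 2.

Definition spanningness (Z : T -> 'cV[R]_m) (L' : set 'cV[R]_m) : \bar R :=
  ereal_inf [set (Ztilde Z theta)%:E | theta in
    [set theta | pseudodual Z L' theta /\ ~ dual_lattice L' theta]].

Definition independent_family (n : nat) (Y : 'I_n -> T -> borelV R m) : Prop :=
  forall (J : {set 'I_n}) (B : 'I_n -> set (borelV R m)),
    (forall j, measurable (B j)) ->
    P (\bigcap_(j in [set` J]) (Y j @^-1` B j)) =
    (\prod_(j in J) P (Y j @^-1` B j))%E.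

End RandomVectors.

Definition iid_copies (R : realType) (m n : nat)
    (d d' : measure_display) (T : measurableType d) (T' : measurableType d')
    (P : probability T R) (P' : probability T' R)
    (X : T -> borelV R m) (Y : 'I_n -> T' -> borelV R m) : Prop :=
  [/\ forall j, measurable_fun [set: T'] (Y j),
      forall j (B : set (borelV R m)), measurable B ->
        P' (Y j @^-1` B) = P (X @^-1` B) &
      independent_family P' Y].

(* Polynomials in five variables, evaluated at a point of R^5. *)
Definition poly5 (R : realType) : Type := mpoly.mpoly 5 R.

Definition eval5 (R : realType) (p : poly5 R) (x0 x1 x2 x3 x4 : R) : R :=
  mpoly.meval (tnth [tuple x0; x1; x2; x3; x4]) p.

(* Main.v *)
Require Import Defs.
From mathcomp Require Import all_boot all_order all_algebra.
From mathcomp Require Import all_classical all_reals all_analysis.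
From mathcomp Require Import measurable_realfun spectral complex.
From mathcomp Require Import (canonicals) mpoly.
From mathcomp Require Import zify ring lra.
Import Order.TTheory GRing.Theory Num.Theory.
Import numFieldNormedType.Exports.
Local Open Scope classical_set_scope.
Local Open Scope ring_scope.

(** Let [x_1, ..., x_n] be the columns of the matrix.  Rounding half of their sum
    to the lattice gives a lattice vector [lam] that has norm at most [2 * rho],
    with [rho] the covering radius and up to an arbitrarily small error, and that
    has the parity of [x_1 + ... + x_n]: the two add up to twice a lattice vector.
    It suffices to write this [lam] as a signed sum of the columns, and this is
    done by Fourier analysis.  In integer coordinates write [k_j] for the columns
    and [kl] for [lam].  The number of sign vectors [y] with
    [kl = \sum_j y_j k_j] is, up to a factor, the sum of
    [cos (<kl, t>) * \prod_j cos (<k_j, t>)] over the dual torus.  The torus is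
    discretized with a large modulus [q] that is as divisible as needed, so that
    the sum is finite, and it is enough that this sum be positive
    ([signs_of_char_sum], [char_sum_gt0]).

    After normalization by [Sigma^(-1/2)] the vectors [z_j] are isotropic, and
    the torus splits into points near the dual lattice and far ones.

    - Near the origin the product behaves like the Gaussian
      [exp (- sum_j <k_j, t>^2 / 2)], and the oscillation of [cos (<kl, t>)] has
      to be shown harmless.  There is an integral translation [l] of the torus
      for which [\sum_j <k_j, t> <k_j, l>] is proportional to [<kl, t>]; since
      [q] is divisible by the determinant of [\sum_j k_j k_j^T], it exists.
      Comparing the product at [t + l] and [t - l] with its value at [t], via
      [exp s + exp (- s) >= 2 + s^2 / 4], bounds the mean of [<kl, t>^2] under
      the product by a small constant, because a translation does not change a
      sum over the torus ([near_pair_ge], [near_far_sum_gt0]).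

    - Far from the origin the expected product of the [|cos|] factors is the
      [n]-th power of one expectation, at most [1 - r0^2 / 2] by spanningness:
      a far frequency is either pseudodual, so that [Ztilde] is at least [s], or
      it is not, so that [Ztilde] exceeds half its distance to the dual lattice
      ([Ztilde_gap], [sum_mass_cos]).  Markov's inequality bounds the far part,
      which has to be compared with the number of points very close to the
      origin.  That number is estimated by the pigeonhole principle in a reduced
      basis of the dual lattice ([near_torus_count], [reduced_basis_group]); this
      is where the determinant ratio enters, through its logarithm.

    The random part of the argument takes place on a finite probability space:
    the columns are truncated at [|z| <= tau], which leaves finitely many lattice
    vectors, and the law of the matrix is compared with product weights
    ([sum_prodw_mass_le]).  Three events of probability [n^-((eta-2)/(eta+2))] are
    discarded: a column beyond the truncation, an empirical covariance that is
    not close to the identity (Chernoff, [cov_close_fail]), and a large far part.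
    The truncation level is [L * n^(2/(eta+2))], which makes the first event that
    improbable, and the polynomial lower bound on [n] makes the other two so
    ([parameters]).  The bound on [R_*^2 rho^2 / sigma] says that [lam], once
    normalized, is short compared with [sqrt n]. *)

Set Implicit Arguments.
Unset Strict Implicit.
Unset Printing Implicit Defensive.

(** * The Euclidean structure of column vectors *)

Section Euclid.
Context {R : realType}.
Implicit Types (m n : nat).

Lemma dotvC m (x y : 'cV[R]_m) : dotv x y = dotv y x.
Proof. by apply: eq_bigr => i _; rewrite mulrC. Qed.

Lemma dotvDl m (x y z : 'cV[R]_m) : dotv (x + y) z = dotv x z + dotv y z.
Proof. by rewrite /dotv -big_split; apply: eq_bigr => i _; rewrite mxE mulrDl. Qed.

Lemma dotvDr m (x y z : 'cV[R]_m) : dotv z (x + y) = dotv z x + dotv z y.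
Proof. by rewrite dotvC dotvDl !(dotvC z). Qed.

Lemma dotvZl m a (x y : 'cV[R]_m) : dotv (a *: x) y = a * dotv x y.
Proof. by rewrite /dotv mulr_sumr; apply: eq_bigr => i _; rewrite mxE mulrA. Qed.

Lemma dotvZr m a (x y : 'cV[R]_m) : dotv x (a *: y) = a * dotv x y.
Proof. by rewrite dotvC dotvZl dotvC. Qed.

Lemma dotvNl m (x y : 'cV[R]_m) : dotv (- x) y = - dotv x y.
Proof. by rewrite -scaleN1r dotvZl mulN1r. Qed.

Lemma dotvNr m (x y : 'cV[R]_m) : dotv x (- y) = - dotv x y.
Proof. by rewrite dotvC dotvNl dotvC. Qed.

Lemma dotvBl m (x y z : 'cV[R]_m) : dotv (x - y) z = dotv x z - dotv y z.
Proof. by rewrite dotvDl dotvNl. Qed.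

Lemma dotv0l m (x : 'cV[R]_m) : dotv 0 x = 0.
Proof. by rewrite /dotv big1 // => i _; rewrite mxE mul0r. Qed.

Lemma dotv0r m (x : 'cV[R]_m) : dotv x 0 = 0.
Proof. by rewrite dotvC dotv0l. Qed.

Lemma dotv_suml m (I : Type) (r : seq I) (Q : pred I) (f : I -> 'cV[R]_m) y :
  dotv (\sum_(i <- r | Q i) f i) y = \sum_(i <- r | Q i) dotv (f i) y.
Proof.
elim/big_rec2: _ => [|i a b _ <-]; first by rewrite dotv0l.
by rewrite dotvDl.
Qed.

Lemma dotv_sumr m (I : Type) (r : seq I) (Q : pred I) (f : I -> 'cV[R]_m) y :
  dotv y (\sum_(i <- r | Q i) f i) = \sum_(i <- r | Q i) dotv y (f i).
Proof. by rewrite dotvC dotv_suml; apply: eq_bigr => i _; rewrite dotvC. Qed.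

Lemma dotvE m (x y : 'cV[R]_m) : dotv x y = (x^T *m y) 0 0.
Proof. by rewrite mxE; apply: eq_bigr => i _; rewrite mxE. Qed.

Lemma dotv_mulmxl m n (A : 'M[R]_(m, n)) x y :
  dotv (A *m x) y = dotv x (A^T *m y).
Proof. by rewrite !dotvE trmx_mul mulmxA. Qed.

Lemma dotv_mulmxr m n (A : 'M[R]_(m, n)) x y :
  dotv y (A *m x) = dotv (A^T *m y) x.
Proof. by rewrite dotvC dotv_mulmxl dotvC. Qed.

Lemma dotv_ge0 m (x : 'cV[R]_m) : 0 <= dotv x x.
Proof. by apply: sumr_ge0 => i _; rewrite -expr2 sqr_ge0. Qed.

Lemma dotv_eq0 m (x : 'cV[R]_m) : (dotv x x == 0) = (x == 0).
Proof.
apply/eqP/eqP => [|->]; last by rewrite dotv0l.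
move=> /eqP; rewrite psumr_eq0; last by move=> i _; rewrite -expr2 sqr_ge0.
move=> /allP H; apply/colP => i; rewrite mxE.
by have := H i (mem_index_enum _); rewrite mulf_eq0 orbb => /eqP.
Qed.

Lemma dotv_gt0 m (x : 'cV[R]_m) : x != 0 -> 0 < dotv x x.
Proof. by move=> x0; rewrite lt_neqAle dotv_ge0 andbT eq_sym dotv_eq0. Qed.

Lemma cauchy_schwarz m (x y : 'cV[R]_m) :
  dotv x y ^+ 2 <= dotv x x * dotv y y.
Proof.
have [->|y0] := eqVneq y 0; first by rewrite !dotv0r expr0n mulr0.
have yy := dotv_gt0 y0.
have := dotv_ge0 (dotv y y *: x - dotv x y *: y).
rewrite dotvBl !(dotvC _ (_ - _)) !dotvBl !dotvZl !dotvZr (dotvC y x).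
move=> H; have : 0 <= dotv y y * (dotv x x * dotv y y - dotv x y ^+ 2).
  by apply: le_trans H _; rewrite le_eqVlt; apply/orP; left; apply/eqP; ring.
by rewrite pmulr_rge0 // subr_ge0.
Qed.

Lemma enorm_ge0 m (x : 'cV[R]_m) : 0 <= enorm x.
Proof. exact: sqrtr_ge0. Qed.

Lemma sqr_enorm m (x : 'cV[R]_m) : enorm x ^+ 2 = dotv x x.
Proof. by rewrite sqr_sqrtr // dotv_ge0. Qed.

Lemma enorm_eq0 m (x : 'cV[R]_m) : (enorm x == 0) = (x == 0).
Proof. by rewrite -sqrf_eq0 sqr_enorm dotv_eq0. Qed.

Lemma enorm_gt0 m (x : 'cV[R]_m) : x != 0 -> 0 < enorm x.
Proof. by move=> x0; rewrite lt_neqAle enorm_ge0 andbT eq_sym enorm_eq0. Qed.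

Lemma enorm0 m : enorm (0 : 'cV[R]_m) = 0.
Proof. by apply/eqP; rewrite enorm_eq0. Qed.

Lemma norm_dotv m (x y : 'cV[R]_m) : `|dotv x y| <= enorm x * enorm y.
Proof.
rewrite -ler_sqr ?nnegrE ?mulr_ge0 ?enorm_ge0 // real_normK ?num_real //.
by rewrite exprMn !sqr_enorm cauchy_schwarz.
Qed.

Lemma enormZ m a (x : 'cV[R]_m) : enorm (a *: x) = `|a| * enorm x.
Proof.
apply/eqP; rewrite -(@eqrXn2 _ 2) ?mulr_ge0 ?enorm_ge0 // exprMn !sqr_enorm.
by rewrite dotvZl dotvZr real_normK ?num_real // mulrA expr2.
Qed.

Lemma enormD m (x y : 'cV[R]_m) : enorm (x + y) <= enorm x + enorm y.
Proof.
rewrite -ler_sqr ?nnegrE ?addr_ge0 ?enorm_ge0 // sqrrD !sqr_enorm.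
rewrite dotvDl !dotvDr (dotvC y x).
have := le_trans (ler_norm _) (norm_dotv x y).
rewrite mulr2n; lra.
Qed.

Lemma enorm_sum m (I : Type) (r : seq I) (Q : pred I) (f : I -> 'cV[R]_m) :
  enorm (\sum_(i <- r | Q i) f i) <= \sum_(i <- r | Q i) enorm (f i).
Proof.
elim/big_rec2: _ => [|i a b _ H]; first by rewrite enorm0.
by apply: le_trans (enormD _ _) _; rewrite lerD2l.
Qed.

Lemma enorm_le m (x : 'cV[R]_m) (r : R) :
  0 <= r -> (enorm x <= r) = (dotv x x <= r ^+ 2).
Proof. by move=> r0; rewrite -sqr_enorm ler_sqr // nnegrE enorm_ge0. Qed.

Lemma norm_coord m (x : 'cV[R]_m) i : `|x i 0| <= enorm x.
Proof.
rewrite -ler_sqr ?nnegrE ?enorm_ge0 // real_normK ?num_real // sqr_enorm.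
rewrite /dotv (bigD1 i) //= expr2 lerDl.
by apply: sumr_ge0 => j _; rewrite -expr2 sqr_ge0.
Qed.

Lemma enorm_le_sum m (x : 'cV[R]_m) : enorm x <= \sum_i `|x i 0|.
Proof.
have -> : x = \sum_i x i 0 *: delta_mx i 0.
  apply/colP => i; rewrite summxE (bigD1 i) //= big1 ?mxE ?eqxx ?mulr1 ?addr0 //.
  by move=> j ji; rewrite !mxE eq_sym (negPf ji) mulr0.
apply: le_trans (enorm_sum _ _ _) _; apply: ler_sum => i _.
rewrite summxE (bigD1 i) //= big1 ?addr0; last first.
  by move=> j ji; rewrite !mxE eq_sym (negPf ji) mulr0.
rewrite !mxE eqxx mulr1 enormZ ler_piMr //.
have : enorm (delta_mx i 0 : 'cV[R]_m) ^+ 2 = 1.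
  rewrite sqr_enorm /dotv (bigD1 i) //= big1 ?mxE ?eqxx ?mulr1 ?addr0 //.
  by move=> j ji; rewrite mxE (negPf ji) mul0r.
by move=> /eqP; rewrite sqrf_eq1 => /orP[] /eqP -> //; lra.
Qed.

End Euclid.

(** * Reduced bases of lattices *)

Section Lattices.
Context {R : realType}.
Implicit Types (m n : nat).

Definition discrete_group m (L : set 'cV[R]_m) : Prop :=
  [/\ L 0, forall x y, L x -> L y -> L (x - y) &
      exists2 e, 0 < e & forall x, L x -> x != 0 -> e <= dotv x x].

(** Dual form of the spanning condition, which passes to projections. *)
Definition spanning m (L : set 'cV[R]_m) : Prop :=
  forall u, (forall x, L x -> dotv u x = 0) -> u = 0.

Lemma round_le_half (t a : R) : 0 < a -> exists k : int, `|t - k%:~R * a| <= a / 2.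
Proof.
move=> a0; exists (Num.floor (t / a + 2^-1)).
set k := Num.floor _.
have h1 : k%:~R <= t / a + 2^-1 := Num.Theory.floor_le_tmp _.
have h2 : t / a + 2^-1 < (k + 1)%:~R := Num.Theory.floorD1_gt _.
have h3 : t = t / a * a by rewrite divfK // gt_eqF.
rewrite h3 -mulrBl normrM (gtr0_norm a0) mulrC ler_pM2l //.
rewrite intrD in h2.
by rewrite ler_norml; apply/andP; split; lra.
Qed.

Section Group.
Context {m : nat} {L : set 'cV[R]_m}.
Hypothesis L0 : L 0.
Hypothesis LB : forall x y, L x -> L y -> L (x - y).

Lemma group_opp x : L x -> L (- x).
Proof. by move=> Lx; rewrite -sub0r; exact: LB. Qed.

Lemma group_add x y : L x -> L y -> L (x + y).
Proof. by move=> Lx Ly; rewrite -[y]opprK; apply: LB => //; exact: group_opp. Qed.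

Lemma group_mulrz x (k : int) : L x -> L (x *~ k).
Proof.
move=> Lx; case: k => k.
  rewrite -pmulrn; elim: k => [|k IH]; first by rewrite mulr0n.
  by rewrite mulrS; exact: group_add.
rewrite NegzE mulrNz; apply: group_opp; rewrite -pmulrn.
by elim: k.+1 => [|j IH]; rewrite ?mulr0n // mulrS; exact: group_add.
Qed.

Lemma group_sum (I : Type) (r : seq I) (Q : pred I) (f : I -> 'cV[R]_m) :
  (forall i, Q i -> L (f i)) -> L (\sum_(i <- r | Q i) f i).
Proof. by move=> H; apply: big_rec => // i x Qi; apply: group_add; exact: H. Qed.

Lemma group_mulmx n (B : 'M[R]_(m, n)) (z : 'cV[int]_n) :
  (forall i, L (col i B)) -> L (B *m map_mx intr z).
Proof.
move=> LBi.
have -> : B *m map_mx intr z = \sum_i col i B *~ z i 0.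
  apply/colP => i; rewrite mxE summxE; apply: eq_bigr => j _.
  by rewrite -scaler_int !mxE mulrC.
by apply: group_sum => i _; exact: group_mulrz.
Qed.

End Group.

(** A reflection that maps [b] to the first coordinate axis. *)
Lemma householder m (b : 'cV[R]_(1 + m)) :
  exists2 Q : 'M[R]_(1 + m), Q^T *m Q = 1%:M & Q *m b = col_mx (enorm b)%:M 0.
Proof.
set e : 'cV[R]_(1 + m) := col_mx (1%:M : 'M[R]_1) 0.
set v : 'cV[R]_(1 + m) := b - enorm b *: e.
have he : enorm b *: e = col_mx (enorm b)%:M 0.
  by rewrite /e scale_col_mx scaler0 scale_scalar_mx mulr1.
have [v0|v0] := eqVneq v 0.
  exists 1%:M; first by rewrite trmx1 mul1mx.
  by rewrite mul1mx -he; apply/eqP; rewrite -subr_eq0 -/v v0.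
have vv := dotv_gt0 v0.
have ee : dotv e e = 1.
  by rewrite dotvE /e tr_col_mx mul_row_col trmx1 mul1mx mulmx0 addr0 mxE.
have vb : 2 * dotv v b = dotv v v.
  rewrite /v !dotvBl !(dotvC _ (_ - _)) !dotvBl !dotvZl !(dotvC _ (_ *: _)).
  rewrite !dotvZl ee (dotvC e b) -(sqr_enorm b); ring.
have vv1 : v^T *m v = (dotv v v)%:M.
  by apply/matrixP => i j; rewrite !ord1 dotvE [RHS]mxE.
set c := 2 / dotv v v.
exists (1%:M - c *: (v *m v^T)).
  have -> : (1%:M - c *: (v *m v^T))^T = 1%:M - c *: (v *m v^T).
    move: (v) c => w c; apply/matrixP => i j.
    by rewrite !mxE !big_ord1 !mxE eq_sym (mulrC (w i 0)).
  rewrite mulmxBl mul1mx mulmxBr mulmx1.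
  rewrite -scalemxAl -scalemxAr scalerA mulmxA -(mulmxA v) vv1.
  rewrite mul_mx_scalar -scalemxAl scalerA.
  have -> : c * c * dotv v v = c + c by rewrite /c; field; rewrite gt_eqF.
  by rewrite scalerDl; move: (c *: _) => w; rewrite (opprD w) opprK addKr subrK.
rewrite mulmxBl mul1mx -scalemxAl -mulmxA.
have -> : v^T *m b = (dotv v b)%:M.
  by apply/matrixP => i j; rewrite !ord1 dotvE [RHS]mxE.
rewrite mul_mx_scalar scalerA.
have -> : c * dotv v b = 1 by rewrite /c mulrAC vb divff // gt_eqF.
by rewrite scale1r /v opprB addrC addrNK he.
Qed.

Lemma orthogonal_dotv m (Q : 'M[R]_m) x y :
  Q^T *m Q = 1%:M -> dotv (Q *m x) (Q *m y) = dotv x y.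
Proof. by move=> H; rewrite dotv_mulmxl mulmxA H mul1mx. Qed.

(** Only the infimum of the squared lengths is known to be positive, so the
    minimum is replaced by a vector within a factor [3 / 2] of it; the slack
    avoids proving that the infimum is attained. *)
Lemma almost_shortest m (L : set 'cV[R]_m) :
  discrete_group L -> spanning L -> (0 < m)%N ->
  exists b, [/\ L b, b != 0 &
    forall x, L x -> x != 0 -> dotv b b <= 3 / 2 * dotv x x].
Proof.
move=> [L0 LB [e e0 He]] span m0.
pose E := [set dotv x x | x in [set x | L x /\ x != 0]].
have lbE : lbound E e by move=> _ [x [Lx x0] <-]; exact: He.
have E0 : E !=set0.
  apply: contrapT => /set0P/negP; rewrite negbK => /eqP E0.
  have /span : forall x, L x -> dotv (const_mx 1 : 'cV[R]_m) x = 0.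
    move=> x Lx; have [->|x0] := eqVneq x 0; first by rewrite dotv0r.
    have : E (dotv x x) by exists x.
    by rewrite E0.
  by move=> /colP/(_ (Ordinal m0)); rewrite !mxE => /eqP; rewrite oner_eq0.
have hi : has_inf E by split => //; exists e.
have i0 : 0 < inf E by apply: lt_le_trans e0 _; exact: lb_le_inf.
have [|_ [b [Lb b0] <-] Hb] := @inf_adherent _ E (inf E / 2) _ hi; first by lra.
exists b; split => // x Lx x0.
have : inf E <= dotv x x by apply: ge_inf; [case: hi | exists x].
by move: Hb; lra.
Qed.

Lemma dotv_col_mx m n (a c : 'cV[R]_m) (b d : 'cV[R]_n) :
  dotv (col_mx a b) (col_mx c d) = dotv a c + dotv b d.
Proof. by rewrite !dotvE tr_col_mx mul_row_col mxE. Qed.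

Lemma dotv_cV1 (a b : 'cV[R]_1) : dotv a b = a 0 0 * b 0 0.
Proof. by rewrite /dotv big_ord1. Qed.

Lemma sub_axis m (y : 'cV[R]_(1 + m)) (a : R) (k : int) :
  y - (col_mx a%:M 0) *~ k = col_mx (y 0 0 - k%:~R * a)%:M (dsubmx y).
Proof.
rewrite -scaler_int; apply/colP => i; case: (split_ordP i) => j ->.
  by rewrite col_mxEu ord1 !mxE (unsplitK (inl 0)) !mxE eqxx !mulr1n; congr (y _ _ - _); apply/val_inj.
by rewrite col_mxEd !mxE (unsplitK (inr j)) !mxE mulr0 subr0.
Qed.

(** Rotate an almost shortest vector [b] onto the first axis, project the
    lattice along it, and lift a basis of the projection by vectors whose
    first coordinate is at most [|b| / 2].  As [b] is almost shortest, lifting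
    at most doubles a squared length, so that the orthogonality defect stays
    bounded in terms of the dimension. *)
Lemma reduced_basis_group m (L : set 'cV[R]_m) :
  discrete_group L -> spanning L ->
  exists B : 'M[R]_m, [/\ \det B != 0,
    L = [set B *m map_mx intr z | z in [set: 'cV[int]_m]] &
    \prod_i dotv (col i B) (col i B) <= 2 ^+ (m ^ 2) * \det B ^+ 2].
Proof.
elim: m L => [|m IH] L.
  move=> [L0 _ _] _; exists 1%:M; split.
  - by rewrite det1 oner_neq0.
  - apply/seteqP; split => [x _|x _]; last by rewrite (flatmx0 x).
    by exists 0 => //; rewrite (flatmx0 x) flatmx0.
  - by rewrite big_ord0 det1 !expr1n mulr1.
move=> DL SL.
have [b [Lb b0 Hb]] := almost_shortest DL SL isT.
have [L0 LB _] := DL.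
have [Q QQ Qb] := @householder m b.
have QQ' : Q *m Q^T = 1%:M by apply: mulmx1C.
pose a := enorm b.
have a0 : 0 < a by exact: enorm_gt0.
pose G : set 'cV[R]_(1 + m) := [set Q *m x | x in L].
have G0 : G 0 by exists 0; rewrite ?mulmx0.
have GB x y : G x -> G y -> G (x - y).
  by move=> [u Lu <-] [v Lv <-]; exists (u - v); rewrite ?mulmxBr //; exact: LB.
have Gshort y : G y -> y != 0 -> a ^+ 2 <= 3 / 2 * dotv y y.
  move=> [x Lx <-] x0; rewrite orthogonal_dotv // /a sqr_enorm; apply: Hb => //.
  by apply: contra_neq x0 => ->; rewrite mulmx0.
have Ga : G (col_mx a%:M 0) by exists b.
pose L' := [set dsubmx y | y in G].
(* each projected vector lifts with first coordinate at most [a / 2] *)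
have lift x : L' x -> exists t : R, G (col_mx t%:M x) /\ `|t| <= a / 2.
  move=> [y Gy <-]; have [k Hk] := round_le_half (y 0 0) a0.
  exists (y 0 0 - k%:~R * a); split => //.
  have -> : col_mx (y 0 0 - k%:~R * a)%:M (dsubmx y) = y - (col_mx a%:M 0) *~ k.
    by rewrite sub_axis.
  exact: (GB _ _ Gy (group_mulrz G0 GB _ Ga)).
have lift0 t x : G (col_mx t%:M x) -> `|t| <= a / 2 -> x = 0 -> t = 0.
  move=> Gt ta x0; apply/eqP; apply: contraT => t0.
  have y0 : col_mx t%:M x != 0.
    apply: contra_neq t0 => /(congr1 (@usubmx _ 1 m 1)).
    by rewrite col_mxKu => /matrixP/(_ 0 0); rewrite !mxE.
  have := Gshort _ Gt y0; rewrite x0 dotv_col_mx dotv0l addr0 dotv_cV1 !mxE mulr1n.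
  have : t * t <= (a / 2) ^+ 2.
    by rewrite -expr2 -[t ^+ 2]real_normK ?num_real // ler_sqr ?nnegrE //; lra.
  have : 0 < a ^+ 2 by rewrite exprn_gt0.
  by rewrite exprMn; lra.
have tt (t : R) : `|t| <= a / 2 -> t * t <= a ^+ 2 / 4.
  move=> ta; rewrite -expr2 -[t ^+ 2]real_normK ?num_real //.
  have -> : a ^+ 2 / 4 = (a / 2) ^+ 2 by field.
  by rewrite ler_sqr ?nnegrE //; lra.
have long t x : G (col_mx t%:M x) -> `|t| <= a / 2 -> x != 0 ->
    a ^+ 2 <= 12 / 5 * dotv x x.
  move=> Gt ta x0.
  have y0 : col_mx t%:M x != 0.
    apply: contra_neq x0 => /(congr1 (@dsubmx _ 1 m 1)).
    by rewrite col_mxKd => ->; rewrite linear0.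
  have := Gshort _ Gt y0; rewrite dotv_col_mx dotv_cV1 !mxE mulr1n.
  by have := tt _ ta; lra.
have DL' : discrete_group L'.
  split.
  - by exists 0 => //; rewrite linear0.
  - by move=> _ _ [x Gx <-] [y Gy <-]; exists (x - y); rewrite ?linearB //; exact: GB.
  - exists (5 / 12 * a ^+ 2); first by rewrite mulr_gt0 ?exprn_gt0.
    by move=> x /lift[t [Gt ta]] x0; have := long _ _ Gt ta x0; lra.
have SL' : spanning L'.
  move=> u Hu; have /SL : forall x, L x -> dotv (Q^T *m col_mx 0 u) x = 0.
    move=> x Lx; rewrite dotv_mulmxl trmxK -[Q *m x]vsubmxK dotv_col_mx dotv0l add0r.
    by apply: Hu; exists (Q *m x) => //; exists x.
  move=> /(congr1 (mulmx Q)); rewrite mulmxA QQ' mul1mx mulmx0.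
  by move=> /(congr1 (@dsubmx _ 1 m 1)); rewrite col_mxKd linear0.
have [B' [dB' LB' PB']] := IH L' DL' SL'.
have colB' i : L' (col i B').
  rewrite LB'; exists (delta_mx i 0) => //.
  rewrite map_delta_mx /= -colE //.
have /choice[t Ht] i := lift _ (colB' i).
pose B1 : 'M[R]_(1 + m) := block_mx a%:M (\row_i t i) 0 B'.
have col0 : col (lshift m 0) B1 = col_mx a%:M 0.
  by rewrite /B1 block_mxEh colKl; apply/colP => i; rewrite !mxE; case: splitP => j; rewrite !mxE ?ord1.
have colS i : col (rshift 1 i) B1 = col_mx (t i)%:M (col i B').
  rewrite /B1 block_mxEh colKr col_col_mx; congr col_mx.
  by apply/matrixP => u v; rewrite !ord1 !mxE eqxx.
have dB1 : \det B1 = a * \det B' by rewrite det_ublock det_scalar1.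
have GE : G = [set B1 *m map_mx intr z | z in [set: 'cV[int]_(1 + m)]].
  apply/seteqP; split => [y Gy|_ [z _ <-]]; last first.
    apply: (group_mulmx G0 GB) => i; case: (split_ordP i) => j ->.
      by rewrite ord1 col0.
    by rewrite colS; case: (Ht j).
  have : L' (dsubmx y) by exists y.
  rewrite LB' => -[z' _ Hz'].
  pose r := y - B1 *m map_mx intr (col_mx 0 z').
  have Gr : G r.
    apply: (GB _ _ Gy); apply: (group_mulmx G0 GB) => i; case: (split_ordP i) => j ->.
      by rewrite ord1 col0.
    by rewrite colS; case: (Ht j).
  have dr : dsubmx r = 0.
    rewrite /r linearB /= /B1 map_col_mx mul_block_col col_mxKd.
    by rewrite mul0mx add0r Hz' subrr.
  have [k Hk] := round_le_half (r 0 0) a0.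
  have E0 : r - (col_mx a%:M 0) *~ k = col_mx (r 0 0 - k%:~R * a)%:M (0 : 'cV_m).
    by rewrite sub_axis dr.
  have := lift0 (r 0 0 - k%:~R * a) 0; rewrite -E0 => /(_ _ Hk erefl) H.
  have {}H : r 0 0 - k%:~R * a = 0.
    exact: (H (GB _ _ Gr (group_mulrz G0 GB _ Ga))).
  move: E0; rewrite H => /eqP.
  have -> : col_mx (0%:M : 'M[R]_1) (0 : 'cV[R]_m) = 0 
    by rewrite (raddf0 (@scalar_mx R 1)) col_mx0.
  rewrite subr_eq0 => /eqP rE.
  exists (col_mx k%:M z') => //.
  have -> : y = r + B1 *m map_mx intr (col_mx 0 z') by rewrite /r subrK.
  rewrite rE /B1 !map_col_mx !mul_block_col map_mx0 mulmx0 add0r mul0mx add0r.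
  rewrite -scaler_int scale_col_mx scaler0 add_col_mx add0r mul0mx add0r.
  congr col_mx; congr (_ + _); rewrite map_scalar_mx -scalar_mxM mulrC.
  by rewrite scale_scalar_mx.
exists (Q^T *m B1); split.
- rewrite det_mulmx mulf_neq0 //.
    by apply: contraTneq (oner_neq0 R) => dQ; rewrite -(det1 R m.+1) -QQ det_mulmx dQ mul0r eqxx.
  by rewrite dB1 mulf_neq0 // gt_eqF.
- apply/seteqP; split => [x Lx|_ [z _ <-]].
    have : G (Q *m x) by exists x.
    rewrite GE => -[z _ Hz]; exists z => //.
    by rewrite -mulmxA Hz mulmxA QQ mul1mx.
  have : G (B1 *m map_mx intr z) by rewrite GE; exists z.
  by move=> [x Lx Hx]; rewrite -mulmxA -Hx mulmxA QQ mul1mx.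
have -> : \det (Q^T *m B1) ^+ 2 = \det B1 ^+ 2.
  by rewrite det_mulmx exprMn expr2 {2}det_tr -det_mulmx QQ det1 mul1r.
have colQ i : dotv (col i (Q^T *m B1)) (col i (Q^T *m B1)) = dotv (col i B1) (col i B1).
  by rewrite !colE -mulmxA; apply: orthogonal_dotv; rewrite trmxK.
under eq_bigr => i _ do rewrite colQ.
rewrite (@big_split_ord _ _ _ 1 m) big_ord1 /= col0 dotv_col_mx dotv0l addr0 dotv_cV1 !mxE mulr1n.
have H1 : \prod_(i < m) dotv (col (rshift 1 i) B1) (col (rshift 1 i) B1) <=
    \prod_(i < m) (2 * dotv (col i B') (col i B')).
  apply: ler_prod => i _; rewrite dotv_ge0 colS dotv_col_mx dotv_cV1 !mxE mulr1n.
  have [Gt ta] := Ht i.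
  have c0 : col i B' != 0.
    apply: contra_neq dB' => c0; rewrite (expand_det_col _ i) big1 // => j _.
    by move/colP: c0 => /(_ j); rewrite !mxE => ->; rewrite mul0r.
  by rewrite /=; have := tt _ ta; have := long _ _ Gt ta c0; have := dotv_ge0 (col i B'); lra.
rewrite dB1 exprMn -[a * a]expr2 mulrCA; apply: ler_pM => //.
- exact: sqr_ge0.
- by apply: prodr_ge0 => i _; exact: dotv_ge0.
apply: le_trans H1 _; rewrite big_split /= prodr_const card_ord.
apply: (@le_trans _ _ (2 ^+ m * (2 ^+ (m ^ 2) * \det B' ^+ 2))).
  by rewrite ler_pM2l // exprn_gt0.
rewrite mulrA -exprD ler_wpM2r ?sqr_ge0 // ler_weXn2l ?ler1n //.
by rewrite -(addn1 m) sqrnD; lia.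
Qed.

End Lattices.

Section LatticeBasis.
Context {R : realType} {m : nat}.
Implicit Types (L : set 'cV[R]_m) (B C : 'M[R]_m).

Lemma is_lattice_discrete L : is_lattice L -> discrete_group L.
Proof.
move=> [L0 LB Liso]; split => //.
have [_ [V /nbhs_ballP[e /= e0 eV] VL]] := Liso _ L0.
exists (e ^+ 2) => [|x Lx x0]; first by rewrite exprn_gt0.
rewrite leNgt; apply: contraNN x0 => xe; apply/eqP.
have : (V `&` L) x.
  split => //; apply: eV; split => // i j; rewrite ord1 /ball /= mxE sub0r normrN.
  apply: le_lt_trans (norm_coord _ _) _.
  by rewrite -ltr_sqr ?nnegrE ?enorm_ge0 ?ltW // sqr_enorm.
by rewrite VL.
Qed.

Lemma nondegenerate_spanning L : nondegenerate_lattice L -> spanning L.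
Proof.
move=> H u Hu; apply/eqP; rewrite -dotv_eq0; apply/eqP.
have : rspan L u by rewrite H.
move=> [k [a [v [Lv {2}->]]]]; rewrite dotv_sumr big1 // => i _.
by rewrite dotvZr Hu // mulr0.
Qed.

Lemma lattice_reduced_basis L : is_lattice L -> nondegenerate_lattice L ->
  exists2 B, lattice_basis L B &
    \prod_i dotv (col i B) (col i B) <= 2 ^+ (m ^ 2) * \det B ^+ 2.
Proof.
move=> /is_lattice_discrete DL /nondegenerate_spanning SL.
have [B [dB LB PB]] := reduced_basis_group DL SL.
by exists B => //; split => //; rewrite unitmxE unitfE.
Qed.

Lemma lattice_basis_mulmx L B z : lattice_basis L B -> L (B *m map_mx intr z).
Proof. by move=> [_ ->]; exists z. Qed.

Lemma lattice_basis_col L B i : lattice_basis L B -> L (col i B).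
Proof.
move=> LB; rewrite colE.
have -> : delta_mx i 0 = map_mx intr (delta_mx i 0) :> 'cV[R]_m.
  by rewrite map_delta_mx.
exact: lattice_basis_mulmx.
Qed.

Lemma lattice_basis_change L B C : lattice_basis L B -> lattice_basis L C ->
  exists U : 'M[int]_m, C = B *m map_mx intr U.
Proof.
move=> LB LC.
have /choice[f Hf] : forall i, exists z : 'cV[int]_m, B *m map_mx intr z = col i C.
  move=> i; have := lattice_basis_col i LC.
  by have [_ {1}->] := LB; case=> z _ <-; exists z.
exists (\matrix_(i, j) f j i 0); apply/matrixP => i j.
have /colP/(_ i) := Hf j; rewrite !mxE => <-.
by apply: eq_bigr => k _; rewrite !mxE.
Qed.

Lemma lattice_basis_det L B C : lattice_basis L B -> lattice_basis L C ->
  `|\det B| = `|\det C|.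
Proof.
move=> LB LC; have [U CU] := lattice_basis_change LB LC.
have [V BV] := lattice_basis_change LC LB.
have [uB _] := LB.
have dB : \det B != 0 by rewrite -unitfE -unitmxE.
have UV : \det U * \det V = 1.
  have : B *m map_mx intr (U *m V) = B *m map_mx intr (1%:M : 'M[int]_m).
    by rewrite map_mxM mulmxA -CU -BV map_mx1 mulmx1.
  move=> /(congr1 (mulmx (invmx B))); rewrite !mulKmx // => /(congr1 determinant).
  by rewrite !det_map_mx det_mulmx det1 => /intr_inj.
have : `|\det U|%N = 1%N.
  move/(congr1 absz): UV; rewrite abszM => /eqP.
  by rewrite muln_eq1 => /andP[/eqP -> _].
move=> dU; rewrite CU det_mulmx normrM det_map_mx -intr_norm -abszE dU.
by rewrite mulr1.
Qed.

Lemma lattice_detE L B : lattice_basis L B -> lattice_det L = `|\det B|.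
Proof.
move=> LB; rewrite /lattice_det; case: xgetP => [_ -> [C LC <-]|H].
  exact: (lattice_basis_det LC LB).
by have := H `|\det B|; case; exists B.
Qed.

End LatticeBasis.

(** * The inverse square root of a positive definite matrix *)

Section InverseSqrt.
Context {R : realType}.

Lemma interpolation (K : fieldType) (g : K -> K) (s : seq K) :
  exists p : {poly K}, {in s, forall x, p.[x] = g x}.
Proof.
elim: s => [|y s [p Hp]]; first by exists 0.
have [ys|ys] := boolP (y \in s).
  by exists p => x; rewrite inE => /orP[/eqP ->|]; exact: Hp.
pose q := \prod_(z <- s) ('X - z%:P).
have qy : q.[y] != 0.
  rewrite -/(root q y) root_prod_XsubC //.
exists (p + ((g y - p.[y]) / q.[y]) *: q) => x; rewrite !hornerE.
rewrite inE => /orP[/eqP ->|xs]; first by rewrite divfK // addrC subrK.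
have /eqP -> : q.[x] == 0 by rewrite -/(root q x) root_prod_XsubC.
by rewrite mulr0 addr0 Hp.
Qed.

Lemma trmx_horner m (A : 'M[R]_m.+1) (p : {poly R}) :
  A^T = A -> (horner_mx A p)^T = horner_mx A p.
Proof.
move=> AT; elim/poly_ind: p => [|p c IH]; first by rewrite !rmorph0 trmx0.
rewrite !rmorphD !rmorphM /= horner_mx_X horner_mx_C linearD /= tr_scalar_mx.
congr (_ + _); rewrite -mulmxE trmx_mul IH AT.
exact: (comm_mx_horner p (comm_mx_refl A)).
Qed.

Lemma pos_def_unit m (A : 'M[R]_m) : pos_def A -> A \in unitmx.
Proof.
move=> [AT Apos]; rewrite unitmxE unitfE; apply/negP => /det0P[v v0 vA].
have /Apos : v^T != 0 by rewrite trmx_eq0.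
by rewrite -[A]AT -trmx_mul vA trmx0 dotv0r ltxx.
Qed.

Lemma symmetric_eigenvalue m (A : 'M[R]_m) d : A^T = A -> eigenvalue A d ->
  exists2 v : 'cV[R]_m, v != 0 & A *m v = d *: v.
Proof.
move=> AT /eigenvalueP[v vA v0]; exists v^T; first by rewrite trmx_eq0.
by rewrite -{1}AT -trmx_mul vA linearZ.
Qed.

(** Over the complex numbers [A] is unitarily diagonalizable with real
    eigenvalues, so that a real polynomial kills [A] as soon as it vanishes on
    the real spectrum.  Functions of [A] can then be taken by interpolation,
    without leaving the reals. *)
Lemma symmetric_spectrum m (A : 'M[R]_m.+1) : A^T = A ->
  exists s : seq R, {in s, forall d, eigenvalue A d} /\
    forall q, {in s, forall d, q.[d] = 0} -> horner_mx A q = 0.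
Proof.
move=> AT; pose f : {rmorphism R -> R[i]} := real_complex R.
pose AC := map_mx f A.
have Creal : AC \is a mxOver Num.real.
  by apply/mxOverP => i j; rewrite mxE; apply/complex_realP; exists (A i j).
have Csym : AC \is symmetricmx.
  by apply/is_hermitianmxP; rewrite expr0 scale1r map_mx_id // /AC map_trmx AT.
have /orthomx_spectralP := symmetric_normalmx Csym Creal.
have := spectral_unit AC.
have /mxOverP := hermitian_spectral_diag_real (realsym_hermsym Csym Creal).
set P := spectralmx AC; set sp := spectral_diag AC => spreal uP spE.
have /choice[d Hd] i : exists k : R, sp 0 i = f k by exact/complex_realP/spreal.
exists [seq d i | i <- enum 'I_m.+1]; split=> [_ /mapP[i _ ->]|q Hq].
  have /eqP/det0P[v v0 /eqP] : \det (A - (d i)%:M) = 0.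
    apply: (@complexI R); rewrite -[LHS](det_map_mx f) map_mxB map_scalar_mx.
    rewrite -Hd -/AC spE.
    have -> : (sp 0 i)%:M = invmx P *m (sp 0 i)%:M *m P.
      by rewrite mul_mx_scalar -scalemxAl mulVmx // scale_scalar_mx mulr1.
    rewrite -mulmxBl -mulmxBr !det_mulmx.
    rewrite (_ : \det (diag_mx sp - (sp 0 i)%:M) = 0) ?mulr0 ?mul0r ?rmorph0 //.
    rewrite (expand_det_row _ i) big1 // => j _; rewrite !mxE eq_sym.
    by case: eqVneq => [->|_]; rewrite ?mulr1n ?subrr ?mulr0n ?subr0 mul0r.
  rewrite mulmxBr mul_mx_scalar subr_eq0 => /eqP vA.
  by apply/eigenvalueP; exists v.
apply: (@map_mx_inj _ _ f).
rewrite (map_horner_mx f) -/AC map_mx0 spE horner_mx_uconjC // horner_mx_diag.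
rewrite (_ : map_mx _ sp = 0) ?diag_mx0 ?raddf0 ?mulmx0 ?mul0mx //.
apply/rowP => i; rewrite !mxE Hd horner_map /= Hq ?rmorph0 //.
by apply/mapP; exists i => //; rewrite mem_enum.
Qed.

Lemma pos_def_eigenvalue m (A : 'M[R]_m) d : pos_def A -> eigenvalue A d -> 0 < d.
Proof.
move=> [AT Apos] /(symmetric_eigenvalue AT)[v v0 vA].
by have := Apos _ v0; rewrite vA dotvZr pmulr_lgt0 // dotv_gt0.
Qed.

(** The square root of [A^-1] is obtained as a square [T * T], with [T]
    symmetric, so that it is positive definite. *)
Lemma pos_def_inv_sqrt m (A : 'M[R]_m) : pos_def A ->
  exists S : 'M[R]_m, pos_def S /\ S *m S = invmx A.
Proof.
case: m A => [|m] A Apd.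
  exists 0; split; last by rewrite !(flatmx0 _).
  by split => [|x]; rewrite ?trmx0 // (flatmx0 x) eqxx.
have [AT Apos] := Apd.
have [s [Hs sA]] := symmetric_spectrum AT.
have [p Hp] := interpolation (fun x => (Num.sqrt (Num.sqrt x))^-1) s.
set T := horner_mx A p.
have TT : T^T = T by exact: trmx_horner.
have uA := pos_def_unit Apd.
have AT4 : A * T ^+ 4 = 1.
  apply/eqP; rewrite -subr_eq0; apply/eqP.
  have -> : A * T ^+ 4 - 1 = horner_mx A ('X * p ^+ 4 - 1).
    by rewrite rmorphB rmorphM rmorphXn /= horner_mx_X rmorph1.
  apply: sA => d ds.
  rewrite hornerD hornerN hornerM horner_exp hornerX hornerC Hp //.
  have d0 : 0 < d by apply: pos_def_eigenvalue Apd (Hs _ ds).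
  rewrite exprVn (exprM _ 2 2) !sqr_sqrtr ?sqrtr_ge0 ?ltW //.
  by rewrite divff ?subrr ?gt_eqF.
have T4 : T *m T *m (T *m T) = invmx A.
  have -> : T *m T *m (T *m T) = T ^+ 4 by rewrite !mulmxE -!expr2 -exprM.
  by apply: (can_inj (mulKmx uA)); rewrite mulmxV.
exists (T *m T); split => //; split => [|x x0]; first by rewrite trmx_mul TT.
rewrite -mulmxA dotv_mulmxr TT dotv_gt0 //; apply: contra_neq x0 => Tx.
rewrite -[x]mul1mx; have <- : A *m (T *m T *m (T *m T)) = 1%:M by rewrite T4 mulmxV.
by rewrite -!mulmxA Tx !mulmx0.
Qed.

(** Whatever square root the definition selects, it satisfies its specification. *)
Lemma inv_sqrtmxP m (A : 'M[R]_m) : pos_def A ->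
  pos_def (inv_sqrtmx A) /\ inv_sqrtmx A *m inv_sqrtmx A = invmx A.
Proof.
move=> /pos_def_inv_sqrt[S HS]; rewrite /inv_sqrtmx.
by case: xgetP => [_ -> //|/(_ S)[]].
Qed.

(** The matrix [A - s] is the square of a symmetric matrix, obtained by
    interpolating the square root of [x - s] on the spectrum. *)
Lemma least_eigenvalue_form m (A : 'M[R]_m) (s : R) x : A^T = A ->
  least_eigenvalue A s -> s * dotv x x <= dotv x (A *m x).
Proof.
case: m A x => [|m] A x AT [sA sleast].
  by rewrite (flatmx0 x) !dotv0l mulr0.
have [l [Hl lA]] := symmetric_spectrum AT.
have [p Hp] := interpolation (fun x => Num.sqrt (x - s)) l.
set T := horner_mx A p.
have TT : T^T = T by exact: trmx_horner.
have /eqP : horner_mx A ('X - s%:P - p ^+ 2) = 0.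
  apply: lA => d dl; rewrite !hornerD !hornerN horner_exp hornerX hornerC Hp //.
  rewrite sqr_sqrtr ?subrr // subr_ge0.
  exact/sleast/Hl.
rewrite !rmorphB rmorphXn /= horner_mx_X horner_mx_C subr_eq0 -/T => /eqP.
move=> /(congr1 (fun M => dotv x (M *m x))); rewrite mulmxBl mul_scalar_mx.
rewrite expr2 -mulmxE -mulmxA (dotv_mulmxr T) TT dotvDr dotvNr dotvZr => H.
by rewrite -subr_ge0 H dotv_ge0.
Qed.

(** With [u = A^-1 x] one has [s |u|^2 <= <x, u> <= |x| |u|]. *)
Lemma least_eigenvalue_inv m (A : 'M[R]_m) (s : R) x : pos_def A ->
  least_eigenvalue A s -> dotv x (invmx A *m x) <= dotv x x / s.
Proof.
move=> Apd lA; have s0 : 0 < s by apply: pos_def_eigenvalue Apd _; case: lA.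
have uA := pos_def_unit Apd.
set u := invmx A *m x.
have Au : A *m u = x by rewrite /u mulKVmx.
have := least_eigenvalue_form u (proj1 Apd) lA; rewrite Au dotvC => H1.
have H2 := cauchy_schwarz x u.
have [xu|xu] := leP (dotv x u) 0.
  by apply: le_trans xu _; rewrite divr_ge0 ?dotv_ge0 // ltW.
rewrite ler_pdivlMr // -(ler_pM2r xu) -mulrA [s * _]mulrC mulrA -expr2.
apply: (@le_trans _ _ (dotv x x * dotv u u * s)); first by rewrite ler_pM2r.
by rewrite -mulrA ler_wpM2l ?dotv_ge0 // mulrC.
Qed.

End InverseSqrt.

(** * Norms and covering radii *)

Lemma sup_ge0 (R : realType) (A : set R) : (forall x, A x -> 0 <= x) -> 0 <= sup A.
Proof.
move=> A0; have [[[x Ax] ubA]|nA] := pselect (has_sup A); last by rewrite sup_out.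
apply: le_trans (A0 _ Ax) _; apply: sup_upper_bound => //; split => //.
by exists x.
Qed.

Lemma inf_ge0 (R : realType) (A : set R) : (forall x, A x -> 0 <= x) -> 0 <= inf A.
Proof.
move=> A0; have [Ane|/set0P/negP/negPn/eqP->] := pselect (A !=set0).
  exact: lb_le_inf.
by rewrite inf0.
Qed.

Section Norms.
Context {R : realType} {m : nat} {N : 'cV[R]_m -> R}.
Hypothesis HN : is_norm N.

Lemma is_norm_eq0 x : N x = 0 -> x = 0.
Proof. by case: HN => H _ _; exact: H. Qed.

Lemma is_normZ a x : N (a *: x) = `|a| * N x.
Proof. by case: HN. Qed.

Lemma is_normD x y : N (x + y) <= N x + N y.
Proof. by case: HN. Qed.

Lemma is_norm0 : N 0 = 0.
Proof. by rewrite -(scale0r 0) is_normZ normr0 mul0r. Qed.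

Lemma is_normN x : N (- x) = N x.
Proof. by rewrite -scaleN1r is_normZ normrN1 mul1r. Qed.

Lemma is_norm_ge0 x : 0 <= N x.
Proof. by have := is_normD x (- x); rewrite subrr is_norm0 is_normN; lra. Qed.

Lemma is_norm_gt0 x : x != 0 -> 0 < N x.
Proof.
move=> x0; rewrite lt_neqAle is_norm_ge0 andbT eq_sym.
by apply: contra_neq x0; exact: is_norm_eq0.
Qed.

Lemma is_norm_sum (I : Type) (r : seq I) (Q : pred I) (f : I -> 'cV[R]_m) :
  N (\sum_(i <- r | Q i) f i) <= \sum_(i <- r | Q i) N (f i).
Proof.
elim/big_rec2: _ => [|i a b _ H]; first by rewrite is_norm0.
by apply: le_trans (is_normD _ _) _; rewrite lerD2l.
Qed.

Lemma is_norm_dist x y : `|N x - N y| <= N (x - y).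
Proof.
have h1 := is_normD (x - y) y; have h2 := is_normD (y - x) x.
rewrite !subrK in h1 h2; rewrite -opprB is_normN in h2.
by rewrite ler_norml; apply/andP; split; lra.
Qed.

Lemma is_norm_coord (x : 'cV[R]_m) (r : R) : (forall i, `|x i 0| <= r) ->
  N x <= r * \sum_i N (delta_mx i 0).
Proof.
move=> xr; have -> : x = \sum_i x i 0 *: delta_mx i 0.
  apply/colP => i; rewrite summxE (bigD1 i) //= big1 ?mxE ?eqxx ?mulr1 ?addr0 //.
  by move=> j ji; rewrite !mxE eq_sym (negPf ji) mulr0.
apply: le_trans (is_norm_sum _ _ _) _; rewrite mulr_sumr.
by apply: ler_sum => i _; rewrite is_normZ ler_wpM2r ?is_norm_ge0.
Qed.

Lemma rV_coord_norm (u : 'rV[R]_m) i : `|u 0 i| <= `|u|.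
Proof.
have /mapP[j Hj ->] : `|u 0 i| \in [seq `|u x.1 x.2| | x : 'I_1 * 'I_m].
  by apply/mapP; exists (ord0, i) => //=; rewrite mem_enum.
by rewrite [leRHS]/Num.norm /= mx_normrE; apply/bigmax_geP; right => /=; exists j.
Qed.

(** The sup norm and [N] are equivalent by compactness of the sup sphere. *)
Lemma enorm_le_norm : exists C, forall x, enorm x <= C * N x.
Proof.
have [[x0 nx0]|allx] := pselect (exists x : 'cV[R]_m, x != 0); last first.
  exists 0 => x; have [->|xn] := eqVneq x 0; first by rewrite enorm0 mul0r.
  by exfalso; apply: allx; exists x.
pose K : set 'rV[R]_m := [set u | `|u| = 1].
have K0 : K !=set0.
  exists (`|x0^T|^-1 *: x0^T); rewrite /K /= normrZ normfV normr_id mulVf //.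
  by rewrite normr_eq0 trmx_eq0.
have Kc : compact K.
  apply: bounded_closed_compact.
    by exists 1; split => // r r1 u; rewrite /K /= => ->; exact: ltW.
  rewrite (_ : K = (fun u : 'rV[R]_m => `|u|) @^-1` [set 1]) //.
  apply: preimage_closed => [u _|]; first exact: norm_continuous.
  exact: closed_eq.
pose S := \sum_i N (delta_mx i 0).
have S0 : 0 <= S by apply: sumr_ge0 => i _; exact: is_norm_ge0.
have fc : continuous (fun u : 'rV[R]_m => N u^T).
  move=> u; apply/(@cvgrPdist_le _ _ _ (nbhs u)) => e e0; near=> v.
  apply: le_trans (is_norm_dist _ _) _; rewrite -linearB /=.
  apply: (@le_trans _ _ (`|u - v| * (S + 1))).
    apply: le_trans (@is_norm_coord _ `|u - v| _) _.
      by move=> i; rewrite mxE; exact: rV_coord_norm.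
    by rewrite ler_wpM2l // lerDl.
  rewrite -ler_pdivlMr ?ltr_wpDl //.
  near: v; apply: (@cvgr_dist_le _ _ _ _ _ id u) => //.
  by rewrite divr_gt0 // ltr_wpDl.
have [c Kc' cmin] := EVT_min_rV K0 Kc (continuous_subspaceT fc).
have c0 : 0 < N c^T.
  apply: is_norm_gt0; rewrite trmx_eq0 -normr_eq0.
  by move: Kc'; rewrite inE /K /= => ->; exact: oner_neq0.
exists (m%:R / N c^T) => x; have [->|xn] := eqVneq x 0.
  by rewrite enorm0 is_norm0 mulr0.
have x1 : 0 < `|x^T| by rewrite normr_gt0 trmx_eq0.
have H1 : enorm x <= m%:R * `|x^T|.
  apply: le_trans (enorm_le_sum _) _.
  apply: (@le_trans _ _ (\sum_(i < m) `|x^T|)).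
    by apply: ler_sum => i _; have := rV_coord_norm x^T i; rewrite mxE.
  by rewrite sumr_const card_ord mulr_natl.
apply: le_trans H1 _; rewrite -mulrA ler_wpM2l // mulrC ler_pdivlMr //.
have /cmin : `|x^T|^-1 *: x^T \in K.
  by rewrite inE /K /= normrZ normfV normr_id mulVf // gt_eqF.
rewrite linearZ /= trmxK is_normZ ger0_norm ?invr_ge0 //.
by rewrite ler_pdivlMl.
Unshelve. all: by end_near. Qed.

Lemma max_enorm_has_sup x : N x = 1 -> has_sup [set enorm x | x in [set x | N x = 1]].
Proof.
move=> Nx; have [C HC] := enorm_le_norm.
split; first by exists (enorm x), x.
by exists C => _ [y Ny <-]; have := HC y; rewrite Ny mulr1.
Qed.

Lemma max_enorm_ge0 : 0 <= max_enorm N.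
Proof.
apply: sup_ge0 => _ [x _ <-]; exact: enorm_ge0.
Qed.

Lemma enorm_le_max x : enorm x <= max_enorm N * N x.
Proof.
have [->|x0] := eqVneq x 0; first by rewrite enorm0 is_norm0 mulr0.
have Nx := is_norm_gt0 x0.
have N1 : N ((N x)^-1 *: x) = 1.
  by rewrite is_normZ ger0_norm ?invr_ge0 ?ltW // mulVf // gt_eqF.
rewrite -ler_pdivrMr //.
have -> : enorm x / N x = enorm ((N x)^-1 *: x).
  by rewrite enormZ ger0_norm ?invr_ge0 ?ltW // mulrC.
by apply: (sup_upper_bound (max_enorm_has_sup N1)); exists ((N x)^-1 *: x).
Qed.

Lemma norm_dist_has_inf (L : set 'cV[R]_m) x : L 0 -> has_inf [set N (x - y) | y in L].
Proof.
move=> L0; split; first by exists (N (x - 0)), 0.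
by exists 0 => _ [y _ <-]; exact: is_norm_ge0.
Qed.

(** Rounding the coordinates in a basis bounds the distances to the lattice. *)
Lemma covering_has_sup (L : set 'cV[R]_m) : is_lattice L -> nondegenerate_lattice L ->
  has_sup [set norm_dist N x L | x in rspan L].
Proof.
move=> latL nd; have [L0 LB _] := latL.
split; first by exists (norm_dist N 0 L), 0 => //; rewrite nd.
have [B LBasis _] := lattice_reduced_basis latL nd.
exists (\sum_i N (col i B)) => _ [x _ <-].
have /choice[k Hk] i := round_le_half ((invmx B *m x) i 0) (@ltr01 R).
pose z : 'cV[int]_m := \col_i k i.
apply: (@le_trans _ _ (N (x - B *m map_mx intr z))).
  apply: ge_inf; first by case: (norm_dist_has_inf x L0).
  exists (B *m map_mx intr z) => //; exact: lattice_basis_mulmx.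
have [uB _] := LBasis.
have -> : x - B *m map_mx intr z =
    \sum_i ((invmx B *m x) i 0 - (k i)%:~R) *: col i B.
  rewrite -{1}[x](mulKVmx uB) -mulmxBr; apply/colP => i.
  rewrite mxE summxE; apply: eq_bigr => j _.
  by rewrite ![in RHS]mxE [in LHS]mxE mulrC; congr ((_ + _) * _); rewrite !mxE.
apply: le_trans (is_norm_sum _ _ _) _; apply: ler_sum => i _.
rewrite is_normZ ler_piMl ?is_norm_ge0 //.
by have := Hk i; rewrite mulr1; lra.
Qed.

Lemma covering_radius_approx (L : set 'cV[R]_m) x e :
  is_lattice L -> nondegenerate_lattice L -> 0 < e ->
  exists2 l, L l & N (x - l) <= covering_radius N L + e.
Proof.
move=> latL nd e0; have [L0 LB _] := latL.
have [_ [l Ll <-] Hl] := inf_adherent e0 (norm_dist_has_inf x L0).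
exists l => //; apply/ltW/(lt_le_trans Hl); rewrite lerD2r.
by apply: (sup_upper_bound (covering_has_sup latL nd)); exists x => //; rewrite nd.
Qed.

Lemma covering_radius_ge0 (L : set 'cV[R]_m) : 0 <= covering_radius N L.
Proof.
apply: sup_ge0 => _ [x _ <-]; apply: inf_ge0 => _ [y _ <-]; exact: is_norm_ge0.
Qed.

End Norms.

(** * Trigonometric and exponential estimates *)

Section Trigonometry.
Context {R : realType}.
Implicit Types a b x y : R.

Lemma pi_le4 : pi <= 4 :> R.
Proof. by have := @pihalf_lt2 R; lra. Qed.

Lemma sin_mvt x : 0 <= x -> exists2 c, 0 <= c <= x & sin x = cos c * x.
Proof.
move=> x0; have [|c] := @MVT_segment R sin cos 0 x x0 (fun y _ => is_derive_sin y).
  exact/continuous_subspaceT/continuous_sin.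
by rewrite in_itv /= sin0 !subr0 => cx ->; exists c.
Qed.

Lemma norm_sin_le x : `|sin x| <= `|x|.
Proof.
wlog x0 : x / 0 <= x => [H|].
  by have [/H//|/ltW x0] := leP 0 x; rewrite -normrN -(normrN x) -sinN H // oppr_ge0.
have [c _ ->] := sin_mvt x0.
by rewrite normrM ler_piMl // cos_max.
Qed.

Lemma cos_ge x : 1 - x ^+ 2 / 2 <= cos x.
Proof.
have -> : cos x = 1 - 2 * sin (x / 2) ^+ 2.
  have {1}-> : x = (x / 2) *+ 2 by rewrite mulr2n; field.
  by rewrite cos_mulr2n sin2cos2 mulr2n; ring.
have : sin (x / 2) ^+ 2 <= (x / 2) ^+ 2.
  by rewrite -[sin _ ^+ 2]real_normK ?num_real // -[leRHS]real_normK ?num_real // ler_sqr ?nnegrE // norm_sin_le.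
by rewrite exprMn; lra.
Qed.

Lemma sin_ge_half x : 0 <= x <= 1 -> x / 2 <= sin x.
Proof.
move=> /andP[x0 x1]; have [c /andP[c0 cx] ->] := sin_mvt x0.
rewrite mulrC ler_wpM2r //; apply: le_trans (cos_ge c).
have : c ^+ 2 <= 1 by rewrite exprn_ile1 //; lra.
by lra.
Qed.

Lemma cos_le x : `|x| <= pi / 2 -> cos x <= 1 - x ^+ 2 / 8.
Proof.
move=> xpi; rewrite -cos_norm -(real_normK (num_real x)).
move: `|x| (normr_ge0 x) xpi => u u0 xpi.
have -> : cos u = 1 - 2 * sin (u / 2) ^+ 2.
  have {1}-> : u = (u / 2) *+ 2 by rewrite mulr2n; field.
  by rewrite cos_mulr2n sin2cos2 mulr2n; ring.
have h : u / 2 / 2 <= sin (u / 2).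
  by apply: sin_ge_half; have := pi_le4; lra.
have : (u / 2 / 2) ^+ 2 <= sin (u / 2) ^+ 2.
  by rewrite ler_sqr ?nnegrE //; lra.
by rewrite !exprMn; lra.
Qed.

Lemma sin_err x : `|sin x - x| <= `|x| ^+ 3 / 2.
Proof.
wlog x0 : x / 0 <= x => [H|].
  have [/H//|/ltW x0] := leP 0 x.
  by have := H (- x); rewrite sinN -opprD !normrN oppr_ge0 => /(_ x0).
have [c /andP[c0 cx] ->] := sin_mvt x0.
rewrite (ger0_norm x0) -[X in _ - X]mul1r -mulrBl normrM (ger0_norm x0).
rewrite exprSr mulrAC ler_wpM2r // ler_norml.
have := cos_ge c; have := cos_le1 c.
have : c ^+ 2 <= x ^+ 2 by rewrite ler_sqr ?nnegrE.
by move=> ? ? ?; apply/andP; split; lra.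
Qed.

Lemma sin_sub_mul_cos x : `|sin x - x * cos x| <= `|x| ^+ 3 / 2.
Proof.
wlog x0 : x / 0 <= x => [H|].
  have [/H//|/ltW x0] := leP 0 x.
  by have := H (- x); rewrite sinN cosN mulNr -opprD !normrN oppr_ge0 => /(_ x0).
have [c /andP[c0 cx] ->] := sin_mvt x0.
rewrite (ger0_norm x0) [x * _]mulrC -mulrBl normrM (ger0_norm x0).
rewrite exprSr mulrAC ler_wpM2r // ler_norml.
have := cos_ge c; have := cos_le1 c; have := cos_ge x; have := cos_le1 x.
have : c ^+ 2 <= x ^+ 2 by rewrite ler_sqr ?nnegrE.
by move=> ? ? ? ? ?; apply/andP; split; lra.
Qed.

Lemma expR_le_quadratic x : `|x| <= 1 / 2 -> expR x <= 1 + x + 2 * x ^+ 2.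
Proof.
rewrite ler_norml => /andP[x1 x2].
have x1' : 0 < 1 - x by lra.
rewrite -(ler_pM2r x1'); apply: (@le_trans _ _ 1).
  rewrite -[leRHS](expRxMexpNx_1 x) ler_pM2l ?expR_gt0 //.
  by have := expR_ge1Dx (- x); lra.
have : 0 <= x ^+ 2 * (1 - 2 * x) by rewrite mulr_ge0 ?sqr_ge0 //; lra.
lra.
Qed.

(** To second order in [b], translation by [b] acts on [cos a] as on the
    Gaussian [exp (- a^2 / 2)]. *)
Lemma cos_shift_ge a b : `|a| <= 1 / 10 -> `|b| <= 1 / 5 ->
  cos a * expR (- (a * b) - b ^+ 2 - `|b| * `|a| ^+ 3) <= cos (a + b).
Proof.
move=> a1 b1; move Ew: (`|b| * `|a| ^+ 3) => w; move Ex: (X in expR X) => x.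
have ca : 9 / 10 <= cos a.
  apply: le_trans (cos_ge a); rewrite -[a ^+ 2]real_normK ?num_real //.
  have : `|a| ^+ 2 <= (1 / 10) ^+ 2 by rewrite ler_sqr ?nnegrE //; lra.
  lra.
have ca1 := cos_le1 a.
have w0 : 0 <= w by rewrite -Ew mulr_ge0 // exprn_ge0.
have a3 : `|a| ^+ 3 <= 1 / 100.
  have : `|a| ^+ 3 <= (1 / 10) ^+ 3 by apply: lerXn2r; rewrite ?nnegrE //; lra.
  lra.
have xb : `|x| <= `|b| * (1 / 3).
  rewrite -Ex; apply: le_trans (ler_normB _ _) _.
  apply: (@le_trans _ _ (`|b| * `|a| + `|b| * `|b| + `|b| * `|a| ^+ 3)).
    rewrite (ger0_norm w0) Ew lerD2r; apply: le_trans (ler_normB _ _) _.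
    by rewrite normrN normrM mulrC lerD2l normrX expr2.
  by rewrite -!mulrDr ler_wpM2l //; lra.
have xh : `|x| <= 1 / 2 by lra.
have x2 : 2 * x ^+ 2 <= 2 / 9 * b ^+ 2.
  rewrite -[x ^+ 2]real_normK ?num_real // -[b ^+ 2]real_normK ?num_real //.
  have : `|x| ^+ 2 <= (`|b| * (1 / 3)) ^+ 2.
    by rewrite ler_sqr ?nnegrE // mulr_ge0 // divr_ge0.
  rewrite exprMn; have : 0 <= `|b| ^+ 2 by rewrite exprn_ge0.
  clear; move: (`|x| ^+ 2) (`|b| ^+ 2) => u v; lra.
have E := expR_le_quadratic xh.
have b2 := sqr_ge0 b.
(* the two sines, compared with [a * cos a] and [b] *)
have S : sin a * sin b <= a * b * cos a + w / 2 + b ^+ 2 / 20.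
  have -> : sin a * sin b =
      b * (sin a - a * cos a) + a * b * cos a + sin a * (sin b - b) by ring.
  have h1 : b * (sin a - a * cos a) <= w / 2.
    apply: le_trans (ler_norm _) _; rewrite normrM -Ew -mulrA ler_wpM2l //.
    exact: sin_sub_mul_cos.
  have h2 : sin a * (sin b - b) <= b ^+ 2 / 20.
    apply: le_trans (ler_norm _) _; rewrite normrM.
    apply: (@le_trans _ _ (1 / 10 * (`|b| ^+ 3 / 2))).
      by apply: ler_pM => //; [exact: le_trans (norm_sin_le a) a1 | exact: sin_err].
    rewrite exprSr real_normK ?num_real //.
    by have := ler_wpM2l b2 b1; lra.
  lra.
rewrite cosD lerBrDr; apply: (@le_trans _ _ (cos a * (1 + x + 2 * x ^+ 2) +
  (a * b * cos a + w / 2 + b ^+ 2 / 20))).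
  by apply: lerD => //; rewrite ler_pM2l //; lra.
have cb := cos_ge b.
have : cos a * (1 - b ^+ 2 / 2) <= cos a * cos b by rewrite ler_pM2l //; lra.
apply: le_trans.
have : cos a * (1 + x + 2 * x ^+ 2) <= cos a * (1 + x + 2 / 9 * b ^+ 2).
  by rewrite ler_pM2l ?lerD2l //; lra.
have : 9 / 10 * (1 / 4 * b ^+ 2 + w) <= cos a * (1 / 4 * b ^+ 2 + w).
  by rewrite ler_wpM2r //; lra.
have : 0 <= cos a * b ^+ 2 by rewrite mulr_ge0 //; lra.
rewrite -Ex; lra.
Qed.

Lemma expR_pair y : 2 + y ^+ 2 / 4 <= expR y + expR (- y).
Proof.
wlog y0 : y / 0 <= y => [H|].
  have [/H//|/ltW y0] := leP 0 y.
  by have := H (- y); rewrite opprK sqrrN (addrC (expR _)) oppr_ge0 => /(_ y0).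
have -> : expR y = expR (y / 2) ^+ 2.
  by rewrite -expRM_natl; congr expR; rewrite mulr2n; field.
have h1 : (1 + y / 2) ^+ 2 <= expR (y / 2) ^+ 2.
  rewrite ler_sqr ?nnegrE ?expR_ge0 ?expR_ge1Dx //; lra.
have h2 := expR_ge1Dx (- y).
move: h1; rewrite sqrrD expr1n exprMn mul1r mulr2n; lra.
Qed.

Lemma cosDpiz x (k : int) : cos (x + pi * k%:~R) = (-1) ^ k * cos x.
Proof.
have N y n : cos (y + pi * n%:R) = (-1) ^+ n * cos y.
  by have := alternatingn (@cosDpi R) n y; rewrite mulr_natr.
case: k => n; first by rewrite -pmulrn N.
rewrite NegzE mulrNz mulrN -[in RHS](subrK (pi * n.+1%:~R) x) -pmulrn N.
by rewrite mulrA (exprnP (-1) n.+1) -expfzDr ?oppr_eq0 ?oner_eq0 // addNr expr0z mul1r.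
Qed.

Lemma sinDpiz x (k : int) : sin (x + pi * k%:~R) = (-1) ^ k * sin x.
Proof. by rewrite -!cosBpihalf addrAC cosDpiz. Qed.

Lemma norm_signz (k : int) : `|(-1) ^ k : R| = 1.
Proof.
case: k => n; first by rewrite -exprnP normrX normrN1 expr1n.
by rewrite NegzE -exprnN normfV normrX normrN1 expr1n invr1.
Qed.

Lemma norm_cosDpiz x (k : int) : `|cos (x + pi * k%:~R)| = `|cos x|.
Proof. by rewrite cosDpiz normrM norm_signz mul1r. Qed.

Lemma signz_even (k : int) : (-1) ^ (k *+ 2) = 1 :> R.
Proof. by rewrite mulr2n expfzDr ?oppr_eq0 ?oner_eq0 // -expfzMl mulrNN mulr1 exp1rz. Qed.

Lemma norm_mod1 y : `|mod1 y| <= 1 / 2.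
Proof.
rewrite /mod1; set k := Num.ceil _.
have h1 : y - 2^-1 <= k%:~R := Num.Theory.ceil_ge _.
have h2 : (k - 1)%:~R < y - 2^-1 := Num.Theory.ceilB1_lt _.
rewrite intrB in h2.
by rewrite ler_norml; apply/andP; split; lra.
Qed.

(** This is what turns a lower bound on the distance of [<th, Z>] to the integers
    into decay of the characteristic product. *)
Lemma norm_cos_mod1 y : `|cos (pi * y)| <= 1 - mod1 y ^+ 2 / 2.
Proof.
have := norm_mod1 y.
have -> : y = mod1 y + (Num.ceil (y - 2^-1))%:~R by rewrite /mod1 subrK.
rewrite mulrDr norm_cosDpiz /mod1 subrK -/(mod1 y); move: (mod1 y) => u u2.
have u3 : `|pi * u| <= pi / 2.
  by rewrite normrM ger0_norm ?pi_ge0 // ler_pM2l ?pi_gt0 //; lra.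
rewrite ger0_norm; last by apply: cos_ge0_pihalf; rewrite -ler_norml.
apply: le_trans (cos_le u3) _; rewrite lerD2l lerN2 exprMn.
have : 4 * u ^+ 2 <= pi ^+ 2 * u ^+ 2.
  rewrite ler_wpM2r ?sqr_ge0 //; have -> : 4 = 2 ^+ 2 :> R by ring.
  by rewrite ler_sqr ?nnegrE ?pi_ge2 ?pi_ge0.
lra.
Qed.

Lemma one_sub_sum_le_prod (I : Type) (r : seq I) (f : I -> R) :
  (forall i, 0 <= f i <= 1) -> 1 - \sum_(i <- r) (1 - f i) <= \prod_(i <- r) f i.
Proof.
move=> f01; suff [] : 1 - \sum_(i <- r) (1 - f i) <= \prod_(i <- r) f i /\
    0 <= \prod_(i <- r) f i <= 1 by [].
elim: r => [|i r [IH /andP[p0 p1]]]; first by rewrite !big_nil subr0 lexx ler01.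
rewrite !big_cons; have /andP[f0 f1] := f01 i; split.
  have : 0 <= (1 - f i) * (1 - \prod_(j <- r) f j) by rewrite mulr_ge0 // subr_ge0.
  lra.
by rewrite mulr_ge0 //= mulr_ile1.
Qed.

End Trigonometry.

(** * Character sums over a finite torus *)

Notation iv := (map_mx intr).

Section Torus.
Context {R : realType} {m q' : nat}.
Let q := q'.+1.
Local Notation G := 'cV['I_q'.+1]_m.
Implicit Types (x y u k l : 'cV[int]_m).

Definition lift_torus (t : G) : 'cV[int]_m := map_mx (fun i : 'I_q'.+1 => Posz i) t.

Definition reduce_torus x : G := map_mx (fun z : int => inord `|(z %% q)%Z|) x.

Lemma lift_reduce x : exists u, lift_torus (reduce_torus x) = x + u *+ q.
Proof.
exists (\col_i - divz (x i 0) q); apply/colP => i.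
have H : Posz (absz (modz (x i 0) q)) = modz (x i 0) q by rewrite gez0_abs // modz_ge0.
rewrite [RHS]mxE mulmxnE !mxE inordK; last by rewrite -ltz_nat H ltz_pmod.
rewrite H -mulr_natr natz mulNr; apply/eqP; rewrite eq_sym subr_eq addrC.
by rewrite -divz_eq.
Qed.

Lemma torus_eq (s t : G) u : lift_torus s = lift_torus t + u *+ q -> s = t.
Proof.
move=> /colP H; apply/colP => i; apply: val_inj.
have := H i; rewrite [RHS]mxE mulmxnE !mxE -mulr_natr natz => {}H.
have Hs := ltn_ord (s i 0); have Ht := ltn_ord (t i 0).
have : modz (s i 0) q = modz (t i 0) q by rewrite H addrC modzMDl.
by rewrite !modz_small // => -[].
Qed.

Definition qperiodic (f : 'cV[int]_m -> R) : Prop := forall x u, f (x + u *+ q) = f x.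

Lemma reduce_shift_inj l : injective (fun t => reduce_torus (lift_torus t + l)).
Proof.
move=> s t st.
have [u Hu] := lift_reduce (lift_torus s + l).
have [v Hv] := lift_reduce (lift_torus t + l).
apply: (@torus_eq _ _ (v - u)); rewrite mulrnBl; apply: (addIr (l + u *+ q)).
by rewrite addrA -Hu st Hv [RHS]addrACA subrK -!addrA; congr (_ + _); rewrite addrC.
Qed.

Lemma sum_shift (f : 'cV[int]_m -> R) l : qperiodic f ->
  \sum_t f (lift_torus t + l) = \sum_t f (lift_torus t).
Proof.
move=> fq; rewrite [RHS](reindex_inj (@reduce_shift_inj l)).
by apply: eq_bigr => t _; have [u ->] := lift_reduce (lift_torus t + l); rewrite fq.
Qed.

Fact phase_key : unit. Proof. exact: tt. Qed.

(** Locked, so that rewriting with product lemmas does not look inside. *)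
Definition phase k x : R := locked_with phase_key (pi * (dotv (iv x) (iv k) / q%:R)).

Lemma phaseE k x : phase k x = pi * (dotv (iv x) (iv k) / q%:R).
Proof. exact: unlock. Qed.

Lemma dotv_int x k : exists z : int, dotv (iv x) (iv k) = z%:~R :> R.
Proof.
exists (\sum_i x i 0 * k i 0); rewrite /dotv rmorph_sum.
by apply: eq_bigr => i _; rewrite !mxE rmorphM.
Qed.

Lemma phaseDr k x y : phase k (x + y) = phase k x + phase k y.
Proof. by rewrite !phaseE map_mxD dotvDl -mulrDr -mulrDl. Qed.

Lemma phaseDl k l x : phase (k + l) x = phase k x + phase l x.
Proof. by rewrite !phaseE map_mxD dotvDr -mulrDr -mulrDl. Qed.

Lemma phaseNl k x : phase (- k) x = - phase k x.
Proof. by rewrite !phaseE map_mxN dotvNr mulNr mulrN. Qed.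

Lemma phaseNr k x : phase k (- x) = - phase k x.
Proof. by rewrite !phaseE map_mxN dotvNl mulNr mulrN. Qed.

Lemma phase_mulq k x : exists2 z : int,
  dotv (iv x) (iv k) = z%:~R :> R & phase k (x *+ q) = pi * z%:~R.
Proof.
have [z Hz] := dotv_int x k; exists z => //; rewrite phaseE.
have -> : iv (x *+ q) = q%:R *: iv x :> 'cV[R]_m by rewrite raddfMn scaler_nat.
by rewrite dotvZl Hz mulrAC divff ?mul1r // pnatr_eq0.
Qed.

(** A shift by one coordinate multiplies the sum of [exp (2 pi i <t, v> / q)]
    by [exp (2 pi i v_j / q)], so the sum vanishes unless this factor is 1. *)
Lemma char_sum_gt0 v : 0 < \sum_t cos (phase v (lift_torus t) *+ 2) ->
  forall i, (q %| v i ord0)%Z.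
Proof.
move=> C0 i; apply: contraTT C0 => qv.
pose C := \sum_t cos (phase v (lift_torus t) *+ 2).
pose S := \sum_t sin (phase v (lift_torus t) *+ 2).
have per2 x u : exists z : int, phase v (x + u *+ q) *+ 2 = phase v x *+ 2 + pi * (z *+ 2)%:~R.
  have [z _ Hz] := phase_mulq v u; exists z.
  by rewrite phaseDr Hz mulrnDl rmorphMn mulrnAr.
have Cper : qperiodic (fun x => cos (phase v x *+ 2)).
  by move=> x u; have [z ->] := per2 x u; rewrite cosDpiz signz_even mul1r.
have Sper : qperiodic (fun x => sin (phase v x *+ 2)).
  by move=> x u; have [z ->] := per2 x u; rewrite sinDpiz signz_even mul1r.
pose e : 'cV[int]_m := delta_mx i 0.
set a := phase v e *+ 2.
have HC : C = cos a * C - sin a * S.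
  rewrite {1}/C -(sum_shift e Cper) !mulr_sumr -sumrB; apply: eq_bigr => t _.
  by rewrite phaseDr mulrnDl -/a cosD mulrC (mulrC (sin a)).
have HS : S = sin a * C + cos a * S.
  rewrite {1}/S -(sum_shift e Sper) !mulr_sumr -big_split; apply: eq_bigr => t _.
  by rewrite phaseDr mulrnDl -/a sinD addrC mulrC (mulrC (cos a)).
have H0 : (1 - cos a) * C = 0.
  have : ((1 - cos a) ^+ 2 + sin a ^+ 2) * C = 0.
    have h1 : (1 - cos a) * C = - (sin a * S) by rewrite mulrBl mul1r {1}HC; ring.
    have h2 : (1 - cos a) * S = sin a * C by rewrite mulrBl mul1r {1}HS; ring.
    rewrite mulrDl expr2 -mulrA h1 mulrN mulrCA h2; ring.
  have -> : (1 - cos a) ^+ 2 + sin a ^+ 2 = 2 * (1 - cos a).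
    by rewrite sin2cos2; ring.
  by rewrite -mulrA => /eqP; rewrite mulf_eq0 pnatr_eq0 /= => /eqP.
have : 1 - cos a != 0.
  rewrite /a cos_mulr2n -[1 in X in X - _]/(1 : R) cos2sin2.
  have -> : 1 - ((1 - sin (phase v e) ^+ 2) *+ 2 - 1) = 2 * sin (phase v e) ^+ 2.
    by rewrite mulr2n; ring.
  rewrite mulf_neq0 ?pnatr_eq0 // expf_neq0 //.
  have -> : phase v e = pi * ((modz (v i 0) q)%:~R / q%:R) + pi * (divz (v i 0) q)%:~R.
    rewrite -mulrDr phaseE; congr (_ * _).
    have -> : dotv (iv e) (iv v) = (v i 0)%:~R :> R.
      rewrite /dotv (bigD1 i) //= !mxE eqxx mul1r big1 ?addr0 // => j ji.
      by rewrite !mxE (negPf ji) mul0r.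
    rewrite {1}(divz_eq (v i 0) q) rmorphD rmorphM /= addrC mulrDl mulfK //.
    by rewrite -pmulrn pnatr_eq0.
  rewrite sinDpiz; apply: mulf_neq0.
    by rewrite -normr_eq0 norm_signz oner_eq0.
  rewrite gt_eqF //; apply: sin_gt0_pi; apply/andP; split.
    rewrite mulr_gt0 ?pi_gt0 // divr_gt0 ?ltr0n // ltr0z lt_neqAle modz_ge0 // andbT eq_sym.
    by apply: contraNN qv => /eqP qv; apply/dvdz_mod0P.
  rewrite -[ltRHS]mulr1 ltr_pM2l ?pi_gt0 // ltr_pdivrMr ?ltr0n // mul1r.
  by rewrite -[q%:R]/(q%:Z%:~R) ltr_int ltz_pmod.
move: H0 => /eqP; rewrite mulf_eq0 => /orP[->//|/eqP C0 _].
by rewrite -/C C0 ltxx.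
Qed.

(** By [cos A * cos B = (cos (A + B) + cos (A - B)) / 2], one factor at a time. *)
Lemma signs_of_char_sum (I : eqType) (r : seq I) (k : I -> 'cV[int]_m) v : uniq r ->
  0 < \sum_t cos (phase v (lift_torus t)) *
        \prod_(j <- r) cos (phase (k j) (lift_torus t)) ->
  exists y : I -> bool, 0 < \sum_t
    cos (phase (v + \sum_(j <- r) (if y j then k j else - k j)) (lift_torus t)).
Proof.
elim: r v => [|j r IH] v /=.
  move=> _ H; exists (fun => true); rewrite big_nil addr0.
  by under [X in _ < X]eq_bigr => t _ do rewrite -[cos _]mulr1 -(big_nil 1 *%R predT (fun j => cos (phase (k j) (lift_torus t)))).
move=> /andP[jr ur] H.
have ext b : 0 < \sum_t cos (phase (v + (if b then k j else - k j)) (lift_torus t)) *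
        \prod_(i <- r) cos (phase (k i) (lift_torus t)) ->
    exists y : I -> bool, 0 < \sum_t
      cos (phase (v + \sum_(i <- j :: r) (if y i then k i else - k i)) (lift_torus t)).
  move=> /(IH _ ur)[y Hy]; exists (fun i => if i == j then b else y i).
  rewrite big_cons eqxx (eq_big_seq (fun i => if y i then k i else - k i)).
    by rewrite addrA.
  by move=> i ir; case: eqVneq => // ij; rewrite -ij ir in jr.
set S1 := \sum_t cos (phase (v + k j) (lift_torus t)) *
        \prod_(i <- r) cos (phase (k i) (lift_torus t)).
set S2 := \sum_t cos (phase (v - k j) (lift_torus t)) *
        \prod_(i <- r) cos (phase (k i) (lift_torus t)).
have S12 : 0 < S1 + S2.
  apply: lt_le_trans (mulr_gt0 (ltr0n R 2) H) _.
  rewrite mulr_sumr -big_split le_eqVlt; apply/orP; left; apply/eqP.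
  apply: eq_bigr => t _ /=; rewrite big_cons !phaseDl phaseNl cosD cosB; ring.
have [S1p|S1n] := ltP 0 S1; first exact: (ext true).
by apply: (ext false); rewrite -/S2; lra.
Qed.

End Torus.

(** * Positivity of the sum over the near region *)

Section NearFar.
Context {R : realType} {m q' n : nat}.
Let q := q'.+1.
Local Notation G := 'cV['I_q'.+1]_m.
Variables (k : 'I_n -> 'cV[int]_m) (kl g l : 'cV[int]_m).
Local Notation ph := (@phase R m q').
Local Notation lift := (@lift_torus m q').
Let F x : R := \prod_j cos (ph (k j) x).
Let A x : R := ph kl x.

Lemma norm_prod_cos_periodic : (@qperiodic R m q') (fun x => `|F x|).
Proof.
move=> x u; rewrite /F !normr_prod; apply: eq_bigr => j _.
have [z _ Hz] := @phase_mulq R m q' (k j) u.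
by rewrite phaseDr Hz norm_cosDpiz.
Qed.

(** The product changes sign when its argument is shifted by a period, unless
    the total frequency is even. *)
Lemma prod_cos_periodic : kl + \sum_j k j = g *+ 2 ->
  (@qperiodic R m q') (fun x => cos (A x) * F x).
Proof.
move=> Hg x u; rewrite /A /F.
have [z Hz Ez] := @phase_mulq R m q' kl u.
have /choice[y Hy] j : exists y : int, dotv (iv u) (iv (k j)) = y%:~R :> R /\
    ph (k j) (u *+ q) = pi * y%:~R.
  by have [y H1 H2] := @phase_mulq R m q' (k j) u; exists y.
rewrite phaseDr Ez cosDpiz.
under eq_bigr => j _ do rewrite phaseDr (proj2 (Hy j)) cosDpiz.
rewrite big_split /= mulrACA.
have -> : \prod_j (-1) ^ y j = (-1) ^ (\sum_j y j) :> R.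
  rewrite (big_morph (fun z : int => (-1 : R) ^ z) (id1 := 1) (op1 := *%R)) //.
  by move=> a b; rewrite expfzDr // oppr_eq0 oner_eq0.
rewrite -expfzDr ?oppr_eq0 ?oner_eq0 //.
have [w Hw] := @dotv_int R m u g.
have -> : z + \sum_j y j = w *+ 2.
  apply: (@intr_inj R); rewrite rmorphD rmorph_sum /= rmorphMn /= -Hz -Hw.
  under eq_bigr => j _ do rewrite -(proj1 (Hy j)).
  rewrite -dotv_sumr -dotvDr -[RHS]mulr_natl -dotvZr; congr dotv.
  rewrite -(raddf_sum (map_mx (intr : int -> R))) -map_mxD Hg raddfMn.
  by rewrite scaler_nat.
by rewrite signz_even mul1r.
Qed.

Hypothesis parity : kl + \sum_j k j = g *+ 2.
Hypothesis shift : forall x, \sum_j ph (k j) x * ph (k j) l = pi * 2 * A x.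
Variables (near : pred G) (rep : G -> 'cV[int]_m).
Hypothesis repP : forall t, near t -> exists u, rep t = lift t + u *+ q.
Hypothesis small : forall t, near t -> forall j, `|ph (k j) (rep t)| <= 1 / 10.
Hypothesis shift_sq : \sum_j ph (k j) l ^+ 2 <= 1 / 25.
Hypothesis shift_cub : forall t, near t ->
  \sum_j `|ph (k j) l| * `|ph (k j) (rep t)| ^+ 3 <= 1 / 40.

Lemma near_cos_gt0 t j : near t -> 0 < cos (ph (k j) (rep t)).
Proof.
move=> nt; apply: lt_le_trans (cos_ge _).
have : `|ph (k j) (rep t)| ^+ 2 <= 1.
  by rewrite exprn_ile1 //; have := small nt j; lra.
rewrite real_normK ?num_real //; lra.
Qed.

Lemma near_prod_gt0 t : near t -> 0 < F (rep t).
Proof. by move=> nt; apply: prodr_gt0 => j _; exact: near_cos_gt0. Qed.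

(** The factor [9 / 10] absorbs the two error terms of [cos_shift_ge], summed
    over the factors. *)
Lemma near_shift_ge t (s : R) (x : 'cV[int]_m) : near t -> `|s| = 1 ->
  (forall j, ph (k j) x = ph (k j) (rep t) + s * ph (k j) l) ->
  F (rep t) * (9 / 10 * expR (- (s * (pi * 2 * A (rep t))))) <= F x.
Proof.
move=> nt s1 Hx.
have bj j : `|ph (k j) l| <= 1 / 5.
  rewrite -ler_sqr ?nnegrE ?divr_ge0 // real_normK ?num_real //.
  apply: (@le_trans _ _ (\sum_j ph (k j) l ^+ 2)).
    by rewrite (bigD1 j) //= lerDl sumr_ge0 // => i _; exact: sqr_ge0.
  by have := shift_sq; lra.
pose e j := ph (k j) l ^+ 2 + `|ph (k j) l| * `|ph (k j) (rep t)| ^+ 3.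
apply: (@le_trans _ _ (\prod_j (cos (ph (k j) (rep t)) *
    expR (- (ph (k j) (rep t) * (s * ph (k j) l)) - e j)))); last first.
  apply: ler_prod => j _; rewrite mulr_ge0 ?expR_ge0 ?(ltW (near_cos_gt0 j nt)) //=.
  rewrite Hx /e opprD addrA.
  have -> : ph (k j) l ^+ 2 = (s * ph (k j) l) ^+ 2.
    by rewrite exprMn -(real_normK (num_real s)) s1 expr1n mul1r.
  have -> : `|ph (k j) l| = `|s * ph (k j) l| by rewrite normrM s1 mul1r.
  apply: cos_shift_ge; first exact: small.
  by rewrite normrM s1 [X in X <= _]mul1r; exact: bj.
rewrite big_split /= ler_wpM2l ?(ltW (near_prod_gt0 nt)) // -expR_sum.
rewrite big_split /= sumrN mulrC.
have -> : \sum_j ph (k j) (rep t) * (s * ph (k j) l) = s * (pi * 2 * A (rep t)).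
  by rewrite -shift mulr_sumr; apply: eq_bigr => j _; ring.
rewrite expRD ler_wpM2l ?expR_ge0 // sumrN; apply: le_trans (expR_ge1Dx _).
by have := shift_cub nt; have := shift_sq; rewrite /e big_split /=; lra.
Qed.

(** The terms linear in the shift cancel between [l] and [- l], and what is left
    is a gain proportional to the square of the phase of [kl]. *)
Lemma near_pair_ge t : near t ->
  F (rep t) * (9 / 5 + 18 / 5 * A (rep t) ^+ 2) <= F (rep t + l) + F (rep t - l).
Proof.
move=> nt.
have h1 : F (rep t) * (9 / 10 * expR (- (1 * (pi * 2 * A (rep t))))) <= F (rep t + l).
  by apply: near_shift_ge; rewrite ?normr1 // => j; rewrite phaseDr mul1r.
have h2 : F (rep t) * (9 / 10 * expR (- (-1 * (pi * 2 * A (rep t))))) <= F (rep t - l).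
  apply: near_shift_ge; rewrite ?normrN1 // => j.
  by rewrite phaseDr mulN1r phaseNr.
apply: le_trans (lerD h1 h2); rewrite -mulrDr ler_wpM2l ?(ltW (near_prod_gt0 nt)) //.
rewrite mulN1r opprK mul1r.
have := expR_pair (pi * 2 * A (rep t)).
have : 4 * A (rep t) ^+ 2 <= pi ^+ 2 * A (rep t) ^+ 2.
  rewrite ler_wpM2r ?sqr_ge0 //; have -> : 4 = 2 ^+ 2 :> R by ring.
  by rewrite ler_sqr ?nnegrE ?pi_ge2 ?pi_ge0.
rewrite !exprMn; lra.
Qed.

(** Translating by [l] costs at most the far part, so that [near_pair_ge],
    summed over the near region, bounds the mean of [A^2] under [F] there; the
    oscillation of [cos A] is then negligible. *)
Lemma near_far_sum_gt0 :
  0 < \sum_(t | near t) F (rep t) ->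
  \sum_(t | ~~ near t) `|F (lift t)| <= 1 / 20 * \sum_(t | near t) F (rep t) ->
  0 < \sum_t cos (A (lift t)) * F (lift t).
Proof.
set NF := \sum_(t | near t) _; set FF := \sum_(t | ~~ near t) _ => NF0 FFle.
have rep_norm t : near t -> `|F (lift t)| = F (rep t).
  move=> nt; have [u Hu] := repP nt; rewrite -(norm_prod_cos_periodic _ u) -Hu.
  by rewrite gtr0_norm // near_prod_gt0.
have total : \sum_t `|F (lift t)| = NF + FF.
  rewrite (bigID near) /=; congr (_ + _); apply: eq_bigr => t; exact: rep_norm.
have shifted (y : 'cV[int]_m) : \sum_(t | near t) F (rep t + y) <= NF + FF.
  rewrite -total -(sum_shift y norm_prod_cos_periodic) [leRHS](bigID near) /=.
  apply: (@le_trans _ _ (\sum_(t | near t) `|F (lift t + y)|)).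
    apply: ler_sum => t nt; have [u ->] := repP nt; apply: le_trans (ler_norm _) _.
    by rewrite addrAC norm_prod_cos_periodic.
  by rewrite lerDl sumr_ge0.
set Q := \sum_(t | near t) F (rep t) * A (rep t) ^+ 2.
have HQ : 9 / 5 * NF + 18 / 5 * Q <= 2 * (NF + FF).
  apply: (@le_trans _ _ (\sum_(t | near t) (F (rep t + l) + F (rep t - l)))).
    rewrite !mulr_sumr -big_split /=; apply: ler_sum => t nt.
    by apply: le_trans (near_pair_ge nt); rewrite le_eqVlt; apply/orP; left; apply/eqP; ring.
  by rewrite big_split /=; have := shifted l; have := shifted (- l); lra.
have near_part : NF - Q / 2 <= \sum_(t | near t) cos (A (lift t)) * F (lift t).
  rewrite /NF /Q mulr_suml -sumrB; apply: ler_sum => t nt.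
  have -> : cos (A (lift t)) * F (lift t) = cos (A (rep t)) * F (rep t).
    by have [u ->] := repP nt; rewrite (prod_cos_periodic parity).
  have := ler_wpM2r (ltW (near_prod_gt0 nt)) (cos_ge (A (rep t))); lra.
have far_part : - FF <= \sum_(t | ~~ near t) cos (A (lift t)) * F (lift t).
  rewrite lerNl -sumrN; apply: ler_sum => t _.
  apply: le_trans (ler_norm _) _; rewrite normrN normrM ler_piMl //.
  exact: cos_max.
by rewrite (bigID near) /=; lra.
Qed.

End NearFar.

(** * Lattice vectors near the origin of the dual torus *)

Section Geometry.
Context {R : realType} {m q' : nat}.
Local Notation q := q'.+1.
Local Notation G := 'cV['I_q'.+1]_m.
Local Notation ph := (@phase R m q').
Local Notation lift := (@lift_torus m q').
Variables W D : 'M[R]_m.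
Hypothesis DW : D^T *m W = 1%:M.

Definition dual_point (x : 'cV[int]_m) : 'cV[R]_m := (2 * q%:R)^-1 *: (D *m iv x).

Definition near_torus (r : R) (t : G) : bool :=
  `[< exists u, enorm (dual_point (lift t + u *+ q)) <= r >].

Lemma phase_dual_point k x : ph k x = 2 * pi * dotv (dual_point x) (W *m iv k).
Proof.
rewrite phaseE dotvZl dotv_mulmxl mulmxA DW mul1mx.
have : q%:R != 0 :> R by rewrite pnatr_eq0.
by move: (q%:R : R) => Q Q0; field.
Qed.

(** Cut the torus into [\prod_i K i] boxes of side [q / K i]: the differences
    between points of the same box are near the origin. *)
Lemma near_torus_count (r : R) (K : 'I_m -> nat) : (forall i, 0 < K i)%N ->
  (forall i, m%:R * enorm (col i D) <= 2 * r * (K i)%:R) -> 0 <= r ->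
  (q ^ m <= \prod_i K i * #|[pred t | near_torus r t]|)%N.
Proof.
move=> K0 HK r0.
have cellP (t : G) i : ((t i ord0 * K i) %/ q < K i)%N.
  by rewrite ltn_divLR // mulnC ltn_pmul2l // K0.
pose cell (t : G) : {dffun forall i : 'I_m, 'I_(K i)} := [ffun i => Ordinal (cellP t i)].
have close (s t : G) : cell s = cell t -> near_torus r (reduce_torus (lift s - lift t)).
  move=> st; apply/asboolP.
  have [u Hu] := @lift_reduce m q' (lift s - lift t).
  exists (- u); rewrite Hu mulNrn addrK /dual_point enormZ.
  have q0 : (0 : R) < q%:R by rewrite ltr0n.
  rewrite ger0_norm ?invr_ge0 ?mulr_ge0 // ler_pdivrMl ?mulr_gt0 //.
  have -> : D *m iv (lift s - lift t) = \sum_i (iv (lift s - lift t) i 0) *: col i D.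
    apply/colP => i; rewrite mxE summxE; apply: eq_bigr => j _.
    by rewrite ![in RHS]mxE [in LHS]mxE mulrC; congr (_ * _); rewrite !mxE.
  apply: le_trans (enorm_sum _ _ _) _.
  apply: (@le_trans _ _ (\sum_(i < m) (2 * q%:R * r / m%:R))); last first.
    rewrite sumr_const card_ord -[leLHS]mulr_natr; case: (m) => [|m1].
      by rewrite mulr0 !mulr_ge0 // ltW.
    by rewrite divfK // pnatr_eq0.
  apply: ler_sum => i _.
  have m0 : (0 : R) < m%:R by rewrite ltr0n; case: (m) i => [[]|].
  rewrite enormZ !mxE ler_pdivlMr //.
  have ri : `|(Posz (s i 0) - Posz (t i 0))%:~R : R| * (K i)%:R <= q%:R.
    have := congr1 (fun f : {dffun forall i : 'I_m, 'I_(K i)} => val (f i)) st.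
    rewrite !ffunE /= => e.
    have H a b : ((a * K i) %/ q = (b * K i) %/ q -> a <= b -> (b - a) * K i <= q)%N.
      move=> ab _; rewrite mulnBl leq_subLR.
      have := ltn_pmod (b * K i) (isT : 0 < q)%N; have := divn_eq (b * K i) q.
      have := divn_eq (a * K i) q; rewrite ab.
      move: (a * K i)%N (b * K i)%N => a' b'; move: (b' %/ q * q)%N => c.
      by move: (a' %% q)%N (b' %% q)%N => d d'; clear; lia.
    rewrite -intr_norm -abszE -pmulrn -natrM ler_nat.
    by have [le|/ltnW le] := leqP (s i ord0) (t i ord0); [rewrite distnC|]; rewrite distnEl //; apply: H.
  move: ri (normr_ge0 ((Posz (s i 0) - Posz (t i 0))%:~R : R)).
  move: `|_|%R => a ri a0; rewrite mulrAC -mulrA.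
  apply: (@le_trans _ _ (a * (2 * r * (K i)%:R))); first exact: ler_wpM2l.
  have -> : 2 * q%:R * r = 2 * r * q%:R by ring.
  by rewrite mulrCA ler_wpM2l ?mulr_ge0.
have -> : (q ^ m = #|G|)%N by rewrite card_mx card_ord muln1.
have fiber c : (#|[pred t | cell t == c]| <= #|[pred t | near_torus r t]|)%N.
  case: (pickP (fun t => cell t == c)) => [t0 /eqP t0c|H]; last first.
    by rewrite eq_card0 // => t; rewrite !inE H.
  rewrite -(fintype.card_image (@reduce_shift_inj m q' (- lift t0))); apply: subset_leq_card.
  apply/fintype.subsetP => _ /fintype.imageP[t tc ->]; apply: (close t t0).
  by rewrite t0c; apply/eqP.
have cells : #|{dffun forall i : 'I_m, 'I_(K i)}| = (\prod_i K i)%N.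
  by rewrite card_dep_ffun foldrE big_map big_enum; apply: eq_bigr => i _; rewrite card_ord.
rewrite -cells -sum1_card (partition_big cell predT) //= -sum_nat_const.
by apply: leq_sum => c _; rewrite sum1_card fiber.
Qed.

Variables (n : nat) (k : 'I_n -> 'cV[int]_m).
Let z j : 'cV[R]_m := W *m iv (k j).
Hypothesis cov_le : forall x, \sum_j dotv x (z j) ^+ 2 <= 2 * n%:R * dotv x x.
Hypothesis cov_ge : forall x, n%:R / 2 * dotv x x <= \sum_j dotv x (z j) ^+ 2.

Lemma sum_phase_sq_le x r : enorm (dual_point x) <= r ->
  \sum_j ph (k j) x ^+ 2 <= 2 ^+ 7 * n%:R * r ^+ 2.
Proof.
move=> xr; have r0 : 0 <= r by apply: le_trans xr; exact: enorm_ge0.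
have -> : \sum_j ph (k j) x ^+ 2 = 4 * pi ^+ 2 * \sum_j dotv (dual_point x) (z j) ^+ 2.
  by rewrite mulr_sumr; apply: eq_bigr => j _; rewrite phase_dual_point; ring.
have pi16 : pi ^+ 2 <= 16 :> R.
  have -> : 16 = 4 ^+ 2 :> R by ring.
  by rewrite ler_sqr ?nnegrE ?pi_ge0 ?pi_le4.
have H := cov_le (dual_point x); rewrite enorm_le // in xr.
apply: (@le_trans _ _ (4 * 16 * (2 * n%:R * r ^+ 2))).
  apply: ler_pM => //.
  - by rewrite mulr_ge0 ?sqr_ge0.
  - by apply: sumr_ge0 => j _; exact: sqr_ge0.
  - by rewrite ler_pM2l.
  by apply: le_trans H _; rewrite ler_wpM2l ?mulr_ge0.
by rewrite le_eqVlt; apply/orP; left; apply/eqP; ring.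
Qed.

(** These points supply the positive mass against which the far part is
    weighed. *)
Lemma prod_cos_near_ge x r : 2 ^+ 7 * n%:R * r ^+ 2 <= 1 -> enorm (dual_point x) <= r ->
  1 / 2 <= \prod_j cos (ph (k j) x).
Proof.
move=> nr xr; have S1 := le_trans (sum_phase_sq_le xr) nr.
have a1 j : ph (k j) x ^+ 2 <= 1.
  by apply: le_trans S1; rewrite (bigD1 j) //= lerDl sumr_ge0 // => i _; exact: sqr_ge0.
apply: le_trans (one_sub_sum_le_prod (index_enum 'I_n) _) => [|j]; last first.
  by rewrite cos_le1 andbT; apply: le_trans (cos_ge _); have := a1 j; lra.
have : \sum_j (1 - cos (ph (k j) x)) <= \sum_j ph (k j) x ^+ 2 / 2.
  by apply: ler_sum => j _; have := cos_ge (ph (k j) x); lra.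
by rewrite -mulr_suml; lra.
Qed.

(** An integral solution of [K l = 2 q kl], where [K] is the Gram sum of the
    frequencies, exists as soon as [\det K] divides [q]. *)
Lemma integral_shift kl : (\det (\sum_j k j *m (k j)^T) %| Posz q)%Z ->
  exists l, forall x, \sum_j ph (k j) x * ph (k j) l = pi * 2 * ph kl x.
Proof.
set K := \sum_j _ => /dvdzP[e He].
exists (e *: (\adj K *m kl) *+ 2) => x.
have Kl : K *m (e *: (\adj K *m kl) *+ 2) = kl *+ 2 *+ q.
  rewrite raddfMn /= -scalemxAr mulmxA mul_mx_adj mul_scalar_mx scalerA -He.
  by rewrite -[Posz q]natz scaler_nat mulrnAC.
move: (e *: _ *+ 2) Kl => l Kl.
have -> : \sum_j ph (k j) x * ph (k j) l = (pi / q%:R) ^+ 2 * dotv (iv x) (iv (K *m l)).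
  rewrite mulmx_suml raddf_sum dotv_sumr mulr_sumr; apply: eq_bigr => j _ /=.
  have -> : iv (k j *m (k j)^T *m l) = dotv (iv l) (iv (k j)) *: iv (k j) :> 'cV[R]_m.
    rewrite !map_mxM -map_trmx -mulmxA; apply/colP => i; rewrite mxE big_ord1 [RHS]mxE.
    by rewrite mulrC dotvC dotvE.
  by rewrite !phaseE dotvZr; ring.
have -> : iv (K *m l) = (2 * q%:R) *: iv kl :> 'cV[R]_m.
  by rewrite Kl !raddfMn /= -mulrnA -natrM scaler_nat.
rewrite dotvZr phaseE.
have : q%:R != 0 :> R by rewrite pnatr_eq0.
by move: (q%:R : R) => Q Q0; field.
Qed.

(** The dual point [u] of such a shift [l] satisfies
    [n / 2 * |u|^2 <= \sum_j <u, z_j>^2 = <u, W kl>]. *)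
Lemma shift_sum_sq_le kl l : (0 < n)%N ->
  (forall x, \sum_j ph (k j) x * ph (k j) l = pi * 2 * ph kl x) ->
  2 ^+ 7 * 25 * dotv (W *m iv kl) (W *m iv kl) <= n%:R ->
  \sum_j ph (k j) l ^+ 2 <= 1 / 25.
Proof.
move=> n0 Hl klb; set u := dual_point l.
have n0' : (0 : R) < n%:R by rewrite ltr0n.
have pi16 : pi ^+ 2 <= 16 :> R.
  have -> : 16 = 4 ^+ 2 :> R by ring.
  by rewrite ler_sqr ?nnegrE ?pi_ge0 ?pi_le4.
have E1 : \sum_j ph (k j) l ^+ 2 = 4 * pi ^+ 2 * \sum_j dotv u (z j) ^+ 2.
  by rewrite mulr_sumr; apply: eq_bigr => j _; rewrite phase_dual_point; ring.
set P := \sum_j dotv u (z j) ^+ 2 in E1 *.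
have P0 : 0 <= P by apply: sumr_ge0 => j _; exact: sqr_ge0.
have E2 : P = dotv u (W *m iv kl).
  have : 4 * pi ^+ 2 * P = 4 * pi ^+ 2 * dotv u (W *m iv kl).
    rewrite -E1; under eq_bigr do rewrite expr2.
    by rewrite Hl phase_dual_point; ring.
  by apply: mulfI; rewrite mulf_neq0 ?pnatr_eq0 // expf_neq0 // gt_eqF ?pi_gt0.
have H1 : P ^+ 2 <= dotv u u * dotv (W *m iv kl) (W *m iv kl).
  by rewrite {1}E2; exact: cauchy_schwarz.
have H2 := cov_ge u; rewrite -/P in H2.
have H3 : P * n%:R <= 2 * dotv (W *m iv kl) (W *m iv kl).
  have [P1|P1] := leP P 0.
    apply: (@le_trans _ _ 0); last by rewrite mulr_ge0 ?dotv_ge0.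
    by rewrite pmulr_lle0.
  rewrite -(ler_pM2r P1) mulrAC -expr2.
  apply: (@le_trans _ _ (dotv u u * dotv (W *m iv kl) (W *m iv kl) * n%:R)).
    by rewrite ler_wpM2r.
  have := ler_wpM2r (dotv_ge0 (W *m iv kl)) H2; lra.
have H4 : 64 * (P * 25) <= 1.
  rewrite -(ler_pM2r n0') mul1r; apply: le_trans klb.
  have -> : 2 ^+ 7 = 128 :> R by ring.
  lra.
rewrite E1; have : pi ^+ 2 * P <= 16 * P by rewrite ler_wpM2r.
lra.
Qed.

(** By Cauchy-Schwarz, with [|a_j|^3] bounded by [alpha^2 * |a_j|]. *)
Lemma shift_cub_le (a b : 'I_n -> R) (alpha A : R) : 0 <= alpha ->
  (forall j, `|a j| <= alpha) -> \sum_j a j ^+ 2 <= A ->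
  \sum_j b j ^+ 2 <= 1 / 25 -> alpha ^+ 4 * A <= 1 / 64 ->
  \sum_j `|b j| * `|a j| ^+ 3 <= 1 / 40.
Proof.
move=> al0 aal sa sb al4; set S := \sum_j _.
have S0 : 0 <= S by apply: sumr_ge0 => j _; rewrite mulr_ge0 // exprn_ge0.
rewrite -ler_sqr ?nnegrE ?divr_ge0 //.
have := cauchy_schwarz (\col_j `|b j|) (\col_j (`|a j| ^+ 3)).
have -> : dotv (\col_j `|b j|) (\col_j (`|a j| ^+ 3)) = S.
  by apply: eq_bigr => j _; rewrite !mxE.
have -> : dotv (\col_j `|b j|) (\col_j `|b j|) = \sum_j b j ^+ 2.
  by apply: eq_bigr => j _; rewrite !mxE -expr2 real_normK ?num_real.
have D1 : dotv (\col_j (`|a j| ^+ 3)) (\col_j (`|a j| ^+ 3)) <= alpha ^+ 4 * A.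
  apply: (@le_trans _ _ (\sum_j alpha ^+ 4 * a j ^+ 2)).
    apply: ler_sum => j _; rewrite !mxE -exprD (exprD _ 4 2) real_normK ?num_real //.
    rewrite ler_wpM2r ?sqr_ge0 //; apply: lerXn2r; rewrite ?nnegrE //.
  by rewrite -mulr_sumr ler_wpM2l // exprn_ge0.
move=> /le_trans; apply; apply: (@le_trans _ _ (1 / 25 * (1 / 64))); last by lra.
apply: ler_pM => //; first by apply: sumr_ge0 => j _; exact: sqr_ge0.
- exact: dotv_ge0.
- exact: le_trans D1 al4.
Qed.

(** The deterministic core: if the lattice vectors have nearly isotropic second
    moments, are not too long, and their characteristic product is small away
    from the origin of the dual torus, then every short vector of the right
    parity is a signed sum of them. *)
Lemma signed_sum_of_small_far (T r0 r1 : R) (K : 'I_m -> nat)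
    (kl g : 'cV[int]_m) : (0 < n)%N ->
  kl + \sum_j k j = g *+ 2 ->
  (forall j, enorm (z j) <= T) -> 0 <= r1 <= r0 ->
  8 * (r0 * T) <= 1 / 10 ->
  (8 * (r0 * T)) ^+ 4 * (2 ^+ 7 * n%:R * r0 ^+ 2) <= 1 / 64 ->
  2 ^+ 7 * n%:R * r1 ^+ 2 <= 1 ->
  2 ^+ 7 * 25 * dotv (W *m iv kl) (W *m iv kl) <= n%:R ->
  (forall i, 0 < K i)%N ->
  (forall i, m%:R * enorm (col i D) <= 2 * r1 * (K i)%:R) ->
  40 * (\prod_i K i)%:R * \sum_(t | ~~ near_torus r0 t)
    \prod_j `|cos (ph (k j) (lift t))| <= (q ^ m)%:R ->
  (\det (\sum_j k j *m (k j)^T) %| Posz q)%Z ->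
  (forall i, `|kl i ord0| + \sum_j `|k j i ord0| < Posz q) ->
  exists y : 'I_n -> bool, kl = \sum_j (if y j then k j else - k j).
Proof.
move=> n0 Hg zT /andP[r10 r1r0] r0T r0T4 nr1 klb K0 HK far Kq qbig.
have [l Hl] := integral_shift kl Kq.
pose near := near_torus r0.
have /choice[rep repP] t : exists x, near t ->
    (exists u, x = lift t + u *+ q) /\ enorm (dual_point x) <= r0.
  have [/asboolP[u Hu]|nt] := boolP (near t); last by exists 0.
  by exists (lift t + u *+ q) => _; split => //; exists u.
have T0 : 0 <= T by apply: le_trans (zT (Ordinal n0)); exact: enorm_ge0.
have r00 : 0 <= r0 by apply: le_trans r1r0.
have phT x j : enorm (dual_point x) <= r0 -> `|ph (k j) x| <= 8 * (r0 * T).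
  move=> xr; rewrite phase_dual_point normrM normrM ger0_norm // ger0_norm ?pi_ge0 //.
  have -> : 8 * (r0 * T) = 2 * 4 * (r0 * T) by ring.
  apply: ler_pM => //; first by rewrite mulr_ge0 ?pi_ge0.
    by rewrite ler_pM2l // pi_le4.
  apply: le_trans (norm_dotv _ _) _.
  by apply: ler_pM; rewrite ?enorm_ge0 //; exact: zT.
have sb := shift_sum_sq_le n0 Hl klb.
have repq t : near t -> exists u, rep t = lift t + u *+ q by case/repP.
have repr t : near t -> enorm (dual_point (rep t)) <= r0 by case/repP.
have small t : near t -> forall j, `|ph (k j) (rep t)| <= 1 / 10.
  by move=> nt j; apply: le_trans r0T; apply: phT; exact: repr.
have cub t : near t ->
    \sum_j `|ph (k j) l| * `|ph (k j) (rep t)| ^+ 3 <= 1 / 40.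
  move=> nt; apply: (shift_cub_le _ _ _ sb r0T4); first by rewrite !mulr_ge0.
    by move=> j; apply: phT; exact: repr.
  exact/sum_phase_sq_le/repr.
set NF := \sum_(t | near t) \prod_j cos (ph (k j) (rep t)).
have K0' : (0 : R) < (\prod_i K i)%:R.
  by rewrite ltr0n; apply: prodn_gt0.
have NFge : (q ^ m)%:R <= (\prod_i K i)%:R * (2 * NF) :> R.
  apply: (@le_trans _ _ ((\prod_i K i)%:R * #|[pred t | near_torus r1 t]|%:R)).
    by rewrite -natrM ler_nat; exact: near_torus_count.
  rewrite ler_pM2l // -sum1_card natr_sum.
  apply: (@le_trans _ _ (\sum_(t | near_torus r1 t) (2 * \prod_j cos (ph (k j) (rep t))))).
    apply: ler_sum => t /asboolP[u Hu].
    have nt : near t by apply/asboolP; exists u; apply: le_trans r1r0.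
    have -> : \prod_j cos (ph (k j) (rep t)) = \prod_j cos (ph (k j) (lift t + u *+ q)).
      have [v Hv] := repq _ nt.
      rewrite -[LHS]gtr0_norm; last exact: (near_prod_gt0 small).
      rewrite Hv (norm_prod_cos_periodic k) -(norm_prod_cos_periodic k _ u) ger0_norm //.
      by apply: le_trans (prod_cos_near_ge nr1 Hu); rewrite divr_ge0.
    by have := prod_cos_near_ge nr1 Hu; lra.
  rewrite mulr_sumr [leRHS](bigID (near_torus r1)) /= [X in _ <= X + _](eq_bigl (near_torus r1)).
    rewrite lerDl; apply: sumr_ge0 => t /andP[nt _].
    by rewrite mulr_ge0 // ltW //; exact: (near_prod_gt0 small).
  move=> t; case: (boolP (near_torus r1 t)) => [/asboolP[u Hu]|]; last by rewrite andbF.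
  by rewrite andbT; apply/asboolP; exists u; apply: le_trans r1r0.
have q0 : (0 : R) < (q ^ m)%:R by rewrite ltr0n expn_gt0.
have NF0 : 0 < NF.
  have : 0 < (\prod_i K i)%:R * (2 * NF) by apply: lt_le_trans NFge.
  by rewrite pmulr_rgt0 // pmulr_rgt0.
have farle : \sum_(t | ~~ near t) `|\prod_j cos (ph (k j) (lift t))| <= 1 / 20 * NF.
  under [X in X <= _]eq_bigr => t _ do rewrite normr_prod.
  move: (le_trans far NFge); rewrite -/near; set FF := \sum_(t | _) _ => H.
  have : 40 * FF <= 2 * NF by rewrite -(ler_pM2l K0') mulrCA mulrA.
  lra.
have := near_far_sum_gt0 Hg Hl repq small sb cub NF0 farle.
move=> /(signs_of_char_sum (index_enum_uniq _))[y Hy].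
pose s := \sum_j (if y j then k j else - k j); rewrite -/s in Hy.
exists (fun j => ~~ y j); pose v := g - \sum_(j | ~~ y j) k j.
have wv : kl + s = v *+ 2.
  rewrite /v mulrnBl -Hg -addrA; congr (_ + _).
  rewrite /s (bigID y) /= [X in X + _](eq_bigr k) => [|j ->//].
  rewrite [X in _ + X](eq_bigr (fun j => - k j)) => [|j /negPf ->//].
  by rewrite sumrN (bigID y predT k) /= mulr2n opprD addrA addrK.
have v0 : v = 0.
  apply/colP => i; rewrite [RHS]mxE.
  have qv : (Posz q %| v i ord0)%Z.
    apply: (@char_sum_gt0 R m q' v); apply: lt_le_trans Hy _; rewrite wv.
    by rewrite le_eqVlt; apply/orP; left; apply/eqP; apply: eq_bigr => t _; rewrite !mulr2n phaseDl.
  have : `|v i ord0 *+ 2| <= `|kl i ord0| + \sum_j `|k j i ord0|.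
    rewrite -mulmxnE -wv mxE; apply: le_trans (ler_normD _ _) _; rewrite lerD2l.
    rewrite /s summxE; apply: le_trans (ler_norm_sum _ _ _) _.
    by apply: ler_sum => j _; case: (y j); rewrite ?mxE ?normrN.
  move=> /le_lt_trans/(_ (qbig i)); case/dvdzP: qv => e ->.
  have [->|e0] := eqVneq e 0; first by rewrite mul0r.
  have : 1 <= `|e| by rewrite -gtz0_ge1 normr_gt0.
  rewrite normrMn normrM [`|Posz _|]ger0_norm //; move: `|e| => a a1.
  by rewrite -mulr_natr ltNge -{1}[Posz q]mul1r -mulrA ler_pM // -{1}[Posz q]mulr1 ler_wpM2l.
move/eqP: wv; rewrite v0 mul0rn addr_eq0 => /eqP ->; rewrite -sumrN.
by apply: eq_bigr => j _; case: (y j); rewrite ?opprK.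
Qed.

End Geometry.

(** * Product weights on finite sets *)

Section ProductWeights.
Context {R : realType} {A : finType} {n : nat}.
Variable p : A -> R.
Hypothesis p0 : forall a, 0 <= p a.
Hypothesis p1 : \sum_a p a <= 1.
Local Notation Om := {ffun 'I_n -> A}.

(** The product measure, where [p] may have total mass below [1]: the missing
    mass is that of the truncated vectors. *)
Definition prodw (om : Om) : R := \prod_j p (om j).

Lemma prodw_ge0 om : 0 <= prodw om.
Proof. by apply: prodr_ge0. Qed.

Lemma sum_prodw_prod (f : A -> R) :
  \sum_om prodw om * \prod_j f (om j) = (\sum_a p a * f a) ^+ n.
Proof.
rewrite -[in RHS](card_ord n) -prodr_const bigA_distr_bigA.
by apply: eq_bigr => om _; rewrite /prodw -big_split.
Qed.

Lemma sum_prodw_ge (e : R) : 1 - e <= \sum_a p a -> 1 - n%:R * e <= \sum_om prodw om.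
Proof.
have -> : \sum_om prodw om = (\sum_a p a) ^+ n.
  transitivity (\sum_om prodw om * \prod_j (fun=> 1) (om j)).
    by apply: eq_bigr => om _; rewrite big1 ?mulr1.
  rewrite (sum_prodw_prod (fun=> 1)); congr (_ ^+ _).
  by apply: eq_bigr => a _; rewrite mulr1.
move=> pe; rewrite -[in leRHS](card_ord n) -prodr_const.
apply: le_trans (one_sub_sum_le_prod (index_enum 'I_n) _) => [|j]; last first.
  by rewrite p1 sumr_ge0.
rewrite sumr_const card_ord lerD2l lerN2 -[leLHS]mulr_natl ler_wpM2l //; lra.
Qed.

Lemma prodw_markov (F : Om -> R) (c : R) : 0 < c -> (forall om, 0 <= F om) ->
  \sum_(om | c <= F om) prodw om <= (\sum_om prodw om * F om) / c.
Proof.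
move=> c0 F0; rewrite ler_pdivlMr // mulr_suml [leRHS](bigID (fun om => c <= F om)) /=.
apply: (@le_trans _ _ (\sum_(om | c <= F om) prodw om * F om)).
  by apply: ler_sum => om cF; rewrite ler_wpM2l // prodw_ge0.
by rewrite lerDl sumr_ge0 // => om _; rewrite mulr_ge0 // prodw_ge0.
Qed.

(** Exponential moments factor over the columns, and
    [exp y <= 1 + y + 2 y^2] for [|y| <= 1 / 2]. *)
Lemma chernoff (f : A -> R) (mu V l x : R) :
  0 <= l -> (forall a, `|l * f a| <= 1 / 2) -> \sum_a p a * f a <= mu ->
  \sum_a p a * f a ^+ 2 <= V ->
  \sum_(om : Om | x <= \sum_j f (om j)) prodw om <= expR (n%:R * (l * mu + 2 * l ^+ 2 * V) - l * x).
Proof.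
move=> l0 lf fmu fV.
apply: (@le_trans _ _ (\sum_(om : Om | expR (l * x) <= \prod_j expR (l * f (om j))) prodw om)).
  rewrite [leRHS](bigID (fun om : Om => x <= \sum_j f (om j))) /=.
  rewrite [X in _ <= X + _](eq_bigl (fun om : Om => x <= \sum_j f (om j))).
    by rewrite lerDl sumr_ge0 // => om _; exact: prodw_ge0.
  move=> om; case: (boolP (x <= _)) => [xf|]; rewrite ?andbF //= andbT.
  by rewrite -expR_sum ler_expR -mulr_sumr ler_wpM2l.
apply: le_trans (prodw_markov (expR_gt0 _) _) _ => [om|].
  by apply: prodr_ge0 => j _; exact: expR_ge0.
rewrite (sum_prodw_prod (fun a => expR (l * f a))) expRB ler_wpM2r ?invr_ge0 ?expR_ge0 //.
rewrite expRM_natl; apply: lerXn2r; rewrite ?nnegrE ?expR_ge0 //.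
  by apply: sumr_ge0 => a _; rewrite mulr_ge0 // expR_ge0.
apply: le_trans (expR_ge1Dx _).
apply: (@le_trans _ _ (\sum_a (p a + l * (p a * f a) + 2 * l ^+ 2 * (p a * f a ^+ 2)))).
  apply: ler_sum => a _; apply: le_trans (ler_wpM2l (p0 a) (expR_le_quadratic (lf a))) _.
  by rewrite le_eqVlt; apply/orP; left; apply/eqP; ring.
rewrite !big_split -!mulr_sumr /= -addrA lerD // lerD // ler_wpM2l // mulr_ge0 ?sqr_ge0 //.
Qed.

Section Covariance.
Context {m : nat}.
Variables (z : A -> 'cV[R]_m) (T : R).
Hypothesis m0 : (0 < m)%N.
Hypothesis T0 : 0 < T.
Hypothesis zT : forall a, enorm (z a) <= T.
Hypothesis var : forall u, \sum_a p a * z a u 0 ^+ 2 <= 1.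
Hypothesis bias : forall u v,
  `|\sum_a p a * (z a u 0 * z a v 0) - (u == v)%:R| <= (8 * m%:R)^-1.

Definition cov_close (om : Om) : bool := [forall u, forall v,
  `|\sum_j z (om j) u 0 * z (om j) v 0 - n%:R * (u == v)%:R| < n%:R / (2 * m%:R)].

(** Entrywise errors of order [n / m] change a quadratic form in [m] variables
    by at most a constant factor. *)
Lemma cov_closeP om x : cov_close om ->
  n%:R / 2 * dotv x x <= \sum_j dotv x (z (om j)) ^+ 2 <= 2 * n%:R * dotv x x.
Proof.
move=> cc; set S := \sum_j _.
suff H : `|S - n%:R * dotv x x| <= n%:R / 2 * dotv x x.
  move: H; rewrite ler_norml => /andP[h1 h2]; apply/andP; split; first by lra.
  have := mulr_ge0 (ler0n R n) (dotv_ge0 x); lra.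
have SE : S - n%:R * dotv x x = \sum_u \sum_v x u 0 * x v 0 *
    (\sum_j z (om j) u 0 * z (om j) v 0 - n%:R * (u == v)%:R).
  under [RHS]eq_bigr => u _ do under eq_bigr => v _ do rewrite mulrBr.
  under [RHS]eq_bigr => u _ do rewrite sumrB.
  rewrite sumrB; congr (_ - _).
    rewrite /S; under eq_bigr => j _ do rewrite expr2 /dotv big_distrlr.
    rewrite exchange_big; apply: eq_bigr => u _; rewrite exchange_big.
    by apply: eq_bigr => v _; rewrite mulr_sumr; apply: eq_bigr => j _ /=; ring.
  rewrite /dotv mulr_sumr; apply: eq_bigr => u _.
  rewrite (bigD1 u) //= eqxx big1 => [|v vu]; first by rewrite mulr1 addr0 mulrC.
  by rewrite eq_sym (negPf vu) !mulr0.
have m0' : (0 : R) < m%:R by rewrite ltr0n.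
rewrite SE; apply: le_trans (ler_norm_sum _ _ _) _.
apply: (@le_trans _ _ (\sum_u \sum_v `|x u 0| * `|x v 0| * (n%:R / (2 * m%:R)))).
  apply: ler_sum => u _; apply: le_trans (ler_norm_sum _ _ _) _.
  apply: ler_sum => v _; rewrite normrM normrM ler_wpM2l ?mulr_ge0 //.
  by apply: ltW; move/forallP: cc => /(_ u)/forallP/(_ v).
have -> : \sum_u \sum_v `|x u 0| * `|x v 0| * (n%:R / (2 * m%:R)) =
    (\sum_u `|x u 0|) ^+ 2 * (n%:R / (2 * m%:R)).
  rewrite expr2 big_distrlr /= mulr_suml; apply: eq_bigr => u _.
  by rewrite mulr_suml.
have cs : (\sum_u `|x u 0|) ^+ 2 <= m%:R * dotv x x.
  have := cauchy_schwarz (\col_u `|x u 0|) (const_mx 1).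
  have -> : dotv (\col_u `|x u 0|) (const_mx 1) = \sum_u `|x u 0|.
    by apply: eq_bigr => u _; rewrite !mxE mulr1.
  have -> : dotv (\col_u `|x u 0|) (\col_u `|x u 0|) = dotv x x.
    by apply: eq_bigr => u _; rewrite !mxE -expr2 real_normK ?num_real.
  have -> : dotv (const_mx 1 : 'cV[R]_m) (const_mx 1) = m%:R.
    under [LHS]eq_bigr do rewrite !mxE mulr1.
    by rewrite sumr_const card_ord.
  by rewrite mulrC.
apply: le_trans (ler_wpM2r _ cs) _; first by rewrite divr_ge0 // mulr_ge0 // ltW.
rewrite le_eqVlt; apply/orP; left; apply/eqP.
by move: (m%:R : R) m0' => M M0; field; rewrite gt_eqF.
Qed.

(** Chernoff's bound for every entry, on both sides. *)
Lemma cov_close_fail :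
  \sum_(om | ~~ cov_close om) prodw om <= 2 * m%:R ^+ 2 * expR (- (n%:R / (64 * m%:R ^+ 2 * T ^+ 2))).
Proof.
have m0' : (0 : R) < m%:R by rewrite ltr0n.
pose l : R := (16 * m%:R * T ^+ 2)^-1.
have l0 : 0 <= l by rewrite invr_ge0 !mulr_ge0 ?sqr_ge0 // ltW.
have lT : l * T ^+ 2 = (16 * m%:R)^-1.
  by rewrite /l; move: (m%:R : R) m0' T0 => M M0 T0'; field; rewrite !gt_eqF.
have zz a u v : `|z a u 0 * z a v 0| <= T ^+ 2.
  rewrite normrM expr2.
  by apply: ler_pM => //; apply: le_trans (norm_coord _ _) (zT a).
have small a u v : `|l * (z a u 0 * z a v 0)| <= 1 / 2.
  rewrite normrM (ger0_norm l0); apply: le_trans (ler_wpM2l l0 (zz a u v)) _.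
  rewrite lT invf_ple ?posrE ?mulr_gt0 // ?divr_gt0 //.
  have : (1 : R) <= m%:R by rewrite ler1n.
  by rewrite invf_div divr1; lra.
have sq u v : \sum_a p a * (z a u 0 * z a v 0) ^+ 2 <= T ^+ 2.
  apply: (@le_trans _ _ (\sum_a T ^+ 2 * (p a * z a v 0 ^+ 2))); last first.
    by rewrite -mulr_sumr -[leRHS]mulr1 ler_wpM2l ?sqr_ge0.
  apply: ler_sum => a _; rewrite exprMn mulrCA ler_wpM2r //.
    by rewrite mulr_ge0 ?sqr_ge0.
  rewrite -[leLHS]real_normK ?num_real // ler_sqr ?nnegrE ?(ltW T0) //.
  exact: le_trans (norm_coord _ _) (zT a).
have side (f : A -> R) (d : R) : (forall a, `|l * f a| <= 1 / 2) ->
    \sum_a p a * f a <= d + (8 * m%:R)^-1 -> \sum_a p a * f a ^+ 2 <= T ^+ 2 ->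
    \sum_(om : Om | n%:R * d + n%:R / (2 * m%:R) <= \sum_j f (om j)) prodw om <=
      expR (- (n%:R / (64 * m%:R ^+ 2 * T ^+ 2))).
  move=> f1 f2 f3; apply: le_trans (chernoff _ l0 f1 f2 f3) _.
  rewrite ler_expR le_eqVlt; apply/orP; left; apply/eqP.
  rewrite /l; move: (m%:R : R) (n%:R : R) m0' T0 => M n' M0 T0'.
  by field; rewrite !gt_eqF.
set e := expR _.
apply: (@le_trans _ _ (\sum_(u < m) \sum_(v < m) (e + e))); last first.
  have cst (x : R) : \sum_(i < m) x = m%:R * x by rewrite sumr_const card_ord mulr_natl.
  by under eq_bigr do rewrite cst; rewrite cst; lra.
pose c1 u v (om : Om) := n%:R * (u == v)%:R + n%:R / (2 * m%:R) <=
  \sum_j z (om j) u 0 * z (om j) v 0.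
pose c2 u v (om : Om) := n%:R * (- (u == v)%:R) + n%:R / (2 * m%:R) <=
  \sum_j - (z (om j) u 0 * z (om j) v 0).
apply: (@le_trans _ _ (\sum_om \sum_u \sum_v
  ((if c1 u v om then prodw om else 0) + (if c2 u v om then prodw om else 0)))).
  rewrite big_mkcond; apply: ler_sum => om _.
  have nn u v : 0 <= (if c1 u v om then prodw om else 0) + (if c2 u v om then prodw om else 0).
    by apply: addr_ge0; case: ifP => // _; exact: prodw_ge0.
  case: ifP => [|_]; last by apply: sumr_ge0 => u _; apply: sumr_ge0 => v _.
  move=> /forallPn[u /forallPn[v]]; rewrite -leNgt => H.
  rewrite (bigD1 u) //= (bigD1 v) //= -addrA.
  apply: (@le_trans _ _ ((if c1 u v om then prodw om else 0) + (if c2 u v om then prodw om else 0))).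
    move: H; rewrite ler_normr => /orP[H|H].
      have -> : c1 u v om by rewrite /c1; lra.
      by rewrite lerDl; case: ifP => // _; exact: prodw_ge0.
    have -> : c2 u v om by rewrite /c2 sumrN; lra.
    by rewrite lerDr; case: ifP => // _; exact: prodw_ge0.
  rewrite lerDl addr_ge0 //; first by apply: sumr_ge0 => v' _.
  by apply: sumr_ge0 => u' _; apply: sumr_ge0 => v' _.
rewrite exchange_big; apply: ler_sum => u _; rewrite exchange_big.
apply: ler_sum => v _; rewrite big_split /= -!big_mkcond /=.
have := bias u v; rewrite ler_norml => /andP[b1 b2].
apply: lerD.
  apply: (side (fun a => z a u 0 * z a v 0) (u == v)%:R) => [a||].
  - exact: small.
  - by lra.
  - exact: sq.
apply: (side (fun a => - (z a u 0 * z a v 0)) (- (u == v)%:R)) => [a||].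
- by rewrite mulrN normrN; exact: small.
- by under eq_bigr do rewrite mulrN; rewrite sumrN; lra.
- by under eq_bigr do rewrite sqrrN; exact: sq.
Qed.

End Covariance.
End ProductWeights.

(** * Signed sums of independent lattice vectors *)

Section RandomSigns.
Context {R : realType} {A : finType} {m n : nat}.
Variables (p : A -> R) (k : A -> 'cV[int]_m) (W D : 'M[R]_m).
Hypothesis p0 : forall a, 0 <= p a.
Hypothesis p1 : \sum_a p a <= 1.
Hypothesis DW : D^T *m W = 1%:M.
Hypothesis m0 : (0 < m)%N.
Hypothesis n0 : (0 < n)%N.
Let z a : 'cV[R]_m := W *m iv (k a).
Local Notation Om := {ffun 'I_n -> A}.

(** A kernel vector of the Gram sum would be orthogonal to all the vectors,
    against the lower bound in [cov_closeP]. *)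
Lemma gram_det_neq0 (om : Om) : cov_close z om ->
  \det (\sum_j k (om j) *m (k (om j))^T) != 0.
Proof.
move=> cc; apply/negP => /eqP det0.
have : \det (map_mx intr (\sum_j k (om j) *m (k (om j))^T) : 'M[R]_m) = 0.
  by rewrite det_map_mx det0 rmorph0.
move=> /eqP/det0P[v v0 vK].
pose x := D *m v^T.
have WD : W^T *m D = 1%:M by rewrite -[D]trmxK -trmx_mul DW trmx1.
have xz a : dotv x (z a) = dotv v^T (iv (k a)).
  by rewrite /x /z dotv_mulmxr mulmxA WD mul1mx.
have S0 : \sum_j dotv x (z (om j)) ^+ 2 = 0.
  transitivity ((v *m map_mx intr (\sum_j k (om j) *m (k (om j))^T) *m v^T) 0 0).
    rewrite raddf_sum mulmx_sumr mulmx_suml summxE; apply: eq_bigr => j _ /=.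
    rewrite map_mxM -map_trmx mulmxA -mulmxA mxE big_ord1 expr2 xz dotvE trmxK.
    by congr (_ * _); rewrite -trmx_mul [RHS]mxE.
  by rewrite vK mul0mx mxE.
have /andP[+ _] := cov_closeP m0 x cc.
rewrite S0 pmulr_rle0 ?divr_gt0 ?ltr0n // leNgt => /negP; apply; apply: dotv_gt0.
apply: contra_neq v0 => x0; apply/eqP; rewrite -trmx_eq0 -[v^T]mul1mx -WD -mulmxA -/x x0.
by rewrite mulmx0.
Qed.

(** Each discarded event costs one [dlt]: the mass missing from [p], a bad
    empirical covariance, and a far part that beats the near one (by Markov,
    from the last two hypotheses).  On the rest the deterministic core
    applies.  The modulus [q] of the torus is taken after everything else:
    divisible by all Gram determinants, and larger than all coordinates in
    sight, so that a congruence modulo [q] is an equality. *)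
Lemma random_signed_sums (T r0 r1 rho dlt : R) (K : 'I_m -> nat)
    (kl g : Om -> 'cV[int]_m) :
  1 - dlt / n%:R <= \sum_a p a ->
  (forall a, enorm (z a) <= T) -> 0 < T ->
  (forall u, \sum_a p a * z a u 0 ^+ 2 <= 1) ->
  (forall u v, `|\sum_a p a * (z a u 0 * z a v 0) - (u == v)%:R| <= (8 * m%:R)^-1) ->
  2 * m%:R ^+ 2 * expR (- (n%:R / (64 * m%:R ^+ 2 * T ^+ 2))) <= dlt ->
  (forall om, kl om + \sum_j k (om j) = g om *+ 2) ->
  (forall om, 2 ^+ 7 * 25 * dotv (W *m iv (kl om)) (W *m iv (kl om)) <= n%:R) ->
  0 <= rho -> 0 <= r1 <= r0 -> 8 * (r0 * T) <= 1 / 10 ->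
  (8 * (r0 * T)) ^+ 4 * (2 ^+ 7 * n%:R * r0 ^+ 2) <= 1 / 64 ->
  2 ^+ 7 * n%:R * r1 ^+ 2 <= 1 ->
  (forall i, 0 < K i)%N ->
  (forall i, m%:R * enorm (col i D) <= 2 * r1 * (K i)%:R) ->
  (forall th : 'cV[R]_m,
    (forall u : 'cV[int]_m, r0 < enorm (th + 2^-1 *: (D *m iv u))) ->
    \sum_a p a * `|cos (2 * pi * dotv th (z a))| <= rho) ->
  40 * (\prod_i K i)%:R * rho ^+ n <= dlt ->
  exists2 good : pred Om, 1 - 3 * dlt <= \sum_(om | good om) prodw p om &
    forall om, good om -> exists y : 'I_n -> bool,
      kl om = \sum_j (if y j then k (om j) else - k (om j)).
Proof.
move=> pe zT T0 var bias chern Hg klb rho0 r10 r0T r0T4 nr1 K0 HK gap fardlt.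
pose dets := (\prod_(om : Om) maxn 1 `|\det (\sum_j k (om j) *m (k (om j))^T)|)%N.
pose coords := (\sum_(om : Om) \sum_i (`|kl om i ord0| + \sum_j `|k (om j) i ord0|))%N.
have dets0 : (0 < dets)%N by rewrite prodn_gt0 // => om; rewrite leq_max.
pose q' := (dets * coords.+1).-1.
have qE : q'.+1 = (dets * coords.+1)%N by rewrite prednK // muln_gt0 dets0.
pose far (om : Om) : R := \sum_(t | ~~ @near_torus R m q' D r0 t)
  \prod_j `|cos (@phase R m q' (k (om j)) (lift_torus t))|.
have gapq t : ~~ @near_torus R m q' D r0 t ->
    \sum_a p a * `|cos (@phase R m q' (k a) (lift_torus t))| <= rho.
  move=> nt; have := gap (@dual_point R m q' D (lift_torus t)).
  under eq_bigr => a _ do rewrite -(@phase_dual_point R m q' W D DW).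
  apply => u; rewrite ltNge; apply: contraNN nt => Hu.
  apply/asboolP; exists u; apply: le_trans Hu; rewrite le_eqVlt; apply/orP; left.
  apply/eqP; congr enorm; rewrite /dual_point map_mxD mulmxDr scalerDr raddfMn /=.
  have -> : D *m (iv u *+ q'.+1) = q'.+1%:R *: (D *m iv u).
    by rewrite -scaler_nat -scalemxAr.
  by rewrite scalerA invfM mulfVK.
have far0 om : 0 <= far om by apply: sumr_ge0 => t _; apply: prodr_ge0.
have Kp : (0 : R) < 40 * (\prod_i K i)%:R.
  by rewrite mulr_gt0 // ltr0n; exact: prodn_gt0.
have qm0 : (0 : R) < (q'.+1 ^ m)%:R by rewrite ltr0n expn_gt0.
pose bad om := (q'.+1 ^ m)%:R <= 40 * (\prod_i K i)%:R * far om.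
exists (fun om => cov_close z om && ~~ bad om).
  have tot := @sum_prodw_ge R A n p p0 p1 _ pe.
  rewrite (mulrC n%:R) divfK in tot; last by rewrite pnatr_eq0 -lt0n.
  have covf := le_trans (cov_close_fail p0 p1 m0 T0 zT var bias) chern.
  have farf : \sum_(om | bad om) prodw p om <= dlt.
    apply: le_trans (prodw_markov p0 qm0 _) _ => [om|]; first by rewrite mulr_ge0 // ltW.
    rewrite ler_pdivrMr //; apply: le_trans (_ : _ <= 40 * (\prod_i K i)%:R * rho ^+ n * (q'.+1 ^ m)%:R) _; last first.
      by rewrite ler_pM2r.
    under [leLHS]eq_bigr => om _ do rewrite mulrCA.
    rewrite -mulr_sumr -[leRHS]mulrA ler_pM2l //.
    under eq_bigr => om _ do rewrite mulr_sumr.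
    rewrite exchange_big /=.
    apply: (@le_trans _ _ (\sum_(t | ~~ @near_torus R m q' D r0 t) rho ^+ n)).
      apply: ler_sum => t nt.
      rewrite (sum_prodw_prod p (fun a => `|cos (@phase R m q' (k a) (lift_torus t))|)).
      apply: lerXn2r; rewrite ?nnegrE.
      - by apply: sumr_ge0 => a _; rewrite mulr_ge0.
      - exact: rho0.
      - exact: gapq.
    have rn0 : 0 <= rho ^+ n by exact: exprn_ge0.
    apply: le_trans (_ : _ <= \sum_(t : 'cV['I_q'.+1]_m) rho ^+ n) _.
      by rewrite [leRHS](bigID (fun t => ~~ @near_torus R m q' D r0 t)) /= lerDl sumr_ge0.
    by rewrite sumr_const card_mx card_ord muln1 mulr_natr.
  have := tot; rewrite (bigID (fun om => cov_close z om && ~~ bad om)) /=.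
  set GS := \sum_(om | _ && _) _; set BS := \sum_(om | ~~ _) _ => tot'.
  have : BS <= \sum_(om : Om | ~~ cov_close z om) prodw p om + \sum_(om | bad om) prodw p om.
    rewrite /BS big_mkcond [X in _ <= X + _]big_mkcond [X in _ <= _ + X]big_mkcond.
    rewrite -big_split /=.
    apply: ler_sum => om _; have := prodw_ge0 p0 om.
    by case: (cov_close z om); case: (bad om) => /=; lra.
  lra.
move=> om /andP[cc nbad].
have covb x := cov_closeP m0 x cc.
have detq : (\det (\sum_j k (om j) *m (k (om j))^T) %| Posz q'.+1)%Z.
  have := gram_det_neq0 cc; rewrite -absz_gt0 dvdzE qE => dt0.
  apply: dvdn_mulr; rewrite /dets (bigD1 om) //=; apply: dvdn_mulr.
  by rewrite (maxn_idPr dt0).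
have cbig i : `|kl om i ord0| + \sum_j `|k (om j) i ord0| < Posz q'.+1.
  rewrite -abszE; under eq_bigr => j _ do rewrite -abszE.
  rewrite -(big_morph Posz PoszD erefl) -PoszD ltz_nat qE.
  apply: leq_trans (leq_pmull _ dets0); rewrite ltnS /coords (bigD1 om) //= (bigD1 i) //=.
  by rewrite -addnA leq_addr.
have farlt : 40 * (\prod_i K i)%:R * far om <= (q'.+1 ^ m)%:R.
  by move: nbad; rewrite /bad -ltNge => /ltW.
apply: (@signed_sum_of_small_far R m q' W D DW n (k \o om) _ _ T r0 r1 K _ (g om)) => //=.
- by move=> x; have /andP[] := covb x.
- by move=> x; have /andP[] := covb x.
- by move=> j; exact: zT.
Qed.

End RandomSigns.

(** * Expectations of functions of a lattice-valued random vector *)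

Section BorelVectors.
Context {R : realType} {m : nat}.

Lemma borelV_open (U : set 'cV[R]_m) : open U -> measurable (U : set (borelV R m)).
Proof. by move=> oU; exact: sub_sigma_algebra. Qed.

Lemma norm_coord_continuous i : continuous (fun v : 'cV[R]_m => v i 0).
Proof. by move=> v; exact: coord_continuous. Qed.

Lemma borelV_coord i : measurable_fun [set: borelV R m] (fun v : borelV R m => v i 0 : R).
Proof.
apply: (measurability _ (RGenOInfty.measurableE R)) => _ [_ [r ->] <-].
rewrite setTI; apply: borelV_open; apply: open_comp; last exact: rray_open.
by move=> v _; exact: norm_coord_continuous.
Qed.

Lemma borelV_set1 (v : 'cV[R]_m) : measurable ([set v] : set (borelV R m)).
Proof.
rewrite (_ : [set v] = \bigcap_(i in [set: 'I_m]) ((fun u : borelV R m => u i 0) @^-1` [set v i 0])).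
  apply: fin_bigcap_measurable => // i _; rewrite -[X in measurable X]setTI.
  exact: borelV_coord.
apply/seteqP; split => [_ -> //|u /= H]; apply/colP => i; exact: H.
Qed.

End BorelVectors.

Section Expectation.
Context {R : realType} {d : measure_display} {T : measurableType d}.
Variable P : probability T R.
Local Notation intg f := (P.-integrable [set: T] (EFin \o f)).
Local Notation Ex f := (\int[P]_w f w).
Implicit Types f g : T -> R.

Lemma expectationE f : fine 'E_P[f] = Ex f.
Proof. by rewrite unlock. Qed.

Lemma Ex_ae_le f g : intg f -> intg g -> {ae P, forall w, f w <= g w} -> Ex f <= Ex g.
Proof.
move=> fi gi fg; rewrite -subr_ge0 -RintegralB //.
have hi : intg (fun w => g w - f w) by exact: (integrableB measurableT gi fi).
have mh : measurable_fun [set: T] (fun w => g w - f w).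
  by apply/measurable_EFinP; exact: (measurable_int P hi).
have mmax : measurable_fun [set: T] (fun w => Num.max (g w - f w) 0).
  by apply: measurable_maxr => //; exact: measurable_cst.
rewrite /Rintegral (ae_eq_integral (fun w => (Num.max (g w - f w) 0)%:E)) //.
- by apply: fine_ge0; apply: integral_ge0 => w _; rewrite lee_fin le_max lexx orbT.
- exact/measurable_EFinP.
- exact/measurable_EFinP.
- apply: filterS fg => w fgw _; congr EFin; apply/esym/max_idPl.
  by rewrite subr_ge0.
Qed.

Lemma Ex_abs_ae_le f g : intg f -> intg g -> {ae P, forall w, `|f w| <= g w} ->
  `|Ex f| <= Ex g.
Proof.
move=> fi gi fg; apply: le_trans (le_normr_Rintegral measurableT fi) _.
apply: Ex_ae_le => //; exact: (integrable_abse fi).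
Qed.

Lemma intgZ c f : intg f -> intg (fun w => c * f w).
Proof. by move=> fi; exact: (integrableZl measurableT c fi). Qed.

Lemma intg_sum (I : Type) (s : seq I) (f : I -> T -> R) : (forall i, intg (f i)) ->
  intg (fun w => \sum_(i <- s) f i w).
Proof.
move=> fi; have := integrable_sum measurableT s (fun i (_ : xpredT i) => fi i).
by apply: eq_integrable => // w _; rewrite /= sumEFin.
Qed.

Lemma Ex_sum (I : Type) (s : seq I) (f : I -> T -> R) : (forall i, intg (f i)) ->
  Ex (fun w => \sum_(i <- s) f i w) = \sum_(i <- s) Ex (f i).
Proof.
move=> fi; elim: s => [|i s IH].
  under eq_Rintegral do rewrite big_nil.
  by rewrite Rintegral_cst // mul0r big_nil.
under eq_Rintegral do rewrite big_cons.
by rewrite RintegralD // ?IH ?big_cons //; exact: intg_sum.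
Qed.

Lemma intg_cst c : intg (fun=> c).
Proof. exact: finite_measure_integrable_cst. Qed.

Lemma Ex_cst c : Ex (fun=> c) = c.
Proof. by rewrite Rintegral_cst //= probability_setT mulr1. Qed.

Lemma intg_bounded f c : measurable_fun [set: T] f -> (forall w, `|f w| <= c) -> intg f.
Proof.
move=> mf fc; apply: (le_integrable measurableT _ _ (intg_cst c)).
  exact/measurable_EFinP.
by move=> w _; rewrite /= lee_fin (le_trans (fc w)) // ler_norm.
Qed.

Lemma intg_indic (B : set T) : measurable B -> intg (\1_B : T -> R).
Proof. exact: integrable_indic. Qed.

Lemma Ex_indic (B : set T) : measurable B -> Ex (\1_B : T -> R) = fine (P B).
Proof. by move=> mB; rewrite /Rintegral integral_indic // setIT. Qed.

End Expectation.

Section DiscreteLaw.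
Context {R : realType} {m : nat} {d : measure_display} {T : measurableType d}.
Variables (P : probability T R) (X : T -> borelV R m).
Hypothesis mX : measurable_fun [set: T] X.
Context {A : finType} (x : A -> 'cV[R]_m).
Hypothesis x_inj : injective x.
Local Notation intg f := (P.-integrable [set: T] (EFin \o f)).
Local Notation Ex f := (\int[P]_w f w).

Definition mass a : R := fine (P (X @^-1` [set x a])).

Definition step (c : A -> R) (w : T) : R := \sum_a c a * \1_(X @^-1` [set x a]) w.

Lemma atom_measurable (v : 'cV[R]_m) : measurable (X @^-1` [set v]).
Proof. by rewrite -[X in measurable X]setTI; apply: mX => //; exact: borelV_set1. Qed.

Lemma mass_ge0 a : 0 <= mass a.
Proof. exact: fine_ge0. Qed.

Lemma intg_step c : intg (step c).
Proof. by apply: intg_sum => a; apply: intgZ; apply: intg_indic; exact: atom_measurable. Qed.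

Lemma Ex_step c : Ex (step c) = \sum_a mass a * c a.
Proof.
have ii a : intg (\1_(X @^-1` [set x a])) by apply: intg_indic; exact: atom_measurable.
rewrite Ex_sum => [|a]; last by apply: intgZ; exact: ii.
apply: eq_bigr => a _; rewrite (RintegralZl _ measurableT (ii a)).
by rewrite (Ex_indic P (atom_measurable (x a))) mulrC.
Qed.

Lemma stepE c w a : X w = x a -> step c w = c a.
Proof.
move=> Xw; rewrite /step (bigD1 a) //= big1 => [|b ba].
  by rewrite indicE mem_set ?mulr1 ?addr0.
rewrite indicE memNset ?mulr0 // => /= Xb; move: ba; rewrite -(inj_eq x_inj).
by rewrite -Xb Xw eqxx.
Qed.

Lemma step0 c w : (forall a, X w <> x a) -> step c w = 0.
Proof. by move=> Xw; rewrite /step big1 // => a _; rewrite indicE memNset ?mulr0 //; exact: Xw. Qed.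

Lemma sum_mass_le (f : 'cV[R]_m -> R) : (forall v, 0 <= f v) -> intg (fun w => f (X w)) ->
  \sum_a mass a * f (x a) <= Ex (fun w => f (X w)).
Proof.
move=> f0 fi; rewrite -(Ex_step (f \o x)); apply: Ex_ae_le => //; first exact: intg_step.
apply: aeW => w.
have [[a Xw]|nX] := pselect (exists a, X w = x a).
  by rewrite (stepE _ Xw) /= Xw.
by rewrite step0 // => a Xw; apply: nX; exists a.
Qed.

(** Restricting a law to finitely many atoms changes an expectation by no more
    than the integral of a bound on the integrand elsewhere. *)
Lemma sum_mass_err (f : 'cV[R]_m -> R) (h : T -> R) :
  intg (fun w => f (X w)) -> intg h -> (forall w, 0 <= h w) ->
  {ae P, forall w, (exists a, X w = x a) \/ `|f (X w)| <= h w} ->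
  `|Ex (fun w => f (X w)) - \sum_a mass a * f (x a)| <= Ex h.
Proof.
move=> fi hi h0 cov; rewrite -(Ex_step (f \o x)) -RintegralB //; last exact: intg_step.
apply: Ex_abs_ae_le => //.
  by exact: (integrableB measurableT fi (intg_step _)).
apply: filterS cov => w [[a Xw]|fh].
  by rewrite (stepE _ Xw) /= Xw subrr normr0.
have [[a Xw]|nX] := pselect (exists a, X w = x a).
  by rewrite (stepE _ Xw) /= Xw subrr normr0.
by rewrite step0 ?subr0 // => a Xw; apply: nX; exists a.
Qed.

Context {n : nat} {d' : measure_display} {T' : measurableType d'}.
Variables (P' : probability T' R) (Y : 'I_n -> T' -> borelV R m).
Hypothesis iid : iid_copies P P' X Y.

(** By independence [prodw mass om] is the probability of the columns being
    exactly [x \o om], and these events are disjoint. *)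
Lemma sum_prodw_mass_le (good : pred {ffun 'I_n -> A}) (B : set T') : measurable B ->
  (forall om w, good om -> (forall j, Y j w = x (om j)) -> B w) ->
  ((\sum_(om | good om) prodw mass om)%:E <= P' B)%E.
Proof.
move=> mB HB; have [mY law ind] := iid.
pose C (om : {ffun 'I_n -> A}) := \bigcap_(j in [set` [set: 'I_n]%SET]) (Y j @^-1` [set x (om j)]).
have mC om : measurable (C om).
  apply: fin_bigcap_measurable => // j _; rewrite -[X in measurable X]setTI.
  by apply: mY => //; exact: borelV_set1.
have PC om : fine (P' (C om)) = prodw mass om.
  rewrite /C ind => [|j]; last exact: borelV_set1.
  rewrite /prodw (_ : (\prod_(j in _) _)%E = (\prod_j mass (om j))%:E) //.
  rewrite -prodEFin; apply: eq_big => [j|j _]; first by rewrite inE.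
  rewrite law ?fineK //; [exact: fin_num_measure (atom_measurable _)|exact: borelV_set1].
have ii om : P'.-integrable [set: T'] (EFin \o (\1_(C om) : T' -> R)).
  exact: intg_indic.
rewrite -[leRHS]fineK ?fin_num_measure // lee_fin -Ex_indic //.
under eq_bigr => om _ do rewrite -PC -Ex_indic //.
rewrite -big_filter -Ex_sum //; apply: Ex_ae_le; [exact: intg_sum | exact: intg_indic|].
apply: aeW => w; rewrite big_filter.
have [[om [gom Cw]]|nC] := pselect (exists om, good om /\ C om w); last first.
  rewrite big1 => [|om gom]; first by rewrite indicE.
  by rewrite indicE memNset // => Cw; apply: nC; exists om.
rewrite (bigD1 om) //= big1 => [|om' /andP[_ oo]].
  rewrite addr0 !indicE !mem_set //; apply: (HB om w gom) => j.
  by apply: Cw; rewrite /= inE.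
rewrite indicE memNset // => Cw'; move/eqP: oo; apply; apply/ffunP => j; apply: x_inj.
have /= <- : (Y j @^-1` [set x (om' j)]) w by apply: Cw'; rewrite /= inE.
by have /= <- : (Y j @^-1` [set x (om j)]) w by apply: Cw; rewrite /= inE.
Qed.

End DiscreteLaw.

Section DiscMeasurable.
Context {R : realType} {m : nat} {N : 'cV[R]_m -> R}.
Hypothesis HN : is_norm N.
Context {d : measure_display} {T : measurableType d}.

(** [N v > r] if and only if [N u - C |v - u| > r] for some rational [u]. *)
Lemma norm_le_measurable (g : T -> 'cV[R]_m) (r : R) :
  (forall i, measurable_fun [set: T] (fun w => g w i 0)) ->
  measurable [set w | N (g w) <= r].
Proof.
move=> mg; rewrite -[X in measurable X]setCK; apply: measurableC.
pose S := \sum_i N (delta_mx i 0).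
have S0 : 0 <= S by apply: sumr_ge0 => i _; exact: is_norm_ge0.
pose B (u : 'cV[rat]_m) :=
  [set w | r < N (map_mx ratr u) - S * \sum_i `|g w i 0 - ratr (u i 0)|].
have lip (v u : 'cV[R]_m) e : (forall i, `|v i 0 - u i 0| <= e) -> `|N v - N u| <= e * S.
  move=> vu; apply: le_trans (is_norm_dist HN v u) _; apply: is_norm_coord => // i.
  by rewrite !mxE.
rewrite (_ : ~` _ = \bigcup_u B u).
  apply: countable_bigcupT_measurable; first exact: countableP.
  move=> u; rewrite /B -[X in measurable X]setTI -preimage_itvoy.
  have : measurable_fun [set: T] (fun w => N (map_mx ratr u) - S * \sum_i `|g w i 0 - ratr (u i 0)|).
    apply: measurable_funB => //; apply: measurable_funM => //.
    apply: measurable_sum => i; apply: measurableT_comp => //.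
    exact: measurable_funB.
  by apply => //; exact: measurable_itv.
apply/seteqP; split => [w /= /negP|w [u _]]; last first.
  rewrite /B /= => rN; apply/negP; rewrite -ltNge; apply: lt_le_trans rN _.
  have : `|N (g w) - N (map_mx ratr u)| <= (\sum_i `|g w i 0 - ratr (u i 0)|) * S.
    apply: lip => i; rewrite !mxE (bigD1 i) //= lerDl; exact: sumr_ge0.
  by rewrite ler_norml => /andP[+ _]; lra.
rewrite -ltNge => rN; pose e := (N (g w) - r) / (S * (m%:R + 1) + 1).
have c0 : 0 < S * (m%:R + 1) + 1 by rewrite ltr_wpDl // mulr_ge0 // addr_ge0.
have e0 : 0 < e by rewrite divr_gt0 // subr_gt0.
have /choice[u Hu] i : exists u : rat, `|g w i 0 - ratr u| <= e.
  have : g w i 0 < g w i 0 + e by rewrite ltrDl.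
  move=> /rat_in_itvoo[u]; rewrite in_itv /= => /andP[h1 h2]; exists u.
  by rewrite distrC ger0_norm; lra.
exists (\col_i u i) => //; rewrite /B /=.
have h1 : `|N (g w) - N (map_mx ratr (\col_i u i))| <= e * S.
  by apply: lip => i; rewrite !mxE.
have h2 : \sum_i `|g w i 0 - ratr ((\col_i u i) i 0)| <= m%:R * e.
  apply: (@le_trans _ _ (\sum_(i < m) e)); first by apply: ler_sum => i _; rewrite mxE.
  by rewrite sumr_const card_ord mulr_natl.
have h3 := ler_wpM2l S0 h2.
have h4 : e * (S * (m%:R + 1) + 1) = N (g w) - r by rewrite divfK // gt_eqF.
have h5 := le_trans (ler_norm _) h1.
lra.
Qed.

Lemma disc_le_ex n (M : 'M[R]_(m, n)) (r : R) :
  disc N M <= r <->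
  exists y : {ffun 'I_n -> bool}, N (M *m \col_j (if y j then 1 else -1)) <= r.
Proof.
rewrite /disc; set S := [set y : 'cV[R]_n | forall j, y j 0 = 1 \/ y j 0 = -1].
have S0 x : [set N (M *m y) | y in S] x -> 0 <= x by move=> [y _ <-]; exact: is_norm_ge0.
have Sy (y : {ffun 'I_n -> bool}) : S (\col_j (if y j then 1 else -1)).
  by move=> j; rewrite mxE; case: (y j); [left|right].
split=> [dr|[y Hy]]; last first.
  apply: le_trans Hy; apply: ge_inf; first by exists 0.
  by exists (\col_j (if y j then 1 else -1)).
pose f (y : {ffun 'I_n -> bool}) := N (M *m \col_j (if y j then 1 else -1)).
pose y0 := [arg min_(y < [ffun=> true]) f y]%O.
exists y0; apply: le_trans dr; apply: lb_le_inf.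
  by exists (f [ffun=> true]), (\col_j (if ([ffun=> true] : {ffun 'I_n -> bool}) j then 1 else -1)).
move=> _ [y Hy <-]; rewrite -/(f y0) /y0; case: arg_minP => // i _ /(_ [ffun j => y j 0 == 1] isT).
move=> /le_trans; apply; rewrite le_eqVlt; apply/orP; left; apply/eqP; congr (N (M *m _)).
apply/colP => j; rewrite mxE ffunE; case: (Hy j) => ->; first by rewrite eqxx.
by case: eqP => // /eqP; rewrite -subr_eq0 -opprD oppr_eq0 -[1 + 1]/(2%:R) pnatr_eq0.
Qed.

Lemma disc_measurable n (M : T -> 'M[R]_(m, n)) (r : R) :
  (forall j, measurable_fun [set: T] (fun w => col j (M w) : borelV R m)) ->
  measurable [set w | disc N (M w) <= r].
Proof.
move=> mM; rewrite (_ : [set w | _] = \bigcup_(y in [set: {ffun 'I_n -> bool}])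
    [set w | N (M w *m \col_j (if y j then 1 else -1)) <= r]); last first.
  apply/seteqP; split=> w /=; first by move=> /disc_le_ex[y]; exists y.
  by move=> [y _ Hy]; apply/disc_le_ex; exists y.
apply: fin_bigcup_measurable => // y _; apply: norm_le_measurable => i.
have -> : (fun w => (M w *m \col_j (if y j then 1 else -1)) i 0) =
    (fun w => \sum_j (col j (M w)) i 0 * (if y j then 1 else -1)).
  by apply/funext => w; rewrite mxE; apply: eq_bigr => j _; rewrite !mxE.
apply: measurable_sum => j; apply: measurable_funM => //.
exact: (measurableT_comp (borelV_coord i) (mM j)).
Qed.

End DiscMeasurable.

(** * The normalized random vector *)

Lemma powR_le_base (R : realType) (a b e : R) :
  0 <= e -> 0 <= a -> a <= b -> a `^ e <= b `^ e.
Proof.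
by move=> e0 a0 ab; apply: ge0_ler_powR; rewrite ?nnegrE //; exact: le_trans ab.
Qed.

Section Normalized.
Context {R : realType} {m : nat} {d : measure_display} {T : measurableType d}.
Variables (P : probability T R) (X : T -> borelV R m).
Hypothesis mX : measurable_fun [set: T] X.
Hypothesis X2 : has_second_moments P X.
Local Notation intg f := (P.-integrable [set: T] (EFin \o f)).
Local Notation Ex f := (\int[P]_w f w).
Let Sigma : 'M[R]_m := second_moment_mx P X.

Lemma coord_measurable i : measurable_fun [set: T] (fun w => (X w : 'cV[R]_m) i 0).
Proof. exact: (measurableT_comp (borelV_coord i) mX). Qed.

Lemma linear_measurable (S : 'M[R]_m) i :
  measurable_fun [set: T] (fun w => (S *m (X w : 'cV[R]_m)) i 0).
Proof.
rewrite (_ : (fun w => _) = (fun w => \sum_j S i j * (X w : 'cV[R]_m) j 0)); last first.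
  by apply/funext => w; rewrite mxE.
by apply: measurable_sum => j; apply: measurable_funM => //; exact: coord_measurable.
Qed.

Lemma dotv_measurable (S : 'M[R]_m) th :
  measurable_fun [set: T] (fun w => dotv th (S *m (X w : 'cV[R]_m))).
Proof.
by apply: measurable_sum => i; apply: measurable_funM => //; exact: linear_measurable.
Qed.

Lemma enorm_measurable (S : 'M[R]_m) :
  measurable_fun [set: T] (fun w => enorm (S *m (X w : 'cV[R]_m))).
Proof.
apply: (measurableT_comp (continuous_measurable_fun (@sqrt_continuous R))).
by apply: measurable_sum => i; apply: measurable_funM; exact: linear_measurable.
Qed.

(** Second moments of linear images, as a quadratic form in [Sigma]. *)
Lemma second_moment_dotv (a b : 'cV[R]_m) :
  intg (fun w => dotv a (X w) * dotv b (X w)) /\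
  Ex (fun w => dotv a (X w) * dotv b (X w)) = dotv a (Sigma *m b).
Proof.
have E w : dotv a (X w) * dotv b (X w) =
    \sum_i \sum_j (a i 0 * b j 0) * ((X w : 'cV[R]_m) i 0 * (X w : 'cV[R]_m) j 0).
  rewrite /dotv big_distrlr; apply: eq_bigr => i _; apply: eq_bigr => j _ /=; ring.
have ii i j : intg (fun w => (a i 0 * b j 0) * ((X w : 'cV[R]_m) i 0 * (X w : 'cV[R]_m) j 0)).
  by apply: intgZ; exact: X2.
under eq_fun do rewrite E; split.
  by apply: intg_sum => i; exact: intg_sum.
rewrite (Ex_sum _ (fun i => intg_sum _ (ii i))) /dotv; apply: eq_bigr => i _.
rewrite (Ex_sum _ (ii i)) mxE mulr_sumr; apply: eq_bigr => j _.
rewrite (RintegralZl _ measurableT (X2 i j)) mxE expectationE.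
by rewrite [RHS]mulrA mulrAC.
Qed.

Lemma second_moment_sym : Sigma^T = Sigma.
Proof.
by apply/matrixP => i j; rewrite !mxE; congr fine; congr expectation; apply/funext => w; rewrite mulrC.
Qed.

(** A direction orthogonal to the support is orthogonal to the lattice. *)
Lemma second_moment_pos_def (Lat : set 'cV[R]_m) : spanning Lat ->
  Lat = zspan (rv_support P X) -> pos_def Sigma.
Proof.
move=> span LatE; split=> [|a a0]; first exact: second_moment_sym.
have [ia Ea] := second_moment_dotv a a.
rewrite lt_neqAle -Ea; apply/andP; split; last first.
  by apply: Rintegral_ge0 => // w _; rewrite -expr2 sqr_ge0.
apply: contra_neq a0 => /esym E0; apply: span => v; rewrite LatE => -[k [c [u [Hu ->]]]].
rewrite dotv_sumr big1 // => i _; rewrite -scaler_int dotvZr.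
have Pu : 0 < mass P X (fun=> u i) tt.
  by apply: fine_gt0; rewrite (Hu i) /= ltey_eq fin_num_measure //; exact: atom_measurable.
have inj : injective (fun _ : unit => u i) by move=> [] [].
have := sum_mass_le mX inj (f := fun v => dotv a v * dotv a v) _ ia.
rewrite E0 (big_pred1 tt) => [|[]//]; rewrite pmulr_rle0 //.
move=> H; have {}H : dotv a (u i) * dotv a (u i) <= 0.
  by apply: H => y; rewrite -expr2 sqr_ge0.
suff /eqP -> : dotv a (u i) == 0 by rewrite mulr0.
by rewrite -sqrf_eq0 eq_le expr2 H -expr2 sqr_ge0.
Qed.

Variable S : 'M[R]_m.
Hypothesis ST : S^T = S.
Hypothesis SS : S *m S = invmx Sigma.
Hypothesis uSigma : Sigma \in unitmx.
Let Z w : 'cV[R]_m := S *m (X w : 'cV[R]_m).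

Lemma isotropic : S *m Sigma *m S = 1%:M.
Proof.
apply: mulmx1C; rewrite mulmxA SS mulVmx //.
Qed.

Lemma Z_second_moment (a b : 'cV[R]_m) :
  intg (fun w => dotv a (Z w) * dotv b (Z w)) /\
  Ex (fun w => dotv a (Z w) * dotv b (Z w)) = dotv a b.
Proof.
have E w : dotv a (Z w) * dotv b (Z w) = dotv (S *m a) (X w) * dotv (S *m b) (X w).
  by rewrite /Z !(dotv_mulmxr S) ST.
under eq_fun do rewrite E; have [i1 i2] := second_moment_dotv (S *m a) (S *m b).
split => //; rewrite i2 (dotv_mulmxl S) ST !mulmxA isotropic mul1mx //.
Qed.

Lemma Z_coord_moment u v :
  intg (fun w => Z w u 0 * Z w v 0) /\ Ex (fun w => Z w u 0 * Z w v 0) = (u == v)%:R.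
Proof.
have dd i (y : 'cV[R]_m) : dotv (delta_mx i 0) y = y i 0.
  rewrite /dotv (bigD1 i) //= big1 ?addr0 => [|j ji]; first by rewrite mxE !eqxx mul1r.
  by rewrite mxE (negPf ji) mul0r.
have := Z_second_moment (delta_mx u 0) (delta_mx v 0).
under eq_fun do rewrite !dd; by rewrite dd mxE eqxx andbT.
Qed.

Variables (eta L : R).
Hypothesis eta2 : 2 < eta.
Hypothesis HL : ('E_P[fun w => (enorm (Z w) `^ eta)%R] `^ eta^-1)%E = L%:E.

Lemma Z_eta_moment : [/\ 0 <= L, intg (fun w => enorm (Z w) `^ eta) &
  Ex (fun w => enorm (Z w) `^ eta) = L `^ eta].
Proof.
have mh : measurable_fun [set: T] (fun w => enorm (Z w) `^ eta).
  exact: (measurableT_comp (measurable_powR eta) (enorm_measurable S)).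
have E0 : (0 <= 'E_P[fun w => (enorm (Z w) `^ eta)%R])%E.
  by apply: expectation_ge0 => w; exact: powR_ge0.
have eta0 : 0 < eta := lt_trans (ltr0n R 2) eta2.
have Efin : ('E_P[fun w => (enorm (Z w) `^ eta)%R])%E \is a fin_num.
  rewrite ge0_fin_numE // ltNge leye_eq; apply/negP => /eqP Ey.
  by move: HL; rewrite Ey poweRyr // gt_eqF // invr_gt0.
have Eint : intg (fun w => enorm (Z w) `^ eta).
  apply/integrableP; split; first exact/measurable_EFinP.
  rewrite (eq_integral (fun w => (enorm (Z w) `^ eta)%:E)) => [|w _].
    by move: Efin; rewrite unlock ge0_fin_numE //; apply: integral_ge0 => w _; rewrite lee_fin powR_ge0.
  by rewrite /= ger0_norm // powR_ge0.
have ELE : L = Ex (fun w => enorm (Z w) `^ eta) `^ eta^-1.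
  by rewrite -expectationE -fine_poweR HL.
split => //; first by rewrite ELE powR_ge0.
rewrite ELE -powRrM mulVf ?gt_eqF // powRr1 //.
by apply: Rintegral_ge0 => // w _; exact: powR_ge0.
Qed.

(** A nonzero dual vector [th] takes integer values on the lattice, so that
    [<th, Z>^2 <= |<th, Z>|^eta] and [|th|^2 <= |th|^eta * L^eta]. *)
Lemma dual_vector_lower th : {ae P, forall w, dotv th (Z w) \is a Num.int} ->
  dotv th th <= enorm th `^ eta * L `^ eta.
Proof.
move=> thint; have [L0 Lint LE] := Z_eta_moment.
have [i1 <-] := Z_second_moment th th.
rewrite -LE -(RintegralZl _ measurableT Lint); apply: Ex_ae_le => //; first exact: intgZ.
apply: filterS thint => w /intrP[z Hz].
have eta0 : 0 < eta := lt_trans (ltr0n R 2) eta2.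
apply: (@le_trans _ _ (`|dotv th (Z w)| `^ eta)); last first.
  by rewrite -powRM ?enorm_ge0 //; apply: powR_le_base (norm_dotv _ _) => //; exact: ltW.
rewrite -expr2 -[leLHS]real_normK ?num_real // -powR_mulrn // Hz.
have [->|z0] := eqVneq z 0; first by rewrite mulr0z normr0 !powR0 // ?gt_eqF // lexx.
apply: ler_powR; last exact: ltW.
by rewrite -intr_norm ler1z -gtz0_ge1 normr_gt0.
Qed.

Lemma Ztilde_sq th : Ztilde P Z th ^+ 2 = Ex (fun w => mod1 (dotv th (Z w)) ^+ 2) /\
  intg (fun w => mod1 (dotv th (Z w)) ^+ 2).
Proof.
have mm : measurable_fun [set: T] (fun w => mod1 (dotv th (Z w)) ^+ 2).
  apply: measurable_funX; apply: (measurableT_comp (f := @mod1 R)); last exact: dotv_measurable.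
  apply: measurable_funB => //.
  apply: (@nondecreasing_measurable R setT (fun y => (Num.ceil (y - 2^-1))%:~R)) => //.
  by move=> y1 y2 y12; rewrite ler_int le_ceil // lerD2r.
split; last first.
  apply: (@intg_bounded R d T P _ 1) => // w; rewrite ger0_norm ?sqr_ge0 //.
  rewrite -[leLHS]real_normK ?num_real // exprn_ile1 //.
  by have := norm_mod1 (dotv th (Z w)); lra.
rewrite /Ztilde expectationE sqr_sqrtr.
  by apply: eq_Rintegral => w _; rewrite real_normK // num_real.
by apply: Rintegral_ge0 => // w _; exact: sqr_ge0.
Qed.

Context {A : finType} (x : A -> 'cV[R]_m).
Hypothesis x_inj : injective x.
Variable tau : R.
Hypothesis tau0 : 0 < tau.
Hypothesis cover : {ae P, forall w, (exists a, X w = x a) \/ tau < enorm (Z w)}.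
Let z a := S *m x a.

Lemma sum_mass_le1 : \sum_a mass P X x a <= 1.
Proof.
have := sum_mass_le mX x_inj (f := fun=> 1) (fun=> ler01) (intg_cst P 1).
by rewrite Ex_cst; under eq_bigr do rewrite mulr1.
Qed.

(** Markov's inequality for [|Z|^eta]. *)
Lemma sum_mass_ge : 1 - L `^ eta / tau `^ eta <= \sum_a mass P X x a.
Proof.
have [L0 Lint LE] := Z_eta_moment.
have := sum_mass_err mX x_inj (f := fun=> 1)
  (h := fun w => (tau `^ eta)^-1 * enorm (Z w) `^ eta) (intg_cst P 1) (intgZ _ Lint) _ _.
rewrite Ex_cst (RintegralZl _ measurableT Lint) LE.
under eq_bigr do rewrite mulr1.
move=> H; have {}H : `|1 - \sum_a mass P X x a| <= (tau `^ eta)^-1 * L `^ eta.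
  apply: H => [w|]; first by rewrite mulr_ge0 ?invr_ge0 ?powR_ge0.
  apply: filterS cover => w [|tZ]; [by left | right].
  rewrite normr1 mulrC ler_pdivlMr ?powR_gt0 // mul1r.
  by apply: powR_le_base; rewrite ltW // (lt_trans _ eta2).
by have := le_trans (ler_norm _) H; lra.
Qed.

Lemma sum_mass_sq u : \sum_a mass P X x a * z a u 0 ^+ 2 <= 1.
Proof.
have [i1 i2] := Z_coord_moment u u.
have := sum_mass_le mX x_inj (f := fun v => (S *m v) u 0 * (S *m v) u 0) _ i1.
rewrite i2 eqxx; apply => v; by rewrite -expr2 sqr_ge0.
Qed.

(** Outside the truncation, [|Z_u Z_v| <= |Z|^2 <= tau^(2 - eta) |Z|^eta]. *)
Lemma sum_mass_bias u v :
  `|\sum_a mass P X x a * (z a u 0 * z a v 0) - (u == v)%:R| <=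
  tau `^ (2 - eta) * L `^ eta.
Proof.
have [L0 Lint LE] := Z_eta_moment.
have [i1 i2] := Z_coord_moment u v.
have := sum_mass_err mX x_inj (f := fun y => (S *m y) u 0 * (S *m y) v 0)
  (h := fun w => tau `^ (2 - eta) * enorm (Z w) `^ eta) i1 (intgZ _ Lint) _ _.
rewrite i2 (RintegralZl _ measurableT Lint) LE distrC; apply => [w|].
  by rewrite mulr_ge0 ?powR_ge0.
apply: filterS cover => w [|tZ]; [by left | right].
have Z0 : 0 < enorm (Z w) by apply: lt_trans tZ.
apply: (@le_trans _ _ (enorm (Z w) `^ 2)).
  by rewrite powR_mulrn ?enorm_ge0 // normrM expr2 ler_pM // norm_coord.
have {1}-> : 2 = (2 - eta) + eta by lra.
rewrite powRD; last by rewrite (gt_eqF Z0) implybT.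
rewrite ler_wpM2r ?powR_ge0 //.
have -> : 2 - eta = - (eta - 2) by lra.
rewrite !powRN lef_pV2 ?posrE ?powR_gt0 //.
by apply: powR_le_base; rewrite ?ltW // subr_gt0.
Qed.

Lemma sum_mass_cos th :
  \sum_a mass P X x a * `|cos (pi * dotv th (z a))| <= 1 - Ztilde P Z th ^+ 2 / 2.
Proof.
have [-> mi] := Ztilde_sq th.
have i1 : intg (fun w => 1 - 2^-1 * mod1 (dotv th (Z w)) ^+ 2).
  by exact: (integrableB measurableT (intg_cst P 1) (intgZ _ mi)).
apply: (@le_trans _ _ (\sum_a mass P X x a * (1 - 2^-1 * mod1 (dotv th (z a)) ^+ 2))).
  apply: ler_sum => a _; rewrite ler_wpM2l ?mass_ge0 //.
  by apply: le_trans (norm_cos_mod1 _) _; rewrite mulrC.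
have := sum_mass_le mX x_inj (f := fun v => 1 - 2^-1 * mod1 (dotv th (S *m v)) ^+ 2) _ i1.
rewrite (RintegralB measurableT (intg_cst P 1) (intgZ _ mi)).
rewrite Ex_cst (RintegralZl _ measurableT mi) mulrC => H; apply: le_trans (H _) _ => // v.
have : `|mod1 (dotv th (S *m v))| ^+ 2 <= 1.
  by rewrite exprn_ile1 //; have := norm_mod1 (dotv th (S *m v)); lra.
rewrite real_normK ?num_real //; lra.
Qed.

End Normalized.

(** * Choice of the parameters *)

Section Scales.
Context {R : realType}.
Implicit Types (m n : nat) (v U : R).

Lemma powR_exprn (a b : R) k : 0 <= a -> (a `^ b) ^+ k = a `^ (b * k%:R).
Proof. by move=> a0; rewrite -powR_mulrn ?powR_ge0 // -powRrM. Qed.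

Lemma le_expR (x : R) : x <= expR x.
Proof. by have := expR_ge1Dx x; lra. Qed.

(** All powers of [n] in terms of one quantity [v], in which the failure
    probability is [v^-40].  With [w = 1 / (eta - 2)] one has
    [(eta - 2) / (eta + 2) = 1 / (4 w + 1)], and [v] is at least the base because
    [(1 + w) / (4 w + 1) >= 1 / 4] and [160 = 4 * 40]. *)
Lemma failure_scale n (eta w B : R) : 2 < eta -> w = 1 / (eta - 2) -> 1 <= B ->
  (B ^+ 160) `^ (1 + w) <= n%:R ->
  exists v : R, [/\ B <= v, v ^+ 40 = n%:R `^ ((eta - 2) / (2 + eta)), v ^+ 40 <= n%:R,
    (1 <= n)%N & ln n%:R <= 40 * (4 * w + 1) * ln v].
Proof.
move=> eta2 wE B1.
have BE : B = (B ^+ 160) `^ (160%:R)^-1.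
  rewrite -[B ^+ 160]powR_mulrn; last exact: le_trans B1.
  by rewrite -powRrM divff ?pnatr_eq0 // powRr1 //; exact: le_trans B1.
move: (B ^+ 160) BE (exprn_ege1 160 B1) => Bp BE Bp1 Bn.
have w0 : 0 < w by rewrite wE divr_gt0 //; lra.
have etaE : eta = 2 + 1 / w by rewrite wE; field; rewrite gt_eqF //; lra.
have bE : (eta - 2) / (2 + eta) = (4 * w + 1)^-1.
  by rewrite etaE; field; rewrite !gt_eqF //; lra.
have n1 : (1 : R) <= n%:R.
  by apply: le_trans Bn; rewrite -[leLHS](powRr0 Bp) ler_powR // addr_ge0 // ltW.
have c0 : 0 < 4 * w + 1 by clear -w0; lra.
exists (n%:R `^ ((4 * w + 1)^-1 / 40)); split.
- rewrite BE; apply: (@le_trans _ _ ((Bp `^ (1 + w)) `^ ((4 * w + 1)^-1 / 40))).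
    rewrite -powRrM ler_powR //.
    have -> : (1 + w) * ((4 * w + 1)^-1 / 40) = (160%:R)^-1 * ((4 + 4 * w) / (4 * w + 1)).
      by field; rewrite gt_eqF.
    by rewrite ler_peMr ?invr_ge0 // ler_pdivlMr //; clear -w0; lra.
  by apply: powR_le_base => //; rewrite ?powR_ge0 // divr_ge0 // invr_ge0 ltW.
- by rewrite powR_exprn ?ler0n // bE divfK // pnatr_eq0.
- rewrite powR_exprn ?ler0n // divfK ?pnatr_eq0 //.
  rewrite -[leRHS]powRr1 ?ler0n // ler_powR // invf_le1 //; clear -w0; lra.
- by rewrite -(ler1n R).
- rewrite ln_powR; rewrite le_eqVlt; apply/orP; left; apply/eqP.
  by move: (ln _) => l; field; rewrite gt_eqF.
Qed.

(** The truncation level [tau] balances the two losses: with [q = n ^ beta],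
    the truncated mass summed over [n] columns is [1 / q], and the covariance
    moves by [(L / q) ^ 2]. *)
Lemma truncation_scale n (eta L q : R) : 2 < eta -> 0 < L -> (0 < n)%N ->
  q = n%:R `^ ((eta - 2) / (2 + eta)) ->
  exists tau : R, [/\ 0 < tau, tau ^+ 2 * q = L ^+ 2 * n%:R,
    L `^ eta / tau `^ eta = q^-1 / n%:R & tau `^ (2 - eta) * L `^ eta = (L / q) ^+ 2].
Proof.
move=> eta2 L0 n0 qE.
have np : (0 : R) < n%:R by rewrite ltr0n.
have e0 : 2 + eta != 0 by rewrite gt_eqF //; lra.
have eta0 : 0 <= eta by lra.
set t : R := n%:R `^ (2 / (2 + eta)).
have t0 : 0 < t by rewrite powR_gt0.
have q0 : 0 < q by rewrite qE powR_gt0.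
have pD (x r s : R) : 0 < x -> x `^ r * x `^ s = x `^ (r + s).
  by move=> x0; rewrite powRD // (gt_eqF x0) implybT.
have tetaE : t `^ eta = n%:R * q.
  rewrite -[X in X * q]powRr1 ?(ltW np) // qE -powRrM pD //.
  by congr powR; field.
exists (L * t); split.
- by rewrite mulr_gt0.
- rewrite exprMn -mulrA; congr (_ * _); rewrite -powR_mulrn ?ltW // -powRrM qE pD //.
  by rewrite -[RHS]powRr1 ?ltW //; congr powR; field.
- rewrite powRM ?(ltW L0) ?(ltW t0) // tetaE invfM mulrA divff ?gt_eqF ?powR_gt0 //.
  by rewrite mul1r invfM mulrC.
- rewrite powRM ?(ltW L0) ?(ltW t0) // mulrAC pD //.
  rewrite subrK exprMn powR_mulrn ?(ltW L0) //; congr (_ * _).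
  rewrite -powRrM -[RHS]powR_mulrn ?invr_ge0 ?(ltW q0) // qE -powRN -powRrM.
  by congr powR; field.
Qed.

Lemma log_count_le (M L w U l v : R) : 1 <= M <= U -> 0 <= L <= U ->
  0 <= w -> 1 + w <= U -> 2^+10 * U <= v -> 0 <= l <= 40 * (4 * w + 1) * v ->
  40 + M ^+ 2 + U + M * (7 + l + M + (1 + 2 * w) * L) + l <= v ^+ 3.
Proof.
move=> /andP[M1 MU] /andP[L0 LU] w0 wU Uv /andP[l0 lv].
have U1 : 1 <= U by lra.
have v0 : 0 <= v by lra.
have lv2 : l <= 160 * (U * v).
  apply: le_trans lv _; rewrite mulrA; apply: ler_wpM2r => //; lra.
have UU : U <= U * U by rewrite ler_peMr //; lra.
have UUU : U * U <= U * U * U by rewrite ler_peMr // mulr_ge0; lra.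
have UvU : U * v <= U * U * v by rewrite ler_wpM2r.
have MM : M ^+ 2 <= U * U by rewrite expr2; apply: ler_pM => //; lra.
have wL : (1 + 2 * w) * L <= 2 * (U * U).
  by rewrite mulrA; apply: ler_pM => //; lra.
have big : M * (7 + l + M + (1 + 2 * w) * L) <= U * (7 + 160 * (U * v) + U + 2 * (U * U)).
  apply: ler_pM => //; first by lra.
    have : 0 <= (1 + 2 * w) * L by rewrite mulr_ge0 //; lra.
    by lra.
  by lra.
have UUv : 2^+10 * (U * U * v) <= U * v * v.
  rewrite [leRHS]mulrAC mulrA; apply: ler_wpM2r => //.
  by rewrite mulrCA; apply: ler_wpM2l => //; lra.
have Uvv : 2^+10 * (U * v * v) <= v ^+ 3.
  by rewrite !mulrA [leRHS]exprSr [v ^+ 2]expr2; do 2![apply: ler_wpM2r => //].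
have UUU2 : U * U * U <= U * U * v by apply: ler_wpM2l; rewrite ?mulr_ge0; lra.
by move: big; lra.
Qed.

Lemma le_expR_sq (y : R) : 0 <= y -> y ^+ 2 / 4 <= expR y.
Proof.
move=> y0.
have -> : y ^+ 2 / 4 = (y / 2) ^+ 2 by field.
have -> : expR y = expR (y / 2) ^+ 2 by rewrite -expRM_natl; congr expR; field.
by apply: lerXn2r; rewrite ?nnegrE ?expR_ge0 ?divr_ge0 ?le_expR.
Qed.

(** The radius [r0] of the near region satisfies [r0 ^ 2 = 2 Q / n], where
    [expR Q] exceeds [n] times the size of the torus count.  Each smallness
    condition compares a fixed power of [U <= v] with [v ^ 40 <= n]. *)
Lemma parameters m n (nu eta L w x : R) :
  let U := 1 + m%:R + nu + L + w + x ^+ 2 in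
  let Q := 40 + m%:R ^+ 2 + U + m%:R * (7 + ln n%:R + m%:R + (1 + 2 * w) * L)
           + ln n%:R in
  (0 < m)%N -> 0 <= nu -> 0 < L -> 2 < eta -> w = 1 / (eta - 2) ->
  ((2^+10 * U) ^+ 160) `^ (1 + w) <= n%:R ->
  exists dlt tau r0 : R,
  [/\ dlt = n%:R `^ (- ((eta - 2) / (2 + eta))), 0 < tau,
      L `^ eta / tau `^ eta <= dlt / n%:R,
      tau `^ (2 - eta) * L `^ eta <= (8 * m%:R)^-1 &
      2 * m%:R ^+ 2 * expR (- (n%:R / (64 * m%:R ^+ 2 * tau ^+ 2))) <= dlt] /\
  [/\ (0 < n)%N, 40 <= Q <= n%:R & n%:R^-1 <= dlt] /\
  [/\ 0 <= r0, n%:R * r0 ^+ 2 = 2 * Q, nu * r0 <= 1, 8 * (r0 * tau) <= 1 / 10 &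
      (8 * (r0 * tau)) ^+ 4 * (2^+7 * n%:R * r0 ^+ 2) <= 1 / 64].
Proof.
move=> U Q m0 nu0 L0 eta2 wE hn.
have w0 : 0 < w by rewrite wE divr_gt0 //; clear -eta2; lra.
have M1 : (1 : R) <= m%:R by rewrite ler1n.
have x20 : 0 <= x ^+ 2 by exact: sqr_ge0.
have MU : m%:R <= U by clear -nu0 L0 w0 x20; rewrite /U; lra.
have LU : L <= U by clear -nu0 M1 w0 x20; rewrite /U; lra.
have nuU : nu <= U by clear -L0 M1 w0 x20; rewrite /U; lra.
have wU : 1 + w <= U by clear -L0 M1 nu0 x20; rewrite /U; lra.
have U1 : 1 <= U by clear -w0 wU; lra.
have B1 : 1 <= 2^+10 * U by rewrite mulr_ege1 // exprn_ege1 // ler1n.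
have [v [Bv vE vn n0 lnv]] := failure_scale eta2 wE B1 hn.
have v10 : 2^+10 <= v.
  by apply: le_trans Bv; rewrite ler_peMr // exprn_ge0.
have v1 : 1 <= v by apply: le_trans Bv.
have v0 : 0 < v by apply: lt_le_trans v1.
have np : (0 : R) < n%:R by rewrite ltr0n.
have l0 : 0 <= ln (n%:R : R) by rewrite ln_ge0 // ler1n.
have Qv : Q <= v ^+ 3.
  apply: (@log_count_le _ _ w) => //; rewrite ?M1 ?(ltW L0) ?(ltW w0) //.
  rewrite l0 /=; apply: le_trans lnv _; apply: ler_wpM2l; last first.
    by rewrite -[leRHS]expRK; rewrite ler_ln ?posrE ?expR_gt0 // le_expR.
  by clear -w0; lra.
have Q40 : 40 <= Q.
  have : 0 <= m%:R * (7 + ln n%:R + m%:R + (1 + 2 * w) * L).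
    have wL0 : 0 <= (1 + 2 * w) * L.
      by rewrite mulr_ge0 ?(ltW L0) // addr_ge0 // mulr_ge0 // ltW.
    by rewrite mulr_ge0 // !addr_ge0.
  have : 0 <= (m%:R : R) ^+ 2 by exact: sqr_ge0.
  have sum4 (a b c d e : R) : 0 <= b -> 0 <= c -> 0 <= d -> 0 <= e ->
    a <= a + b + c + d + e by clear; lra.
  by move=> a0 b0; apply: sum4 => //; exact: le_trans ler01 U1.
have Q0 : 0 <= Q by apply: le_trans Q40.
move: Q Qv Q40 Q0 => Q Qv Q40 Q0.
have Uv : U <= v.
  by apply: le_trans Bv; rewrite ler_peMl ?exprn_ege1 ?ler1n // (le_trans ler01 U1).
have Lv : L <= v by exact: le_trans Uv.
have Mv : m%:R <= v by exact: le_trans Uv.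
have nuv : nu <= v by exact: le_trans Uv.
have v40 : 0 < v ^+ 40 by rewrite exprn_gt0.
have [tau [tau0 tau2 tA tB]] := truncation_scale eta2 L0 n0 vE.
exists (v ^+ 40)^-1, tau, (Num.sqrt (2 * Q / n%:R)).
set r0 : R := Num.sqrt _.
have r00 : 0 <= r0 by exact: sqrtr_ge0.
have r02 : n%:R * r0 ^+ 2 = 2 * Q.
  by rewrite sqr_sqrtr ?divr_ge0 ?mulr_ge0 // mulrC divfK ?gt_eqF.
have pw a b : (a <= b)%N -> v ^+ a <= v ^+ b by move=> ab; rewrite ler_weXn2l.
have pg a : 2^+10 * v ^+ a <= v ^+ a.+1.
  by rewrite [leRHS]exprS; apply: ler_wpM2r => //; exact/exprn_ge0/ltW.
have nuvn : nu ^+ 2 * v ^+ 4 <= n%:R.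
  apply: le_trans vn; apply: (@le_trans _ _ (v ^+ 6)); last exact: pw.
  rewrite [leRHS](exprD v 2 4); apply: ler_wpM2r; first exact/exprn_ge0/ltW.
  by apply: lerXn2r; rewrite ?nnegrE ?(ltW v0).
have Q2 : 2 * Q <= v ^+ 4.
  apply: le_trans (pg 3); apply: ler_pM => //.
  by rewrite exprS ler_peMr // exprn_ege1 // ler1n.
have h5 : (8 * (r0 * tau)) ^+ 2 * v ^+ 5 <= 1.
  have hE : (8 * (r0 * tau)) ^+ 2 * v ^+ 40 = 2^+6 * ((2 * Q) * L ^+ 2).
    have -> : (8 * (r0 * tau)) ^+ 2 * v ^+ 40 = 2^+6 * r0 ^+ 2 * (tau ^+ 2 * v ^+ 40).
      by move: (v ^+ 40) => ?; ring.
    by rewrite tau2 -r02; ring.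
  have : (8 * (r0 * tau)) ^+ 2 * v ^+ 5 * v ^+ 35 <= 1 * v ^+ 35.
    rewrite -mulrA -exprD mul1r hE; apply: le_trans (pw 7 35 isT).
    apply: le_trans (pg 6); apply: ler_pM; rewrite ?mulr_ge0 ?exprn_ge0 ?(ltW L0) //.
      by rewrite -natrX -natrX ler_nat.
    rewrite [leRHS](exprD v 4 2); apply: ler_pM => //; rewrite ?mulr_ge0 ?exprn_ge0 ?(ltW L0) //.
    by apply: lerXn2r; rewrite ?nnegrE ?(ltW v0) ?(ltW L0).
  by rewrite ler_pM2r // exprn_gt0.
have sq1 (a b : R) : 0 <= a -> 0 <= b -> a ^+ 2 <= b ^+ 2 -> a <= b.
  by move=> a0 b0; rewrite ler_sqr ?nnegrE.
have h0 : 0 <= 8 * (r0 * tau) by rewrite !mulr_ge0 // ltW.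
split; last split; last split => //.
- split => //; first by rewrite vE powRN.
  + by rewrite tA.
  + rewrite tB -[leRHS]mul1r ler_pdivlMr ?mulr_gt0 ?ltr0n //.
    have a1 : L / v ^+ 40 * v <= 1.
      rewrite mulrAC ler_pdivrMr // mul1r; apply: le_trans (pw 2 40 isT).
      by rewrite expr2; apply: ler_wpM2r => //; exact: ltW.
    have a0 : 0 <= L / v ^+ 40 by rewrite divr_ge0 // ltW.
    have m8 : 8 * m%:R <= v.
      apply: le_trans Bv; apply: ler_pM => //.
      by rewrite -natrX ler_nat.
    move: (L / v ^+ 40) a1 a0 => a a1 a0.
    have am : a * (8 * m%:R) <= 1 by apply: le_trans a1; apply: ler_wpM2l.
    have aa : a <= 1 by apply: le_trans a1; rewrite ler_peMr.
    by rewrite expr2 -mulrA -[leRHS]mulr1; apply: ler_pM => //; rewrite !mulr_ge0.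
  + set y := n%:R / _.
    have yp : v ^+ 35 <= y.
      rewrite ler_pdivlMr; last by rewrite !mulr_gt0 ?exprn_gt0 // ltr0n.
      have E (a : R) : a * (64 * m%:R ^+ 2 * tau ^+ 2) * v ^+ 40
                       = n%:R * (a * (64 * (m%:R ^+ 2 * L ^+ 2))).
        rewrite -[LHS]mulrA -[_ * _ * v ^+ 40]mulrA tau2; move: (v ^+ 40) => ?; ring.
      rewrite -(ler_pM2r v40) E; apply: ler_wpM2l => //.
      rewrite (exprD v 35 5); apply: ler_wpM2l; first exact/exprn_ge0/ltW.
      apply: le_trans (pg 4); apply: ler_pM; rewrite ?mulr_ge0 ?sqr_ge0 ?(ltW L0) //.
        by rewrite -natrX ler_nat.
      rewrite (exprD v 2 2); apply: ler_pM; rewrite ?sqr_ge0 //.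
        by apply: lerXn2r; rewrite ?nnegrE ?(ltW v0).
      by apply: lerXn2r; rewrite ?nnegrE ?(ltW v0) ?(ltW L0).
    have y0 : 0 <= y by apply: le_trans yp; exact/exprn_ge0/ltW.
    rewrite expRN ler_pdivrMr ?expR_gt0 // [leRHS]mulrC ler_pdivlMr //.
    apply: le_trans (le_expR_sq y0); rewrite ler_pdivlMr //.
    have yy : v ^+ 44 <= y ^+ 2.
      apply: le_trans (pw 44 70 isT) _; rewrite (exprM v 35 2).
      by apply: lerXn2r; rewrite ?nnegrE // exprn_ge0 // ltW.
    apply: le_trans yy; apply: le_trans (pg 43).
    have E (a : R) : 2 * m%:R ^+ 2 * a * 4 = 8 * (a * m%:R ^+ 2) by ring.
    rewrite E.
    apply: ler_pM; rewrite ?mulr_ge0 ?sqr_ge0 ?(ltW v40) ?(ltW v0) //.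
      by rewrite -natrX ler_nat.
    apply: le_trans (pw 42 43 isT); rewrite (exprD v 40 2).
    apply: ler_wpM2l; first exact: ltW.
    by apply: lerXn2r; rewrite ?nnegrE ?(ltW v0).
- split => //; last by rewrite lef_pV2 ?posrE.
  by rewrite Q40 /=; apply: le_trans Qv (le_trans (pw 3 40 isT) vn).
- apply: sq1 => //; first by rewrite mulr_ge0.
  rewrite expr1n -(ler_pM2l np) mulr1 exprMn mulrCA r02.
  by apply: le_trans nuvn; apply: ler_wpM2l => //; exact: sqr_ge0.
- apply: sq1 => //.
  have : (8 * (r0 * tau)) ^+ 2 * 100 <= 1.
    apply: le_trans h5; apply: ler_wpM2l; first exact: sqr_ge0.
    apply: le_trans (pw 1 5 isT); apply: le_trans v10.
    by rewrite -natrX ler_nat.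
  by move: ((8 * _) ^+ 2) => a; clear; lra.
- have -> : (8 * (r0 * tau)) ^+ 4 * (2^+7 * n%:R * r0 ^+ 2)
          = ((8 * (r0 * tau)) ^+ 2) ^+ 2 * (2^+7 * (2 * Q)).
    by rewrite -exprM -[_ * _ * r0 ^+ 2]mulrA r02.
  move: (_ ^+ 2) h5 (sqr_ge0 (8 * (r0 * tau))) => h h5 hh.
  rewrite ler_pdivlMr ?ltr0n // -mulrA.
  have : (h * v ^+ 5) ^+ 2 <= 1 by rewrite expr_le1 // mulr_ge0 // exprn_ge0 // ltW.
  apply: le_trans; rewrite exprMn; apply: ler_wpM2l; first exact: sqr_ge0.
  rewrite mulrAC -exprM; apply: (@le_trans _ _ (2^+10 * v ^+ 5)); last first.
    by apply: le_trans (pg 5) _; exact: pw.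
  apply: le_trans (_ : 2^+10 * (2^+10 * v ^+ 4) <= _); last first.
    by apply: ler_wpM2l; rewrite ?exprn_ge0 //; exact: pg.
  rewrite mulrA; apply: ler_pM; rewrite ?mulr_ge0 ?exprn_ge0 //.
  by rewrite -!natrX -!natrM ler_nat.
Qed.

(** The product of the lengths in a reduced basis is comparable to the
    determinant.  Rounding up costs little as every length is at least
    [expR (- a)]. *)
Lemma cell_count_le m n (D : 'M[R]_m) (x a : R) : (0 < n)%N -> (0 < m)%N -> 0 <= a ->
  \prod_i dotv (col i D) (col i D) <= 2 ^+ (m ^ 2) * \det D ^+ 2 ->
  `|\det D| = expR (- x) ->
  (forall i, 1 <= enorm (col i D) * expR a) ->
  (\prod_i (Num.truncn (6 * n%:R * m%:R * enorm (col i D))).+1)%:R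
    <= expR (m%:R ^+ 2 + (1 + x ^+ 2) + m%:R * (7 + ln n%:R + m%:R + a)).
Proof.
move=> n0 m0 a0 red detD short.
have n1 : (1 : R) <= n%:R by rewrite ler1n.
have m1 : (1 : R) <= m%:R by rewrite ler1n.
have ea : 1 <= expR a by rewrite -expR0 ler_expR.
have cell : 6 * n%:R * m%:R + expR a <= expR (7 + ln n%:R + m%:R + a).
  rewrite !expRD lnK ?posrE ?ltr0n //.
  apply: (@le_trans _ _ (7 * n%:R * m%:R * expR a)).
    have nm1 : 1 <= n%:R * m%:R :> R by rewrite mulr_ege1.
    have A : 0 <= n%:R * m%:R * (expR a - 1) by rewrite mulr_ge0 ?mulr_ge0 ?subr_ge0.
    have B : 0 <= (n%:R * m%:R - 1) * expR a by rewrite mulr_ge0 ?subr_ge0 ?expR_ge0.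
    by move: A B; clear; lra.
  apply: ler_wpM2r; first exact: expR_ge0.
  apply: ler_pM; rewrite ?mulr_ge0 ?le_expR // -subr_ge0.
  by rewrite -mulrBl mulr_ge0 // subr_ge0 le_expR.
have dirs : \prod_i enorm (col i D) <= expR (m%:R ^+ 2 + (1 + x ^+ 2)).
  have p0 : 0 <= \prod_i enorm (col i D) by apply: prodr_ge0 => i _; exact: enorm_ge0.
  apply: (@le_trans _ _ (2 ^+ (m ^ 2) * `|\det D|)).
    rewrite -ler_sqr ?nnegrE ?mulr_ge0 ?exprn_ge0 //.
    rewrite -prodrXl (eq_bigr _ (fun i _ => sqr_enorm _)) exprMn real_normK ?num_real //.
    apply: le_trans red _; apply: ler_wpM2r; first exact: sqr_ge0.
    by rewrite ler_eXnr // exprn_ege1 // ler1n.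
  rewrite detD expRD; apply: ler_pM; rewrite ?exprn_ge0 ?expR_ge0 //.
    rewrite -[m%:R ^+ 2 in leRHS]natrX -[_%:R in leRHS]mulr1 expRM_natl.
    by apply: lerXn2r; rewrite ?nnegrE ?expR_ge0 //; exact: (expR_ge1Dx 1).
  by rewrite ler_expR; nra.
rewrite natr_prod; apply: (@le_trans _ _ (\prod_i (enorm (col i D) * expR (7 + ln n%:R + m%:R + a)))).
  apply: ler_prod => i _; rewrite ler0n /= -natr1.
  apply: le_trans (ler_wpM2l (enorm_ge0 _) cell).
  rewrite mulrDr; apply: lerD => //.
  by rewrite [leRHS]mulrC truncn_le // !mulr_ge0 // enorm_ge0.
rewrite big_split /= prodr_const card_ord [leRHS]expRD; apply: ler_pM => //.
- by apply: prodr_ge0 => i _; exact: enorm_ge0.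
- by rewrite expRM_natl.
Qed.

(** The summand [ln n] of [Q] leaves a factor [1 / n] after the count [C] has been
    absorbed. *)
Lemma far_count_le n (C Q q : R) : (0 < n)%N -> 0 <= C <= expR q ->
  40 + q + ln n%:R <= Q -> Q <= n%:R ->
  40 * C * (1 - Q / n%:R) ^+ n <= n%:R^-1.
Proof.
move=> n0 /andP[C0 Cq] qQ Qn.
have np : (0 : R) < n%:R by rewrite ltr0n.
have r0 : 0 <= 1 - Q / n%:R by rewrite subr_ge0 ler_pdivrMr // mul1r.
have rn : (1 - Q / n%:R) ^+ n <= expR (- Q).
  rewrite (_ : - Q = n%:R * (- (Q / n%:R))) ?expRM_natl; last by field; rewrite gt_eqF.
  by apply: lerXn2r; rewrite ?nnegrE ?expR_ge0 // expR_ge1Dx.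
have e40 : 40 * C <= expR (40 + q) by rewrite expRD; apply: ler_pM => //; exact: le_expR.
have n1E : expR (40 + q) * expR (- Q) <= n%:R^-1.
  by rewrite -[n%:R^-1]lnK ?posrE ?invr_gt0 // lnV ?posrE // -expRD ler_expR; lra.
by apply: le_trans n1E; apply: ler_pM; rewrite ?mulr_ge0 ?exprn_ge0.
Qed.

End Scales.

(** * Reduced bases of the dual lattice *)

Section DualLattice.
Context {R : realType} {m : nat}.
Implicit Types (L : set 'cV[R]_m) (B D S : 'M[R]_m).

Lemma lattice_basis_linear L B S : S \in unitmx -> lattice_basis L B ->
  lattice_basis [set S *m x | x in L] (S *m B).
Proof.
move=> uS [uB ->]; split; first by rewrite unitmx_mul uS.
apply/seteqP; split => [_ [_ [z _ <-] <-]|_ [z _ <-]].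
  by exists z => //; rewrite mulmxA.
by exists (B *m map_mx intr z); [exists z | rewrite mulmxA].
Qed.

Lemma dual_lattice_basis L B : lattice_basis L B ->
  lattice_basis (dual_lattice L) (invmx B)^T.
Proof.
move=> LB; have [uB LE] := LB; split; first by rewrite unitmx_tr unitmx_inv.
have dE z x : dotv z (B *m x) = dotv (B^T *m z) x by rewrite dotv_mulmxr.
apply/seteqP; split => [z Hz|_ [u _ <-] l]; last first.
  rewrite LE => -[v _ <-]; rewrite dE mulmxA -trmx_mul mulVmx // trmx1 mul1mx.
  rewrite /dotv; apply: rpred_sum => i _; rewrite !mxE -intrM; exact: intr_int.
have /choice[u Hu] i : exists k : int, (B^T *m z) i 0 = k%:~R.
  apply/intrP; rewrite (_ : _ i 0 = dotv z (col i B)); last first.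
    by rewrite dotvC mxE; apply: eq_bigr => j _; rewrite !mxE.
  exact: Hz (lattice_basis_col i LB).
exists (\col_i u i) => //.
have -> : map_mx intr (\col_i u i) = B^T *m z :> 'cV[R]_m.
  by apply/colP => i; rewrite !mxE -Hu mxE.
by rewrite mulmxA -trmx_mul mulmxV // trmx1 mul1mx.
Qed.

Lemma dual_latticeK L B : lattice_basis L B -> dual_lattice (dual_lattice L) = L.
Proof.
move=> LB; have [_ ->] := dual_lattice_basis (dual_lattice_basis LB).
by have [_ ->] := LB; rewrite trmx_inv trmxK invmxK.
Qed.

Lemma lattice_basis_spanning L B : lattice_basis L B -> spanning L.
Proof.
move=> LB u Hu; have [uB _] := LB.
rewrite -[u]mul1mx -trmx1 -(mulmxV uB) trmx_mul -mulmxA.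
rewrite (_ : B^T *m u = 0) ?mulmx0 //; apply/colP => i.
rewrite [RHS]mxE -[RHS](Hu _ (lattice_basis_col i LB)) dotvC mxE.
by apply: eq_bigr => j _; rewrite !mxE.
Qed.

(** A coordinate in the basis is an inner product with a row of the inverse, and
    some coordinate of a nonzero point is at least [1] in absolute value. *)
Lemma lattice_basis_discrete L B : lattice_basis L B -> discrete_group L.
Proof.
move=> [uB ->]; split.
- by exists 0 => //; rewrite map_mx0 mulmx0.
- by move=> _ _ [x _ <-] [y _ <-]; exists (x - y) => //; rewrite map_mxB mulmxBr.
pose r i : 'cV[R]_m := (row i (invmx B))^T.
pose s := \sum_i dotv (r i) (r i).
have s0 : 0 <= s by apply: sumr_ge0 => i _; exact: dotv_ge0.
exists (1 + s)^-1; first by rewrite invr_gt0 ltr_wpDr.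
move=> _ [z _ <-] z0.
have [i zi] : exists i, z i 0 != 0.
  apply/existsP; apply: contraNT z0 => /existsPn H; apply/eqP.
  rewrite (_ : z = 0) ?map_mx0 ?mulmx0 //; apply/colP => i.
  by have := H i; rewrite negbK mxE => /eqP.
set x := B *m _.
have zE : (z i 0)%:~R = dotv (r i) x.
  rewrite dotvE trmxK -row_mul mxE mulKmx // mxE //.
have : 1 <= (dotv (r i) x) ^+ 2.
  rewrite -zE -[leRHS]real_normK ?num_real // exprn_ege1 // -intr_norm ler1z.
  by rewrite -gtz0_ge1 normr_gt0.
move=> /le_trans/(_ (cauchy_schwarz _ _)) H.
rewrite -[leLHS]mul1r ler_pdivrMr ?ltr_wpDr // mulrC.
apply: le_trans H _; apply: ler_wpM2r; first exact: dotv_ge0.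
by rewrite /s (bigD1 i) //= [leRHS]addrCA lerDl addr_ge0 // sumr_ge0 // => j _; exact: dotv_ge0.
Qed.

(** The inverse transpose of a basis of the dual is a basis of the bidual, which
    is the lattice itself. *)
Lemma dual_reduced_basis L B : lattice_basis L B ->
  exists D, [/\ lattice_basis (dual_lattice L) D, lattice_basis L (invmx D)^T &
    \prod_i dotv (col i D) (col i D) <= 2 ^+ (m ^ 2) * \det D ^+ 2].
Proof.
move=> LB; have LD := dual_lattice_basis LB.
have [D [dD DE PD]] := reduced_basis_group (lattice_basis_discrete LD) (lattice_basis_spanning LD).
have LD' : lattice_basis (dual_lattice L) D by split => //; rewrite unitmxE unitfE.
by exists D; split => //; rewrite -{1}(dual_latticeK LB); exact: dual_lattice_basis.
Qed.

End DualLattice.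

(** * Truncation, dual gap and rounding *)

Section Polynomial.
Context {R : realType}.
Implicit Types x : R.

(** It dominates each of the first four arguments and the absolute value of the
    last one, a logarithm that may be negative. *)
Definition base_poly : poly5 R :=
  let X k := mpoly.mpolyX R (mpoly.mnm1 k) in
  1 + X (@Ordinal 5 0 isT) + X (@Ordinal 5 1 isT) + X (@Ordinal 5 2 isT)
    + X (@Ordinal 5 3 isT) + X (@Ordinal 5 4 isT) ^+ 2.

Lemma eval_base_poly (a : R) k x0 x1 x2 x3 x4 :
  eval5 ((mpoly.mpolyC 5 a * base_poly) ^+ k) x0 x1 x2 x3 x4 =
  (a * (1 + x0 + x1 + x2 + x3 + x4 ^+ 2)) ^+ k.
Proof.
rewrite /eval5 /base_poly rmorphXn /= mpoly.mevalM mpoly.mevalC !mpoly.mevalD.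
by rewrite mpoly.meval1 rmorphXn /= !mpoly.mevalXU.
Qed.

End Polynomial.

Section Helpers.
Context {R : realType} {m : nat}.

(** Only finitely many values are in play, so a small enough excess over [b]
    is none. *)
Lemma excess_gap (A : finType) (f : A -> R) (b e0 : R) : 0 < e0 ->
  exists2 e, 0 < e <= e0 & forall a, f a <= b + e -> f a <= b.
Proof.
move=> e00; exists (\big[Num.min/e0]_(a | b < f a) ((f a - b) / 2)).
  by rewrite bigmin_le_id andbT lt_bigmin // => a ba; rewrite divr_gt0 // subr_gt0.
move=> a Ha; rewrite leNgt; apply/negP => ba.
have := @bigmin_le_cond _ _ _ e0 a (fun a => b < f a) (fun a => (f a - b) / 2) ba.
by move: Ha; move: (\big[_/_]_(_ | _) _) => e; lra.
Qed.

(** Coordinates of a lattice point are inner products with the dual basis, so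
    that a ball contains finitely many points. *)
Lemma finite_truncation (S W B D : 'M[R]_m) (L : set 'cV[R]_m) (tau : R) :
  D^T *m W = 1%:M -> S *m B = W -> lattice_basis L B ->
  exists (A : finType) (k : A -> 'cV[int]_m),
    [/\ injective k, forall a, enorm (W *m iv (k a)) <= tau &
      forall v, L v -> (exists a, v = B *m iv (k a)) \/ tau < enorm (S *m v)].
Proof.
move=> DW SB [_ LE].
pose M := Num.truncn ((\sum_i enorm (col i D)) * tau).
pose k (a : 'cV['I_(M + M).+1]_m) : 'cV[int]_m := \col_i ((a i 0 : nat)%:Z - M%:Z).
have k_inj : injective k.
  move=> a b /colP ab; apply/colP => i; apply/val_inj.
  by have := ab i; rewrite !mxE => /addIr [].
exists {a | enorm (W *m iv (k a)) <= tau}, (fun a => k (val a)); split.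
- by apply: inj_comp => //; exact: val_inj.
- by move=> [].
move=> v; rewrite LE => -[z _ <-]; have [zt|zt] := leP (enorm (W *m iv z)) tau; last first.
  by right; rewrite mulmxA SB.
left; have zM i : `|z i ord0| <= M%:Z.
  have tau0 : 0 <= tau by apply: le_trans zt; exact: enorm_ge0.
  have zi : (z i ord0)%:~R = dotv (col i D) (W *m iv z).
    have -> : col i D = D *m delta_mx i 0 by rewrite colE.
    rewrite dotv_mulmxl mulmxA DW mul1mx /dotv (bigD1 i) //= big1 ?addr0 => [|j ji].
      by rewrite !mxE !eqxx mul1r.
    by rewrite !mxE (negPf ji) mul0r.
  have small : enorm (col i D) * enorm (W *m iv z) < M.+1%:R.
    apply: le_lt_trans (truncnS_gt _); apply: ler_pM; rewrite ?enorm_ge0 //.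
    by rewrite (bigD1 i) //= lerDl sumr_ge0 // => j _; exact: enorm_ge0.
  rewrite -ltzD1 -(ltr_int R) intr_norm zi intrD natr1.
  exact: le_lt_trans (norm_dotv _ _) small.
have az i : (absz (z i ord0 + M%:Z)%R < (M + M).+1)%N by have := zM i; lia.
have kz : k (\col_i Ordinal (az i)) = z.
  apply/colP => i; rewrite !mxE /= gez0_abs ?addrK //.
  by have := zM i; rewrite ler_norml; lia.
have Hz : enorm (W *m iv (k (\col_i Ordinal (az i)))) <= tau by rewrite kz.
pose Q a := enorm (W *m iv (k a)) <= tau.
by exists (exist Q _ Hz) => /=; rewrite kz.
Qed.

(** Half of [s] is within the covering radius, up to [e], of a lattice point;
    doubling restores the parity of [s]. *)
Lemma lattice_half_sum (N : 'cV[R]_m -> R) (L : set 'cV[R]_m) (B : 'M[R]_m) (e : R)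
    (s : 'cV[int]_m) : is_norm N -> is_lattice L -> nondegenerate_lattice L ->
  lattice_basis L B -> 0 < e ->
  exists g : 'cV[int]_m, N (B *m iv (g *+ 2 - s)) <= 2 * (covering_radius N L + e).
Proof.
move=> HN latL ndL [_ LE] e0.
have [l Ll Nl] := covering_radius_approx HN (2^-1 *: (B *m iv s)) latL ndL e0.
have [g _ gl] : [set B *m iv z | z in [set: 'cV[int]_m]] l by rewrite -LE.
exists g.
have -> : B *m iv (g *+ 2 - s) = (- 2) *: (2^-1 *: (B *m iv s) - l).
  rewrite map_mxB mulmxBr raddfMn /= -scaler_nat -scalemxAr gl.
  by rewrite scalerBr scalerA mulNr divff ?pnatr_eq0 // scaleN1r addrC scaleNr opprK.
by rewrite (is_normZ HN) normrN ger0_norm // ler_pM2l.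
Qed.

End Helpers.

Section DualGap.
Context {R : realType} {m : nat} {d : measure_display} {T : measurableType d}.
Variables (P : probability T R) (Z : T -> 'cV[R]_m) (L : set 'cV[R]_m).

(** A frequency outside the dual is either pseudodual, and counted in the
    spanningness, or its [Ztilde] exceeds half its distance to the dual. *)
Lemma Ztilde_gap (th : 'cV[R]_m) (r : R) : dual_lattice L 0 ->
  spanningness P Z L != 0%E -> 0 <= r ->
  fine (spanningness P Z L)^-1 * r <= 1 ->
  (forall l, dual_lattice L l -> 2 * r < enorm (th - l)) -> r <= Ztilde P Z th.
Proof.
move=> L0 s0 r0 sr far.
have dist : 2 * r <= norm_dist enorm th (dual_lattice L).
  apply: lb_le_inf; first by exists (enorm (th - 0)), 0.
  by move=> _ [l Ll <-]; apply/ltW/far.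
have [pd|npd] := pselect (pseudodual P Z L th); last first.
  by move: npd; rewrite /pseudodual => /negP; rewrite -ltNge; lra.
have nth : ~ dual_lattice L th by move=> /far; rewrite subrr enorm0; lra.
have : (spanningness P Z L <= (Ztilde P Z th)%:E)%E.
  by apply: ereal_inf_lbound; exists th.
have : (0 <= spanningness P Z L)%E.
  by apply: le_ereal_inf_tmp => _ [t _ <-]; rewrite lee_fin sqrtr_ge0.
move: (spanningness _ _ _) s0 sr => [s| |] //= s0 sr.
rewrite !lee_fin => s00 sZ; have sp : 0 < s by rewrite lt_neqAle eq_sym s00 andbT.
move: sr; rewrite inver gt_eqF //= mulrC ler_pdivrMr // mul1r => rs.
exact: le_trans sZ.
Qed.

End DualGap.

Section SmallEstimates.
Context {R : realType}.
Implicit Types (e L eta w : R).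

(** With [e] the length of a dual vector, the hypothesis is the conclusion of
    [dual_vector_lower]; the power [1 / (eta - 2)] isolates [e]. *)
Lemma length_lower e L eta w : 2 < eta -> w = 1 / (eta - 2) -> 0 < e -> 0 <= L ->
  e ^+ 2 <= e `^ eta * L `^ eta -> 0 < L /\ 1 <= e * expR ((1 + 2 * w) * L).
Proof.
move=> eta2 wE e0 L0 H; have eta0 : eta != 0 by rewrite gt_eqF // (lt_trans _ eta2).
have w0 : 0 < w by rewrite wE divr_gt0 // subr_gt0.
have Lp : 0 < L.
  rewrite lt_neqAle L0 andbT eq_sym; apply/negP => /eqP LZ.
  by move: H; rewrite LZ powR0 // mulr0 leNgt exprn_gt0.
split => //; have H1 : 1 <= e `^ (eta - 2) * L `^ eta.
  rewrite -(ler_pM2l (exprn_gt0 2 e0)) mulr1 mulrA -[X in _ <= X * _ * _]powR_mulrn ?(ltW e0) // -powRD.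
    by rewrite addrC subrK.
  by rewrite (gt_eqF e0) implybT.
have H2 : 1 <= (e `^ (eta - 2) * L `^ eta) `^ w.
  by rewrite -[leLHS](powRr0 (e `^ (eta - 2) * L `^ eta)) ler_powR // ltW.
have etaE : (eta - 2) * w = 1 by rewrite wE mul1r divff // gt_eqF // subr_gt0.
apply: le_trans H2 _; rewrite powRM ?powR_ge0 // -!powRrM etaE powRr1 ?(ltW e0) //.
apply: ler_wpM2l; first exact: ltW.
have -> : eta * w = 1 + 2 * w by move: etaE; lra.
rewrite /powR gt_eqF // ler_expR; apply: ler_wpM2l.
  by rewrite addr_ge0 // mulr_ge0 // ltW.
by rewrite -[leRHS]expRK ler_ln ?posrE ?expR_gt0 // le_expR.
Qed.

(** With [e] this small, [(2 r + e)^2 <= 8 r^2 + 2 e^2] splits [n] in halves. *)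
Lemma rounding_scale (b r s e y : R) : 0 < s -> 1 <= y ->
  2^+16 * (b ^+ 2 * r ^+ 2 / s) <= y -> 0 < e <= s / (2^+14 * (b ^+ 2 + 1) + s) ->
  2^+7 * 25 * (b ^+ 2 * (2 * r + e) ^+ 2 / s) <= y.
Proof.
move=> s0 y1 by1 /andP[e0 ee].
have b0 : 0 <= b ^+ 2 by exact: sqr_ge0.
have d0 : 0 < 2^+14 * (b ^+ 2 + 1) + s by rewrite ltr_wpDl // mulr_ge0 ?exprn_ge0 // addr_ge0.
have : e * (2^+14 * (b ^+ 2 + 1) + s) <= s by rewrite -ler_pdivlMr.
move: (b ^+ 2) b0 d0 by1 {ee} => c c0 d0 cy ee.
have e1 : e <= 1.
  rewrite -(ler_pM2r s0) mul1r; apply: le_trans ee; apply: ler_wpM2l; first exact: ltW.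
  by rewrite lerDr mulr_ge0 ?exprn_ge0 // addr_ge0.
have ce : 2^+14 * (c / s * e) <= 1.
  rewrite (_ : _ * _ = e * (2^+14 * c) / s) ?ler_pdivrMr ?mul1r //; last first.
    by move: (2^+14) => ?; field; rewrite gt_eqF.
  apply: le_trans ee; apply: ler_wpM2l; first exact: ltW.
  by rewrite mulrDr -addrA lerDl addr_ge0 ?mulr1 ?exprn_ge0 // ltW.
have cq : c * (2 * r + e) ^+ 2 / s <= 8 * (c * r ^+ 2 / s) + 2 * (c / s * e).
  have -> : 8 * (c * r ^+ 2 / s) + 2 * (c / s * e) = c / s * (8 * r ^+ 2 + 2 * e).
    by field; rewrite gt_eqF.
  rewrite mulrAC; apply: ler_wpM2l; first by rewrite divr_ge0 // ltW.
  by have := sqr_ge0 (2 * r - e); nra.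
have pos : 0 <= c * r ^+ 2 / s by rewrite divr_ge0 ?(ltW s0) // mulr_ge0 ?sqr_ge0.
have pos2 : 0 <= c / s * e by rewrite mulr_ge0 ?divr_ge0 ?(ltW s0) ?(ltW e0).
apply: le_trans (ler_wpM2l _ cq) _; first by rewrite mulr_ge0 ?exprn_ge0.
move: (c * r ^+ 2 / s) (c / s * e) cy ce pos pos2 => a a' + + a0 a'0.
have -> : 2^+16 * a = 64 * (2^+10 * a).
  by rewrite (exprD 2 10 6); move: (2^+10) => ?; ring.
have -> : 2^+14 * a' = 64 * (2^+8 * a').
  by rewrite (exprD 2 8 6); move: (2^+8) => ?; ring.
move=> h h'.
rewrite [leLHS](_ : _ = 25 * (2^+10 * a) + 25 * (2^+8 * a')); last first.
  by rewrite (exprD 2 7 3) (exprD 2 7 1); move: (2^+7) => ?; ring.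
have : 0 <= 2^+10 * a by rewrite mulr_ge0 ?exprn_ge0.
have : 0 <= 2^+8 * a' by rewrite mulr_ge0 ?exprn_ge0.
move: (2^+10 * a) (2^+8 * a') h h' => p q; clear -y1; lra.
Qed.

Lemma grid_radius n (r Q : R) : (0 < n)%N -> 40 <= Q -> 0 <= r -> n%:R * r ^+ 2 = 2 * Q ->
  let r1 : R := (12 * n%:R)^-1 in 0 <= r1 <= r /\ 2^+7 * n%:R * r1 ^+ 2 <= 1.
Proof.
move=> n0 Q40 r0 rQ /=.
have n1 : (1 : R) <= n%:R by rewrite ler1n.
have np : (0 : R) < n%:R by rewrite ltr0n.
split; last first.
  rewrite [leLHS](_ : _ = (2^+7 / 144) / n%:R); last by field; rewrite gt_eqF.
  rewrite ler_pdivrMr // mul1r; apply: le_trans n1; rewrite ler_pdivrMr ?ltr0n // mul1r.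
  by rewrite -natrX ler_nat.
apply/andP; split; first by rewrite invr_ge0 mulr_ge0.
rewrite -ler_sqr ?nnegrE ?invr_ge0 ?mulr_ge0 // -(ler_pM2l np) rQ.
rewrite [leLHS](_ : _ = 144^-1 / n%:R); last by field; rewrite gt_eqF.
rewrite ler_pdivrMr //; have : 1 <= Q * n%:R by rewrite mulr_ege1 //; lra.
by lra.
Qed.

End SmallEstimates.

(** * Random matrices with lattice columns *)

(** The hypotheses of [random_signed_sums] in terms of the data.  The sum of
    columns is rounded with an excess [e] over twice the covering radius; only
    finitely many matrices survive the truncation, so for small [e] the excess
    disappears from the conclusion. *)
Lemma random_lattice_disc (R : realType) (m : nat) (N : 'cV[R]_m -> R)
    (Lat : set 'cV[R]_m) (d : measure_display) (T : measurableType d)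
    (P : probability T R) (X : T -> borelV R m) (sigma eta L : R)
    (n : nat) (d' : measure_display) (T' : measurableType d')
    (P' : probability T' R) (M : T' -> 'M[R]_(m, n)) :
  let Sigma : 'M[R]_m := second_moment_mx P X in
  let S := inv_sqrtmx Sigma in
  let Z : T -> 'cV[R]_m := fun w => S *m X w in
  let s : \bar R := spanningness P Z [set S *m x | x in Lat] in
  let w := 1 / (eta - 2) in
  let x := ln (lattice_det Lat / Num.sqrt (\det Sigma)) in
  is_norm N -> is_lattice Lat -> nondegenerate_lattice Lat ->
  measurable_fun [set: T] X -> {ae P, forall w, Lat (X w)} ->
  Lat = zspan (rv_support P X) -> has_second_moments P X ->
  least_eigenvalue Sigma sigma -> 2 < eta ->
  (('E_P[fun w => (enorm (Z w) `^ eta)%R] `^ eta^-1) = L%:E)%E ->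
  iid_copies P P' X (fun j w => col j (M w)) ->
  s != 0%E ->
  2^+16 * (max_enorm N ^+ 2 * covering_radius N Lat ^+ 2 / sigma) <= n%:R ->
  ((2^+10 * (1 + m%:R + fine (s^-1)%E + L + w + x ^+ 2)) ^+ 160) `^ (1 + w) <= n%:R ->
  (P' [set w | (disc N (M w) <= 2 * covering_radius N Lat)%R] >=
    (1 - 3 * n%:R `^ (- ((eta - 2) / (2 + eta))))%:E)%E.
Proof.
move=> Sigma S Z s w x HN latL ndL mX latX LatE X2 lam eta2 HL iid s0 n_norm n_poly.
have spL := nondegenerate_spanning ndL.
have pdS := second_moment_pos_def mX X2 spL LatE.
have uSig := pos_def_unit pdS.
have [pdI SS] := inv_sqrtmxP pdS; rewrite -/S in pdI SS.
have ST := proj1 pdI; have uS := pos_def_unit pdI.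
have m0 : (0 < m)%N.
  have /eigenvalueP[v _] := proj1 lam; rewrite lt0n; apply: contra_neq => m0.
  by apply/rowP => -[i Hi]; exfalso; move: Hi m0; lia.
have sigma0 := pos_def_eigenvalue pdS (proj1 lam).
have [L00 _ _] := Z_eta_moment mX eta2 HL.
(* [W] is the basis of the normalized lattice dual to the reduced basis [D]. *)
have [B0 LB0 _] := lattice_reduced_basis latL ndL.
have LB' := lattice_basis_linear uS LB0.
have [D [LD LW Dred]] := dual_reduced_basis LB'.
set W := (invmx D)^T in LW; have [uD _] := LD.
have DW : D^T *m W = 1%:M by rewrite /W -trmx_mul mulVmx // trmx1.
pose B := invmx S *m W.
have SB : S *m B = W by rewrite /B mulKVmx.
have LB : lattice_basis Lat B.
  rewrite (_ : Lat = [set invmx S *m y | y in [set S *m y | y in Lat]]).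
    by apply: lattice_basis_linear => //; rewrite unitmx_inv.
  apply/seteqP; split => [y Ly|_ [_ [y Ly <-] <-]]; last by rewrite mulKmx.
  by exists (S *m y); [exists y | rewrite mulKmx].
have detD : `|\det D| = expR (- x).
  have dD : \det D != 0 by rewrite -unitfE -unitmxE.
  have dS : \det S != 0 by rewrite -unitfE -unitmxE.
  rewrite /x; have -> : Num.sqrt (\det Sigma) = `|\det S|^-1.
    have : \det S ^+ 2 = (\det Sigma)^-1 by rewrite expr2 -det_mulmx SS det_inv.
    move=> /(congr1 GRing.inv); rewrite invrK => <-.
    by rewrite -exprVn sqrtr_sqr normfV.
  rewrite (lattice_detE LB) /B det_mulmx det_inv /W det_tr det_inv normrM !normfV invrK.
  rewrite mulrAC mulVf ?normr_eq0 // mul1r lnV ?posrE ?normr_gt0 // opprK lnK //.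
  by rewrite posrE normr_gt0.
clearbody B W.
have dual_int i : {ae P, forall w, dotv (col i D) (Z w) \is a Num.int}.
  apply: filterS latX => y Ly; apply: (lattice_basis_col i LD); by exists (X y).
have col0 i : 0 < enorm (col i D).
  apply: enorm_gt0; apply/negP => /eqP; rewrite colE => /(congr1 (mulmx (invmx D))).
  rewrite mulKmx // mulmx0 => /colP/(_ i)/eqP; by rewrite !mxE !eqxx oner_eq0.
have lw i : 0 < L /\ 1 <= enorm (col i D) * expR ((1 + 2 * w) * L).
  apply: (length_lower eta2 (erefl w) (col0 i) L00); rewrite sqr_enorm.
  exact: (dual_vector_lower mX X2 ST SS uSig eta2 HL (dual_int i)).
have [Lpos _] := lw (Ordinal m0).
have s_ge0 : (0 <= s)%E.
  by apply: le_ereal_inf_tmp => _ [t _ <-]; rewrite lee_fin sqrtr_ge0.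
have nu0 : 0 <= fine (s^-1)%E by rewrite fine_ge0 // inve_ge0.
have [dlt [tau [r0 [[dltE tau0 pe bias chern]]]]] := parameters m0 nu0 Lpos eta2 (erefl w) n_poly.
move=> [[n0 /andP[Q40 Qn] ndlt] [r00 nr0 nur0 r0t r0t4]].
set Q := (X in 2 * X) in nr0; rewrite -/Q in Q40 Qn.
have np : (0 : R) < n%:R by rewrite ltr0n.
have [A [k [k_inj zT cover]]] := finite_truncation tau DW SB LB.
pose y a : 'cV[R]_m := B *m iv (k a).
have y_inj : injective y.
  move=> a b /(congr1 (mulmx S)); rewrite /y !mulmxA SB.
  move=> /(congr1 (mulmx D^T)); rewrite !mulmxA DW !mul1mx => /matrixP ab.
  apply: k_inj; apply/matrixP => i j; have := ab i j; rewrite !mxE; exact: intr_inj.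
have cov : {ae P, forall w, (exists a, X w = y a) \/ tau < enorm (S *m X w)}.
  by apply: filterS latX => t; exact: cover.
have zE a : W *m iv (k a) = S *m y a by rewrite /y mulmxA SB.
have ep : 0 < sigma / (2^+14 * (max_enorm N ^+ 2 + 1) + sigma).
  by rewrite divr_gt0 // ltr_wpDl // mulr_ge0 ?exprn_ge0 // addr_ge0 // sqr_ge0.
have [e /andP[e0 e_le] He] := excess_gap (fun om : {ffun 'I_n -> A} =>
  disc N (\matrix_(i, j) y (om j) i 0)) (2 * covering_radius N Lat) ep.
have /choice[g Hg] (om : {ffun 'I_n -> A}) : exists g : 'cV[int]_m,
    N (B *m iv (g *+ 2 - \sum_j k (om j))) <= 2 * covering_radius N Lat + e.
  have e2 : 0 < e / 2 by rewrite divr_gt0.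
  have [g Ng] := lattice_half_sum (\sum_j k (om j)) HN latL ndL LB e2.
  by exists g; apply: le_trans Ng _; rewrite mulrDr [2 * (e / 2)]mulrC divfK.
pose kl om := g om *+ 2 - \sum_j k (om j).
have lam_le om : 2^+7 * 25 * dotv (W *m iv (kl om)) (W *m iv (kl om)) <= n%:R.
  set v := B *m iv (kl om).
  have -> : W *m iv (kl om) = S *m v by rewrite /v mulmxA SB.
  have -> : dotv (S *m v) (S *m v) = dotv v (invmx Sigma *m v).
    by rewrite dotv_mulmxl ST mulmxA SS.
  have n1 : (1 : R) <= n%:R by rewrite ler1n.
  apply: le_trans (rounding_scale sigma0 n1 n_norm (introT andP (conj e0 e_le))).
  apply: ler_wpM2l; first by rewrite mulr_ge0 ?exprn_ge0.
  apply: le_trans (least_eigenvalue_inv v pdS lam) _.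
  rewrite ler_pM2r ?invr_gt0 // -sqr_enorm -exprMn.
  apply: lerXn2r; rewrite ?nnegrE ?enorm_ge0 //.
    rewrite mulr_ge0 ?max_enorm_ge0 // addr_ge0 ?(ltW e0) //.
    by rewrite mulr_ge0 ?covering_radius_ge0.
  apply: le_trans (enorm_le_max HN v) _; apply: ler_wpM2l; first exact: max_enorm_ge0.
  exact: Hg.
have gap (th : 'cV[R]_m) :
    (forall u : 'cV[int]_m, r0 < enorm (th + 2^-1 *: (D *m iv u))) ->
    \sum_a mass P X y a * `|cos (2 * pi * dotv th (W *m iv (k a)))| <= 1 - Q / n%:R.
  move=> far; have r0Z : r0 <= Ztilde P Z (2 *: th).
    apply: Ztilde_gap nur0 _ => //.
      by move=> l _; rewrite dotv0l; exact: int_num0.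
    move=> l; have [_ ->] := LD; move=> [u _ <-].
    have := far (- u); rewrite map_mxN mulmxN scalerN => faru.
    have -> : 2 *: th - D *m iv u = 2 *: (th - 2^-1 *: (D *m iv u)).
      by rewrite scalerBr scalerA divff ?scale1r // pnatr_eq0.
    by rewrite enormZ ger0_norm // ltr_pM2l.
  apply: le_trans (_ : 1 - Ztilde P Z (2 *: th) ^+ 2 / 2 <= _).
    have E a : 2 * pi * dotv th (W *m iv (k a)) = pi * dotv (2 *: th) (S *m y a).
      by rewrite zE dotvZl mulrCA mulrA.
    under eq_bigr => a _ do rewrite E.
    exact: sum_mass_cos.
  have : r0 ^+ 2 <= Ztilde P Z (2 *: th) ^+ 2.
    by apply: lerXn2r; rewrite ?nnegrE ?sqrtr_ge0.
  have -> : r0 ^+ 2 = 2 * (Q / n%:R) by rewrite mulrA -nr0 mulrAC divff ?mul1r // gt_eqF.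
  by clear; lra.
pose K i := (Num.truncn (6 * n%:R * m%:R * enorm (col i D))).+1.
have [r1r0 nr1] := grid_radius n0 Q40 r00 nr0.
set r1 : R := (12 * n%:R)^-1 in r1r0 nr1.
have KD i : m%:R * enorm (col i D) <= 2 * r1 * (K i)%:R.
  have -> : 2 * r1 * (K i)%:R = (K i)%:R / (6 * n%:R).
    by rewrite /r1; move: (K i)%:R => ?; field; rewrite gt_eqF.
  rewrite ler_pdivlMr ?mulr_gt0 // mulrC mulrA; apply: ltW; exact: truncnS_gt.
have w0 : 0 < w by rewrite divr_gt0 // subr_gt0.
have a0 : 0 <= (1 + 2 * w) * L.
  by rewrite mulr_ge0 ?(ltW Lpos) // addr_ge0 // mulr_ge0 // ltW.
have count := cell_count_le n0 m0 a0 Dred detD (fun i => proj2 (lw i)).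
have fardlt : 40 * (\prod_i K i)%:R * (1 - Q / n%:R) ^+ n <= dlt.
  apply: le_trans ndlt; apply: far_count_le (n0) _ _ Qn; first by rewrite ler0n; exact: count.
  rewrite /Q; move: (ler0n R m) Lpos w0 nu0; clear; set t := m%:R * _; lra.
have rho0 : 0 <= 1 - Q / n%:R by rewrite subr_ge0 ler_pdivrMr // mul1r.
have pe' : 1 - dlt / n%:R <= \sum_a mass P X y a.
  have := sum_mass_ge mX eta2 HL y_inj tau0 cov; move: pe; clear; lra.
have var u : \sum_a mass P X y a * (W *m iv (k a)) u 0 ^+ 2 <= 1.
  under eq_bigr => a _ do rewrite zE.
  exact: (sum_mass_sq mX X2 ST SS uSig y_inj u).
have bias' u v : `|\sum_a mass P X y a * ((W *m iv (k a)) u 0 * (W *m iv (k a)) v 0)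
                   - (u == v)%:R| <= (8 * m%:R)^-1.
  apply: le_trans bias; under eq_bigr => a _ do rewrite zE.
  exact: (sum_mass_bias mX X2 ST SS uSig eta2 HL y_inj tau0 cov).
have klg om : kl om + \sum_j k (om j) = g om *+ 2 by rewrite subrK.
have [good Hgood good_ok] := random_signed_sums (mass_ge0 P X y) (sum_mass_le1 P mX y_inj)
  DW m0 n0 pe' zT tau0 var bias' chern klg lam_le rho0 r1r0 r0t r0t4 nr1
  (fun i => ltn0Sn _) KD gap fardlt.
rewrite -dltE; have [mY _ _] := iid.
have mB : measurable [set t | disc N (M t) <= 2 * covering_radius N Lat].
  by apply: disc_measurable.
apply: (@le_trans _ _ (\sum_(om | good om) prodw (mass P X y) om)%:E); first by rewrite lee_fin.
apply: (sum_prodw_mass_le mX y_inj iid mB).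
move=> om t gom Yt /=.
have -> : M t = \matrix_(i, j) y (om j) i 0.
  by apply/matrixP => i j; have := Yt j => /matrixP/(_ i 0); rewrite !mxE.
apply: He; apply/(disc_le_ex HN).
have [b kb] := good_ok om gom; exists [ffun j => b j].
rewrite (_ : _ *m _ = B *m iv (kl om)); first exact: Hg.
rewrite kb raddf_sum mulmx_sumr; apply/colP => i; rewrite summxE mxE.
apply: eq_bigr => j _; rewrite mxE [X in _ * X]mxE ffunE.
case: (b j); rewrite /= ?map_mxN ?mulmxN ?mulr1 // mulrN1.
by rewrite [RHS]mxE.
Qed.

Theorem corollary4p11 (R : realType) :
  exists (c : R) (p : poly5 R),
    0 < c /\
    (forall x0 x1 x2 x3 x4 : R, 0 <= x0 -> 0 <= x1 -> 0 <= x2 -> 0 <= x3 ->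
       0 <= eval5 p x0 x1 x2 x3 x4) /\
    forall (m : nat) (N : 'cV[R]_m -> R) (Lat : set 'cV[R]_m)
      (d : measure_display) (T : measurableType d) (P : probability T R)
      (X : T -> borelV R m) (sigma eta L : R),
    let Sigma : 'M[R]_m := second_moment_mx P X in
    let Z : T -> 'cV[R]_m := fun w => inv_sqrtmx Sigma *m X w in
    let s : \bar R :=
      spanningness P Z [set inv_sqrtmx Sigma *m x | x in Lat] in
    let N3 : \bar R :=
      if s == 0%E then +oo%E else
      (c * Num.max
        (max_enorm N ^+ 2 * covering_radius N Lat ^+ 2 / sigma)
        (eval5 p m%:R (fine (s^-1)%E) L (1 / (eta - 2))
           (ln (lattice_det Lat / Num.sqrt (\det Sigma)))
         `^ (1 + 1 / (eta - 2))))%:E in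
    is_norm N ->
    is_lattice Lat ->
    nondegenerate_lattice Lat ->
    measurable_fun [set: T] X ->
    {ae P, forall w, Lat (X w)} ->
    Lat = zspan (rv_support P X) ->
    has_second_moments P X ->
    least_eigenvalue Sigma sigma ->
    2 < eta ->
    (('E_P[fun w => (enorm (Z w) `^ eta)%R] `^ eta^-1) = L%:E)%E ->
    forall (n : nat) (d' : measure_display) (T' : measurableType d')
      (P' : probability T' R) (M : T' -> 'M[R]_(m, n)),
    iid_copies P P' X (fun j w => col j (M w)) ->
    (N3 <= n%:R%:E)%E ->
    (P' [set w | (disc N (M w) <= 2 * covering_radius N Lat)%R] >=
      (1 - 3 * n%:R `^ (- ((eta - 2) / (2 + eta))))%:E)%E.
Proof.
(* The factor [2^16] is the one of [rounding_scale]; the power of the polynomial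
   is the one of [parameters]. *)
exists (2^+16), ((mpoly.mpolyC 5 (2^+10) * base_poly) ^+ 160).
split; first by rewrite exprn_gt0.
split=> [x0 x1 x2 x3 x4 h0 h1 h2 h3|m N Lat d T P X sigma eta L Sigma Z s N3].
  by rewrite eval_base_poly exprn_ge0 // mulr_ge0 ?exprn_ge0 // !addr_ge0 // sqr_ge0.
move=> HN latL ndL mX latX LatE X2 lam eta2 HL n d' T' P' M iid.
rewrite /N3; case: (eqVneq s 0%E) => [_|s0] /=; first by rewrite leye_eq.
rewrite lee_fin eval_base_poly => hn.
have c0 : (0 : R) <= 2^+16 by rewrite exprn_ge0.
have c1 : (1 : R) <= 2^+16 by rewrite exprn_ege1 // ler1n.
apply: (random_lattice_disc HN latL ndL mX latX LatE X2 lam eta2 HL iid s0).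
  by apply: le_trans hn; apply: ler_wpM2l => //; rewrite le_max lexx.
have max_ge (a b : R) : 0 <= b -> b <= 2^+16 * Num.max a b.
  move=> b0; apply: (@le_trans _ _ (Num.max a b)); first by rewrite le_max lexx orbT.
  by rewrite ler_peMl // le_max b0 orbT.
by apply: le_trans hn; apply: max_ge; exact: powR_ge0.
Qed.
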